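(* For an integer $k\ge 0$ and complex $z$ define $\mathscr S_k(z)=\sum_{n=0}^{\infty}\frac{z^n}{(2n+1)^k\binom{2n}{n}}$ (whenever the series converges). Then: (a) For integers $k\ge2$, $N\ge3$ and any integer $m$, \[ \mathscr S_k\Bigl(4\sin^2\frac{2m\pi}{N}\Bigr)\sin\frac{2m\pi}{N}\in i\,\mathfrak Z_k(\operatorname{lcm}(2,N)). \] (b) For every integer $k\ge2$: $\mathscr S_k(-9/4)\in\mathfrak Z_k(6)$; $\mathscr S_k(-4)\in\mathfrak Z_k(8)$; $\sqrt2\,\mathscr S_k(-1/2)\in\mathfrak Z_k(8)$; $\mathscr S_k(-1)\in\mathfrak Z_k(10)$; $\sqrt5\,\mathscr S_k(-16/5)\in\mathfrak Z_k(10)$; $\sqrt3\,\mathscr S_k(-4/3)\in\mathfrak Z_k(12)$.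
   Context: For positive integers $s_1,\dots,s_m$ and complex $z_1,\dots,z_m$, $\operatorname{Li}_{s_1,\dots,s_m}(z_1,\dots,z_m)=\sum_{n_1>\cdots>n_m\ge1} \frac{z_1^{n_1}\cdots z_m^{n_m}}{n_1^{s_1}\cdots n_m^{s_m}}$ (when convergent). For positive integers $k,N$, $\mathfrak Z_k(N)$ is the $\mathbb Q$-linear span of all $\operatorname{Li}_{s_1,\dots,s_m}(z_1,\dots,z_m)$ with $s_j\in\mathbb Z_{>0}$, $\sum_j s_j=k$, $z_j^N=1$ for all $j$, and $(s_1,z_1)\neq(1,1)$ (cyclotomic multiple zeta values of weight $k$ and level $N$); $\mathfrak Z_0(N)=\mathbb Q$. $i\,\mathfrak Z_k(M)=\{ix:x\in\mathfrak Z_k(M)\}$, and $\operatorname{lcm}(a,b)$ is the least common multiple. *)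

(* Defs.v *)
From Stdlib Require Import Reals QArith Qreals List.
From Coquelicot Require Import Coquelicot.
Open Scope R_scope.

Fixpoint cpow (z : C) (n : nat) : C :=
  match n with O => RtoC 1 | S n' => Cmult z (cpow z n') end.

Fixpoint csum (f : nat -> C) (M : nat) : C :=
  match M with O => RtoC 0 | S M' => Cplus (csum f M') (f M') end.

(* Truncated multiple polylogarithm:
   LiT [(s1,z1);...;(sm,zm)] M = sum_{M > n1 > ... > nm >= 1} prod z_j^{n_j}/n_j^{s_j}.
   (empty list gives 1) *)
Fixpoint LiT (l : list (nat * C)) (M : nat) : C :=
  match l with
  | nil => RtoC 1
  | (s, z) :: r =>
      csum (fun j => Cmult (Cdiv (cpow z (S j)) (cpow (RtoC (INR (S j))) s))
                           (LiT r (S j))) (pred M)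
  end.

Definition is_Li (l : list (nat * C)) (L : C) : Prop :=
  filterlim (fun M => LiT l M) eventually (@locally C_UniformSpace L).

Definition sum_weights (l : list (nat * C)) : nat :=
  List.fold_right (fun p acc => (fst p + acc)%nat) O l.

Definition cmzv_index (k N : nat) (l : list (nat * C)) : Prop :=
  List.Forall (fun p => (0 < fst p)%nat /\ cpow (snd p) N = RtoC 1) l /\
  sum_weights l = k /\
  match l with
  | nil => True
  | (s, z) :: _ => ~ (s = 1%nat /\ z = RtoC 1)
  end.

(* x lies in the Q-linear span Z_k(N) of CMZVs of weight k and level N.
   (For k = 0 the only index is the empty one, with value 1, giving Q.) *)
Definition in_CMZV (k N : nat) (x : C) : Prop :=
  exists terms : list (Q * list (nat * C) * C),
    List.Forall (fun t => cmzv_index k N (snd (fst t)) /\ is_Li (snd (fst t)) (snd t))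
      terms /\
    x = List.fold_right (fun t acc => Cplus (Cmult (RtoC (Q2R (fst (fst t)))) (snd t)) acc)
          (RtoC 0) terms.

Definition in_iCMZV (k N : nat) (x : C) : Prop :=
  exists y : C, in_CMZV k N y /\ x = Cmult Ci y.

Definition S_term (k : nat) (z : C) (n : nat) : C :=
  Cdiv (cpow z n)
       (Cmult (cpow (RtoC (INR (2 * n + 1))) k) (RtoC (Binomial.C (2 * n) n))).

Definition is_S (k : nat) (z : C) (L : C) : Prop :=
  @is_series C_AbsRing C_NormedModule (S_term k z) L.

(* Main.v *)
(* Substituting z = -(q - 1/q)^2 and u = (q - 1/q)/2, the function f_k = u S_k(z) satisfies
     f_k' / f_{k-1} = dlog (q - 1/q)  (k >= 3),    f_2' = log q . dlog ((q - 1)/(q + 1)),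
   and vanishes at q = 1: it is an iterated integral of weight k starting at q = 1.  On the unit
   circle q itself is a root of unity; in the six real cases a Moebius map q = q(x) carries
   q = 1, 0, -1, infinity and the end point to roots of unity in the variable x.  Either way f_k is
   integrated along the chord between two roots of unity against forms dx/(x - w), w = 0 or w^N = 1.

   Such functions are polynomials in log x whose coefficients are power series with coefficients
   built from truncated multiple polylogarithms, and this class is stable under integration.
   To evaluate at an end point, the partial sums of the power series are expanded by the stuffle
   product in the truncated sums of (1,...,1), with coefficients in the algebra of cyclotomic
   multiple zeta values, up to o(1).  By Abel's theorem (the chord is non-tangential) the function
   is then, up to o(1), a combination of the series of (1,...,1), which are polynomials of exact
   degree j in the logarithm of the distance to the end point; if it has a limit, only the constant
   term survives, and it is a cyclotomic multiple zeta value of the right weight. *)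

Require Import Defs.
From Stdlib Require Import Reals QArith Qreals ZArith Lia Lra.
From Coquelicot Require Import Coquelicot.
From Stdlib Require Import List.
Import ListNotations.
Open Scope R_scope.

(** * Truncated sums and the stuffle product *)

(** The [f_k] are kept as genuine power series in [u], never as abstract continuations. Hence
    [|u| < 1] must hold inside the whole path, and only at its far end may [|u| = 1] occur. This is
    the source of the polynomial inequalities below and of the reduction to end points with
    non-negative real part on the unit circle. Both ends of the chord matter. A primitive found in
    the class is correct only up to a constant, which is its regularised value at the start; so the
    evaluation at end points enters every integration, not just the last one. At the far end the
    powers of [log x] bring in [log b], which must itself be shown to be a cyclotomic value of
    weight one; it is obtained from [log (1 + x)], with -1 as a pole. The Moebius maps come from
    cross-ratios: roots of unity lie on a circle, so four of them have a real cross-ratio. One looks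
    for roots [z0], [zm], [zi] such that [1], [zm] and [z0], [zi] form a harmonic quadruple; the
    image [q0] of the end point is then a quotient of sines. *)

Lemma cpow_Cpow z n : cpow z n = Cpow z n.
Proof. induction n as [|n IH]; simpl; [reflexivity|now rewrite IH]. Qed.

Lemma Cinv_0 : Cinv (RtoC 0) = RtoC 0.
Proof. unfold Cinv, RtoC; simpl. f_equal; unfold Rdiv; ring. Qed.

Lemma Cpow_0_l n : (0 < n)%nat -> Cpow (RtoC 0) n = RtoC 0.
Proof. destruct n as [|n]; [lia|]. intros _. simpl. ring. Qed.

Lemma csum_S f M : csum f (S M) = (csum f M + f M)%C.
Proof. reflexivity. Qed.

Lemma csum_ext f g M : (forall n, (n < M)%nat -> f n = g n) -> csum f M = csum g M.
Proof.
  induction M as [|M IH]; intros H; simpl; [reflexivity|].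
  rewrite IH by (intros; apply H; lia). now rewrite H by lia.
Qed.

Lemma csum_plus f g M : csum (fun n => f n + g n)%C M = (csum f M + csum g M)%C.
Proof. induction M as [|M IH]; simpl; [ring|rewrite IH; ring]. Qed.

Lemma csum_scal c f M : csum (fun n => c * f n)%C M = (c * csum f M)%C.
Proof. induction M as [|M IH]; simpl; [ring|rewrite IH; ring]. Qed.

Lemma csum_0 M : csum (fun _ => RtoC 0) M = RtoC 0.
Proof. induction M as [|M IH]; simpl; [reflexivity|rewrite IH; ring]. Qed.

Lemma csum_first f M : csum f (S M) = (f O + csum (fun n => f (S n)) M)%C.
Proof. induction M as [|M IH]; [simpl; ring|]. rewrite csum_S, IH, csum_S. ring. Qed.

(** The summation may begin at [n = 0] because inversion sends 0 to 0 and [s > 0]. Indexing from 0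
    makes every truncated sum a partial sum of a power series. *)
Lemma LiT_csum s z r M : (0 < s)%nat ->
  LiT ((s, z) :: r) M
  = csum (fun n => (Cpow z n / Cpow (RtoC (INR n)) s * LiT r n)%C) M.
Proof.
  intros Hs. destruct M as [|M]; [reflexivity|].
  rewrite csum_first. simpl (INR 0). rewrite Cpow_0_l by exact Hs.
  unfold Cdiv at 1. rewrite Cinv_0.
  change (LiT ((s,z)::r) (S M)) with
    (csum (fun j => ((cpow z (S j) / cpow (RtoC (INR (S j))) s) * LiT r (S j))%C) M).
  rewrite (csum_ext _ (fun n => (Cpow z (S n) / Cpow (RtoC (INR (S n))) s * LiT r (S n))%C))
    by (intros; now rewrite !cpow_Cpow).
  ring.
Qed.

Definition word (N : nat) (l : list (nat * C)) : Prop :=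
  Forall (fun p => (0 < fst p)%nat /\ cpow (snd p) N = RtoC 1) l.

Definition admissible (l : list (nat * C)) : Prop :=
  match l with nil => True | (s, z) :: _ => ~ (s = 1%nat /\ z = RtoC 1) end.

(** The three lists correspond to [n > n'], [n < n'] and [n = n'] for the outermost indices. The
    inner [fix] makes the recursion on the pair structural. *)
Fixpoint stuffle (l l' : list (nat * C)) {struct l} : list (list (nat * C)) :=
  match l with
  | nil => [l']
  | (s, z) :: r =>
      (fix st (l' : list (nat * C)) : list (list (nat * C)) :=
         match l' with
         | nil => [(s, z) :: r]
         | (s', z') :: r' =>
             map (cons (s, z)) (stuffle r ((s', z') :: r'))
             ++ map (cons (s', z')) (st r')
             ++ map (cons ((s + s')%nat, (z * z')%C)) (stuffle r r')
         end) l'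
  end.

Lemma stuffle_cons s z r s' z' r' :
  stuffle ((s, z) :: r) ((s', z') :: r')
  = map (cons (s, z)) (stuffle r ((s', z') :: r'))
    ++ map (cons (s', z')) (stuffle ((s, z) :: r) r')
    ++ map (cons ((s + s')%nat, (z * z')%C)) (stuffle r r').
Proof. reflexivity. Qed.

Lemma stuffle_nil_r l : stuffle l [] = [l].
Proof. destruct l as [|[s z] r]; reflexivity. Qed.

Definition LiTs (ws : list (list (nat * C))) (M : nat) : C :=
  fold_right (fun w acc => (LiT w M + acc)%C) (RtoC 0) ws.

Lemma LiTs_app w1 w2 M : LiTs (w1 ++ w2) M = (LiTs w1 M + LiTs w2 M)%C.
Proof. induction w1 as [|w w1 IH]; simpl; [ring|rewrite IH; ring]. Qed.

Lemma LiTs_map_cons s z ws M : (0 < s)%nat ->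
  LiTs (map (cons (s, z)) ws) M
  = csum (fun n => (Cpow z n / Cpow (RtoC (INR n)) s * LiTs ws n)%C) M.
Proof.
  intros Hs. induction ws as [|w ws IH].
  - simpl. rewrite (csum_ext _ (fun _ => RtoC 0)) by (intros; ring). now rewrite csum_0.
  - change (LiTs (map (cons (s, z)) (w :: ws)) M)
      with (LiT ((s, z) :: w) M + LiTs (map (cons (s, z)) ws) M)%C.
    rewrite IH, LiT_csum, <- csum_plus by exact Hs.
    apply csum_ext; intros n _. simpl. ring.
Qed.

Lemma stuffle_shape N l l' : word N l -> word N l' ->
  Forall (fun w => word N w /\ sum_weights w = (sum_weights l + sum_weights l')%nat)
    (stuffle l l').
Proof.
  revert l'. induction l as [|[s z] r IHl]; intros l' Hl Hl'.
  - simpl. constructor; [split; [assumption|reflexivity]|constructor].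
  - induction l' as [|[s' z'] r' IHl'].
    + rewrite stuffle_nil_r. constructor; [|constructor]. split; [assumption|]. simpl; lia.
    + rewrite stuffle_cons.
      pose proof (Forall_inv Hl) as [Hs Hz]. pose proof (Forall_inv_tail Hl) as Hr.
      pose proof (Forall_inv Hl') as [Hs' Hz']. pose proof (Forall_inv_tail Hl') as Hr'.
      simpl in Hs, Hz, Hs', Hz'.
      rewrite !Forall_app, !Forall_map. split; [|split].
      * refine (Forall_impl _ _ (IHl _ Hr Hl')). intros w [Hw Hk]. split.
        -- constructor; [now split|assumption].
        -- simpl in Hk |- *. lia.
      * refine (Forall_impl _ _ (IHl' Hr')). intros w [Hw Hk]. split.
        -- constructor; [now split|assumption].
        -- simpl in Hk |- *. lia.
      * refine (Forall_impl _ _ (IHl _ Hr Hr')). intros w [Hw Hk]. split.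
        -- constructor; [|assumption]. simpl. split; [lia|].
           rewrite cpow_Cpow in Hz, Hz' |- *. rewrite Cpow_mult_l, Hz, Hz'. ring.
        -- simpl in Hk |- *. lia.
Qed.

Lemma LiT_stuffle N l l' M : word N l -> word N l' ->
  (LiT l M * LiT l' M)%C = LiTs (stuffle l l') M.
Proof.
  revert l' M. induction l as [|[s z] r IHl]; intros l' M Hl Hl'; [simpl; ring|].
  revert M. induction l' as [|[s' z'] r' IHl']; intros M.
  { rewrite stuffle_nil_r. simpl. ring. }
  pose proof (Forall_inv Hl) as [Hs Hz]. pose proof (Forall_inv_tail Hl) as Hr.
  pose proof (Forall_inv Hl') as [Hs' Hz']. pose proof (Forall_inv_tail Hl') as Hr'.
  simpl in Hs, Hz, Hs', Hz'.
  rewrite stuffle_cons, !LiTs_app, !LiTs_map_cons by lia.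
  induction M as [|M IHM]; [simpl; ring|].
  rewrite !csum_S, <- !IHl by assumption. rewrite <- IHl' by assumption.
  rewrite (LiT_csum s z r (S M)), (LiT_csum s' z' r' (S M)) by assumption.
  rewrite !csum_S, <- !LiT_csum by assumption.
  rewrite Cpow_mult_l, Cpow_add_r.
  set (A := LiT ((s, z) :: r) M) in *. set (B := LiT ((s', z') :: r') M) in *.
  assert (Hinv : (Cpow z M * Cpow z' M / (Cpow (RtoC (INR M)) s * Cpow (RtoC (INR M)) s'))%C
     = ((Cpow z M / Cpow (RtoC (INR M)) s) * (Cpow z' M / Cpow (RtoC (INR M)) s'))%C).
  { destruct M as [|M].
    - simpl (INR 0). rewrite !Cpow_0_l by assumption.
      unfold Cdiv. replace (0 * 0)%C with (RtoC 0) by ring. rewrite Cinv_0. ring.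
    - field. split; apply Cpow_nz; intros E; apply RtoC_inj in E;
      revert E; apply not_0_INR; lia. }
  rewrite Hinv.
  set (a := (Cpow z M / Cpow (RtoC (INR M)) s)%C) in *.
  set (b := (Cpow z' M / Cpow (RtoC (INR M)) s')%C) in *.
  (* Discrete Leibniz rule: the increment of the product [A * B] is the sum of the three stuffle
     terms. *)
  transitivity (A * B + (a * (LiT r M * B) + b * (A * LiT r' M) + a * b * (LiT r M * LiT r' M)))%C;
    [ring|].
  rewrite IHM. ring.
Qed.

Definition ones (p : nat) : list (nat * C) := repeat (1%nat, RtoC 1) p.

Lemma ones_S p : ones (S p) = (1%nat, RtoC 1) :: ones p.
Proof. reflexivity. Qed.

Lemma word_ones N p : word N (ones p).
Proof.
  induction p as [|p IH]; constructor; [|exact IH].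
  simpl. split; [lia|]. rewrite cpow_Cpow. apply Cpow_1_l.
Qed.

Lemma sum_weights_ones p : sum_weights (ones p) = p.
Proof. induction p as [|p IH]; simpl; [reflexivity|]. unfold ones in IH. now rewrite IH. Qed.

Lemma sum_weights_app l l' : sum_weights (l ++ l') = (sum_weights l + sum_weights l')%nat.
Proof. induction l as [|[s z] r IH]; simpl; [reflexivity|rewrite IH; lia]. Qed.

(** Leading letters are inherited or merged, and a merged one has exponent [s + s' >= 2], so it
    cannot be [(1, 1)]. *)
Lemma stuffle_admissible l l' :
  (forall s z r, l = (s, z) :: r -> (0 < s)%nat) ->
  (forall s z r, l' = (s, z) :: r -> (0 < s)%nat) ->
  admissible l -> admissible l' -> Forall admissible (stuffle l l').
Proof.
  intros Hl0 Hl0' Hl Hl'. destruct l as [|[s z] r]; [constructor; [assumption|constructor]|].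
  destruct l' as [|[s' z'] r']; [constructor; [assumption|constructor]|].
  specialize (Hl0 _ _ _ eq_refl). specialize (Hl0' _ _ _ eq_refl).
  rewrite stuffle_cons, !Forall_app, !Forall_map.
  split; [|split]; apply Forall_forall; intros w _; simpl in *; try assumption.
  intros [E _]. lia.
Qed.

(* Only the first word of the stuffle of [1^p] with [v] keeps all [p] ones in front. *)
Lemma stuffle_ones N p v : word N v -> admissible v ->
  exists rest, stuffle (ones p) v = (ones p ++ v) :: rest /\
    Forall (fun w => exists i u, (i < p)%nat /\ w = ones i ++ u /\ admissible u) rest.
Proof.
  intros Hv Hc. induction p as [|p (rest & E & Hrest)].
  - exists []. split; [reflexivity|constructor].
  - destruct v as [|[s z] r].
    { exists []. rewrite stuffle_nil_r, app_nil_r. split; [reflexivity|constructor]. }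
    rewrite ones_S, stuffle_cons, E.
    exists (map (cons (1%nat, RtoC 1)) rest
            ++ map (cons (s, z)) (stuffle (ones (S p)) r)
            ++ map (cons ((1 + s)%nat, (RtoC 1 * z)%C)) (stuffle (ones p) r)).
    split; [reflexivity|].
    rewrite !Forall_app, !Forall_map. split; [|split].
    + refine (Forall_impl _ _ Hrest). intros w (i & u & Hi & -> & Hu).
      exists (S i), u. repeat split; [lia|assumption].
    + apply Forall_forall; intros w _. exists O, ((s, z) :: w).
      repeat split; [lia|exact Hc].
    + apply Forall_forall; intros w _. exists O. eexists. split; [lia|].
      split; [reflexivity|]. pose proof (Forall_inv Hv) as [Hs _]. simpl in Hs |- *.
      intros [Es _]. lia.
Qed.

Lemma word_split l : exists p v, l = ones p ++ v /\ admissible v.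
Proof.
  induction l as [|[s z] r (p & v & E & Hv)]; [exists O, []; now split|].
  destruct (Nat.eq_dec s 1) as [->|Hs].
  - destruct (Ceq_dec z (RtoC 1)) as [->|Hz].
    + exists (S p), v. rewrite E. now split.
    + exists O, ((1%nat, z) :: r). split; [reflexivity|]. simpl. tauto.
  - exists O, ((s, z) :: r). split; [reflexivity|]. simpl. tauto.
Qed.

(** * Limits of complex sequences *)

Definition Clim (a : nat -> C) (L : C) : Prop :=
  forall eps, 0 < eps -> exists n0, forall n, (n0 <= n)%nat -> Cmod (a n - L) < eps.

Lemma Clim_ext_from n0 a b L : (forall n, (n0 <= n)%nat -> a n = b n) -> Clim a L -> Clim b L.
Proof.
  intros E H eps He. destruct (H eps He) as [n1 H1]. exists (n0 + n1)%nat.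
  intros n Hn. rewrite <- E by lia. apply H1. lia.
Qed.

Lemma Clim_const c : Clim (fun _ => c) c.
Proof.
  intros eps He. exists O. intros n _. replace (c - c)%C with (RtoC 0) by ring. now rewrite Cmod_0.
Qed.

Lemma Clim_plus a b A B : Clim a A -> Clim b B -> Clim (fun n => a n + b n)%C (A + B)%C.
Proof.
  intros Ha Hb eps He. destruct (Ha (eps / 2)) as [n1 H1]; [lra|].
  destruct (Hb (eps / 2)) as [n2 H2]; [lra|]. exists (n1 + n2)%nat. intros n Hn.
  replace (a n + b n - (A + B))%C with ((a n - A) + (b n - B))%C by ring.
  eapply Rle_lt_trans; [apply Cmod_triangle|].
  specialize (H1 n ltac:(lia)). specialize (H2 n ltac:(lia)). lra.
Qed.

Lemma Clim_scal c a A : Clim a A -> Clim (fun n => c * a n)%C (c * A)%C.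
Proof.
  intros Ha eps He. pose proof (Cmod_ge_0 c) as Hc.
  destruct (Ha (eps / (Cmod c + 1))) as [n1 H1].
  { apply Rdiv_lt_0_compat; lra. }
  exists n1. intros n Hn. replace (c * a n - c * A)%C with (c * (a n - A))%C by ring.
  rewrite Cmod_mult. specialize (H1 n Hn).
  pose proof (Cmod_ge_0 (a n - A)) as H0.
  apply Rmult_lt_compat_r with (r := Cmod c + 1) in H1; [|lra].
  unfold Rdiv in H1. rewrite Rmult_assoc, Rinv_l, Rmult_1_r in H1 by lra. nra.
Qed.

Lemma Clim_unique a A B : Clim a A -> Clim a B -> A = B.
Proof.
  intros HA HB. destruct (Ceq_dec A B) as [E|E]; [exact E|exfalso].
  assert (Hp : 0 < Cmod (A - B)) by (apply Cmod_gt_0; now apply Cminus_eq_contra).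
  destruct (HA (Cmod (A - B) / 2)) as [n1 H1]; [lra|].
  destruct (HB (Cmod (A - B) / 2)) as [n2 H2]; [lra|].
  specialize (H1 (n1 + n2)%nat ltac:(lia)). specialize (H2 (n1 + n2)%nat ltac:(lia)).
  assert (Hle : Cmod (A - B) <= Cmod (a (n1 + n2)%nat - B) + Cmod (a (n1 + n2)%nat - A)).
  { replace (A - B)%C with ((a (n1 + n2)%nat - B) + - (a (n1 + n2)%nat - A))%C by ring.
    rewrite <- (Cmod_opp (a (n1 + n2)%nat - A)). apply Cmod_triangle. }
  lra.
Qed.

Lemma Clim_mult a b A B : Clim a A -> Clim b B -> Clim (fun n => a n * b n)%C (A * B)%C.
Proof.
  intros Ha Hb.
  assert (H0 : Clim (fun n => (a n - A) * (b n - B))%C (RtoC 0)).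
  { intros eps He. destruct (Ha 1 ltac:(lra)) as [n1 H1]. destruct (Hb eps He) as [n2 H2].
    exists (n1 + n2)%nat. intros n Hn. specialize (H1 n ltac:(lia)). specialize (H2 n ltac:(lia)).
    replace ((a n - A) * (b n - B) - 0)%C with ((a n - A) * (b n - B))%C by ring.
    rewrite Cmod_mult. pose proof (Cmod_ge_0 (a n - A)). pose proof (Cmod_ge_0 (b n - B)). nra. }
  pose proof (Clim_plus _ _ _ _ (Clim_plus _ _ _ _ H0 (Clim_scal A _ _ Hb))
                (Clim_plus _ _ _ _ (Clim_scal B _ _ Ha) (Clim_const (- (A * B))%C))) as H.
  replace (0 + A * B + (B * A + - (A * B)))%C with (A * B)%C in H by ring.
  refine (Clim_ext_from O _ _ _ _ H). intros n _. simpl. ring.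
Qed.

Lemma Clim_le a L b K n0 : Clim a L ->
  (forall n, (n0 <= n)%nat -> Cmod (a n - b) <= K) -> Cmod (L - b) <= K.
Proof.
  intros H Hle. apply le_epsilon. intros eps He.
  destruct (H eps He) as [n1 H1]. specialize (H1 (n0 + n1)%nat ltac:(lia)).
  specialize (Hle (n0 + n1)%nat ltac:(lia)).
  replace (L - b)%C with (- (a (n0 + n1)%nat - L) + (a (n0 + n1)%nat - b))%C by ring.
  eapply Rle_trans; [apply Cmod_triangle|]. rewrite Cmod_opp. lra.
Qed.

Lemma Re_sub_le a b : Rabs (fst a - fst b) <= Cmod (a - b).
Proof.
  eapply Rle_trans; [|apply Rmax_Cmod]. eapply Rle_trans; [|apply Rmax_l].
  apply Req_le. f_equal.
Qed.

Lemma Im_sub_le a b : Rabs (snd a - snd b) <= Cmod (a - b).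
Proof.
  eapply Rle_trans; [|apply Rmax_Cmod]. eapply Rle_trans; [|apply Rmax_r].
  apply Req_le. f_equal.
Qed.

Lemma Cmod_le_abs (z : C) : Cmod z <= Rabs (fst z) + Rabs (snd z).
Proof.
  destruct z as [x y]; simpl. replace (x, y) with (RtoC x + Ci * RtoC y)%C.
  - eapply Rle_trans; [apply Cmod_triangle|]. rewrite Cmod_mult, Cmod_Ci, !Cmod_R. lra.
  - unfold Cplus, Cmult, Ci, RtoC; simpl. f_equal; ring.
Qed.

Lemma C_complete (a : nat -> C) :
  (forall eps, 0 < eps -> exists n0, forall n, (n0 <= n)%nat -> Cmod (a n - a n0) < eps) ->
  exists L, Clim a L.
Proof.
  intros H.
  assert (Hc : forall p : C -> R, (forall x y, Rabs (p x - p y) <= Cmod (x - y)) ->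
             exists l, Un_cv (fun n => p (a n)) l).
  { intros p Hp. destruct (Rcomplete.R_complete (fun n => p (a n))) as [l Hl]; [|now exists l].
    intros eps He. destruct (H (eps / 2)) as [n0 H0]; [lra|]. exists n0. intros n m Hn Hm.
    unfold Rdist. pose proof (Hp (a n) (a n0)). pose proof (Hp (a m) (a n0)).
    specialize (H0 n ltac:(lia)) as Hn0. specialize (H0 m ltac:(lia)) as Hm0.
    replace (p (a n) - p (a m)) with ((p (a n) - p (a n0)) + - (p (a m) - p (a n0))) by ring.
    eapply Rle_lt_trans; [apply Rabs_triang|]. rewrite Rabs_Ropp. lra. }
  destruct (Hc fst Re_sub_le) as [x Hx]. destruct (Hc snd Im_sub_le) as [y Hy].
  exists (x, y). intros eps He. destruct (Hx (eps / 2)) as [n1 H1]; [lra|].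
  destruct (Hy (eps / 2)) as [n2 H2]; [lra|]. exists (n1 + n2)%nat. intros n Hn.
  specialize (H1 n ltac:(lia)). specialize (H2 n ltac:(lia)). unfold Rdist in *.
  eapply Rle_lt_trans; [apply Cmod_le_abs|]. simpl. unfold Rminus in *. lra.
Qed.

Lemma is_Li_Clim l L : is_Li l L <-> Clim (LiT l) L.
Proof.
  unfold is_Li. split; intros H.
  - intros eps He.
    assert (Hl : @locally C_UniformSpace L (fun y => Cmod (y - L) < eps)).
    (* Neighbourhoods are squares here: two coordinates below [eps / 2] bound the modulus by
       [eps]. *)
    { exists (mkposreal (eps / 2) ltac:(lra)). intros y Hy.
      destruct Hy as [H1 H2]. unfold ball in H1, H2; simpl in H1, H2.
      unfold AbsRing_ball, abs, minus, plus, opp in H1, H2; simpl in H1, H2.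
      eapply Rle_lt_trans; [apply Cmod_le_abs|]. simpl. lra. }
    destruct (H _ Hl) as [n0 H0]. exists n0. exact H0.
  - intros P [eps HP]. destruct (H eps (cond_pos eps)) as [n0 H0]. exists n0. intros n Hn.
    apply HP. specialize (H0 n Hn).
    split; (eapply Rle_lt_trans; [|exact H0]); [apply Re_sub_le|apply Im_sub_le].
Qed.

(** * Growth of truncated sums *)

(** This growth condition absorbs every power of [log n] and is stable under products, so no
    logarithmic exponents have to be tracked. *)
Definition slow (a : nat -> C) : Prop :=
  forall eps, 0 < eps -> exists K, 0 <= K /\
    forall n, (1 <= n)%nat -> Cmod (a n) <= K * Rpower (INR n) eps.

Lemma INR_ge_1 n : (1 <= n)%nat -> 1 <= INR n.
Proof. intros H. apply (le_INR 1 n H). Qed.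

Lemma Rpower_pos x y : 0 < Rpower x y.
Proof. apply exp_pos. Qed.

Lemma Rpower_ge_1 n eps : (1 <= n)%nat -> 0 <= eps -> 1 <= Rpower (INR n) eps.
Proof.
  intros Hn He. apply INR_ge_1 in Hn.
  rewrite <- (Rpower_O (INR n)) by lra. apply Rle_Rpower; lra.
Qed.

Lemma slow_le a b : (forall n, (1 <= n)%nat -> Cmod (a n) <= Cmod (b n)) -> slow b -> slow a.
Proof.
  intros H Hb eps He. destruct (Hb eps He) as (K & HK & HbK). exists K. split; [exact HK|].
  intros n Hn. eapply Rle_trans; [apply H|apply HbK]; exact Hn.
Qed.

Lemma slow_small_eps a :
  (forall eps, 0 < eps < 1 -> exists K, 0 <= K /\
    forall n, (1 <= n)%nat -> Cmod (a n) <= K * Rpower (INR n) eps) -> slow a.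
Proof.
  intros H eps He. destruct (H (Rmin eps (1 / 2))) as (K & HK & Hb).
  { split; [apply Rmin_glb_lt; lra|]. eapply Rle_lt_trans; [apply Rmin_r|lra]. }
  exists K. split; [exact HK|]. intros n Hn. eapply Rle_trans; [apply Hb; exact Hn|].
  apply Rmult_le_compat_l; [exact HK|]. apply INR_ge_1 in Hn. apply Rle_Rpower; [exact Hn|apply Rmin_l].
Qed.

Lemma slow_plus a b : slow a -> slow b -> slow (fun n => a n + b n)%C.
Proof.
  intros Ha Hb eps He. destruct (Ha eps He) as (K & HK & H1). destruct (Hb eps He) as (K' & HK' & H2).
  exists (K + K'). split; [lra|]. intros n Hn. eapply Rle_trans; [apply Cmod_triangle|].
  specialize (H1 n Hn). specialize (H2 n Hn). lra.
Qed.

Lemma slow_mult a b : slow a -> slow b -> slow (fun n => a n * b n)%C.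
Proof.
  intros Ha Hb eps He. destruct (Ha (eps / 2)) as (K & HK & H1); [lra|].
  destruct (Hb (eps / 2)) as (K' & HK' & H2); [lra|].
  exists (K * K'). split; [nra|]. intros n Hn. rewrite Cmod_mult.
  replace (Rpower (INR n) eps) with (Rpower (INR n) (eps / 2) * Rpower (INR n) (eps / 2))
    by (rewrite <- Rpower_plus; f_equal; field).
  specialize (H1 n Hn). specialize (H2 n Hn).
  pose proof (Cmod_ge_0 (a n)). pose proof (Cmod_ge_0 (b n)).
  replace (K * K' * (Rpower (INR n) (eps / 2) * Rpower (INR n) (eps / 2)))
    with ((K * Rpower (INR n) (eps / 2)) * (K' * Rpower (INR n) (eps / 2))) by ring.
  apply Rmult_le_compat; assumption.
Qed.

Lemma slow_bounded a K : (forall n, (1 <= n)%nat -> Cmod (a n) <= K) -> slow a.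
Proof.
  intros H eps He. exists (Rmax K 0). split; [apply Rmax_r|]. intros n Hn.
  pose proof (Rpower_ge_1 n eps Hn ltac:(lra)). pose proof (Rmax_l K 0). pose proof (Rmax_r K 0).
  specialize (H n Hn). nra.
Qed.

Lemma inv_sqrt_small K eps : 0 <= K -> 0 < eps ->
  exists n0, forall n, (n0 <= n)%nat -> (1 <= n)%nat /\ K / sqrt (INR n) < eps.
Proof.
  intros HK He. set (x := (K + 1) / eps). assert (Hx : 0 < x) by (apply Rdiv_lt_0_compat; lra).
  destruct (INR_unbounded (x * x)) as [n0 Hn0]. exists (S n0). intros n Hn. split; [lia|].
  assert (Hnx : x * x < INR n) by (eapply Rlt_le_trans; [exact Hn0|apply le_INR; lia]).
  assert (Hs : x < sqrt (INR n)) by (rewrite <- (sqrt_square x) by lra; apply sqrt_lt_1; nra).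
  apply Rmult_lt_reg_r with (sqrt (INR n)); [lra|].
  unfold Rdiv. rewrite Rmult_assoc, Rinv_l, Rmult_1_r by lra.
  assert (x * eps = K + 1) by (unfold x; field; lra). nra.
Qed.

Lemma INR_C_neq_0 n : (1 <= n)%nat -> RtoC (INR n) <> RtoC 0.
Proof. intros H E. apply RtoC_inj in E. revert E. apply not_0_INR. lia. Qed.

Lemma slow_rate a t eps : slow (fun n => Cpow (RtoC (INR n)) t * a n)%C -> 0 < eps ->
  exists K, 0 <= K /\ forall n, (1 <= n)%nat -> Cmod (a n) <= K * Rpower (INR n) (eps - INR t).
Proof.
  intros Ha He. destruct (Ha eps He) as (K & HK & H). exists K. split; [exact HK|]. intros n Hn.
  specialize (H n Hn). apply INR_ge_1 in Hn.
  rewrite Cmod_mult, Cmod_pow, Cmod_R, Rabs_pos_eq, <- Rpower_pow in H by lra.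
  apply Rmult_le_reg_l with (Rpower (INR n) (INR t)); [apply Rpower_pos|]. eapply Rle_trans; [exact H|].
  replace (Rpower (INR n) eps) with (Rpower (INR n) (INR t) * Rpower (INR n) (eps - INR t))
    by (rewrite <- Rpower_plus; f_equal; ring). lra.
Qed.

Lemma slow_null a : slow a -> Clim (fun n => a n / RtoC (INR n))%C (RtoC 0).
Proof.
  intros Ha eps He. destruct (Ha (/ 2)) as (K & HK & H); [lra|].
  destruct (inv_sqrt_small K eps HK He) as [n0 Hn0]. exists n0. intros n Hn.
  destruct (Hn0 n Hn) as [Hn1 Hlt]. specialize (H n Hn1). pose proof (INR_ge_1 n Hn1) as H1.
  replace (a n / RtoC (INR n) - 0)%C with (a n / RtoC (INR n))%C by ring.
  rewrite Cmod_div, Cmod_R, Rabs_pos_eq by (try lra; now apply INR_C_neq_0).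
  rewrite Rpower_sqrt in H by lra. eapply Rle_lt_trans; [|exact Hlt].
  pose proof (sqrt_lt_R0 (INR n) ltac:(lra)) as Hs. pose proof (sqrt_sqrt (INR n) ltac:(lra)) as Hss.
  apply Rmult_le_reg_r with (INR n); [lra|].
  replace (K / sqrt (INR n) * INR n) with (K * sqrt (INR n)) by (rewrite <- Hss at 3; field; lra).
  unfold Rdiv. rewrite Rmult_assoc, Rinv_l by lra. lra.
Qed.

(** The mean value theorem plays the role of the integral test: it compares a term of size [x^(e-1)]
    with an increment of [x^e / e], and such increments telescope. *)
Lemma Rpower_diff x e : 0 < x -> exists c, x < c < x + 1 /\
  Rpower (x + 1) e - Rpower x e = e * Rpower c (e - 1).
Proof.
  intros Hx.
  destruct (MVT_cor2 (fun t => Rpower t e) (fun t => e * Rpower t (e - 1)) x (x + 1)) as (c & E & Hc).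
  - lra.
  - intros c Hc. apply derivable_pt_lim_power. lra.
  - exists c. split; [exact Hc|]. rewrite E. ring.
Qed.

Lemma Rpower_anti x y e : 0 < x <= y -> e <= 0 -> Rpower y e <= Rpower x e.
Proof.
  intros Hxy He. rewrite <- (Ropp_involutive e), !(Rpower_Ropp _ (- e)).
  apply Rinv_le_contravar; [apply Rpower_pos|]. apply Rle_Rpower_l; lra.
Qed.

Lemma slow_csum a : slow (fun n => Cpow (RtoC (INR n)) 1 * a n)%C -> slow (csum a).
Proof.
  intros Ha. apply slow_small_eps. intros eps He.
  destruct (slow_rate a 1 eps Ha ltac:(lra)) as (K & HK & Hb). simpl (INR 1) in Hb.
  (* The last term of [csum a (S (S m))] has index [m + 1], hence the power of [S m] in the
     bound. *)
  assert (Hs : forall m, Cmod (csum a (S (S m))) <= Cmod (a O) + K + K / eps * Rpower (INR (S m)) eps).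
  { induction m as [|m IH].
    - simpl csum. replace (0 + a 0%nat + a 1%nat)%C with (a 0%nat + a 1%nat)%C by ring.
      eapply Rle_trans; [apply Cmod_triangle|]. specialize (Hb 1%nat (le_n 1)).
      assert (E1 : forall e, Rpower (INR 1) e = 1)
        by (intros e; simpl INR; unfold Rpower; rewrite ln_1, Rmult_0_r; apply exp_0).
      rewrite E1 in Hb |- *. assert (0 <= K / eps) by (apply Rdiv_le_0_compat; lra). lra.
    - rewrite csum_S. eapply Rle_trans; [apply Cmod_triangle|].
      specialize (Hb (S (S m)) ltac:(lia)).
      destruct (Rpower_diff (INR (S m)) eps) as (c & Hc & E); [apply lt_0_INR; lia|].
      rewrite <- S_INR in E, Hc.
      assert (Hle : Rpower (INR (S (S m))) (eps - 1) <= Rpower c (eps - 1)).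
      { apply Rpower_anti; [|lra]. pose proof (lt_0_INR (S m) ltac:(lia)). lra. }
      assert (E2 : K / eps * Rpower (INR (S (S m))) eps
                   = K / eps * Rpower (INR (S m)) eps + K * Rpower c (eps - 1)).
      { replace (Rpower (INR (S (S m))) eps) with (Rpower (INR (S m)) eps + eps * Rpower c (eps - 1)) by lra.
        field. lra. }
      rewrite E2. assert (K * Rpower (INR (S (S m))) (eps - 1) <= K * Rpower c (eps - 1))
        by (apply Rmult_le_compat_l; assumption). lra. }
  pose proof (Cmod_ge_0 (a O)) as H0. assert (Hke : 0 <= K / eps) by (apply Rdiv_le_0_compat; lra).
  exists (Cmod (a O) + K + K / eps). split; [lra|]. intros n Hn.
  pose proof (Rpower_ge_1 n eps Hn ltac:(lra)) as Hp.
  destruct n as [|[|m]]; [lia| |].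
  - simpl csum. replace (0 + a 0%nat)%C with (a 0%nat) by ring. nra.
  - eapply Rle_trans; [apply Hs|].
    assert (Rpower (INR (S m)) eps <= Rpower (INR (S (S m))) eps).
    { apply Rle_Rpower_l; [lra|]. split; [apply lt_0_INR; lia|apply le_INR; lia]. }
    nra.
Qed.

(** The rate O(n^(eps-1)) of the tail is kept along with convergence: it has to beat the growth of a
    divergent factor during regularisation. *)
Lemma csum_tail d : slow (fun n => Cpow (RtoC (INR n)) 2 * d n)%C ->
  exists L, Clim (csum d) L /\ slow (fun n => RtoC (INR n) * (csum d n - L))%C.
Proof.
  intros Hd.
  assert (Hdiff : forall eps, 0 < eps < 1 -> exists K, 0 <= K /\ forall m k,
     Cmod (csum d (S (S (m + k))) - csum d (S (S m))) <= K * Rpower (INR (S m)) (eps - 1)).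
  { intros eps He. destruct (slow_rate d 2 eps Hd ltac:(lra)) as (K & HK & Hb).
    replace (INR 2) with 2 in Hb by (simpl; ring).
    exists (K / (1 - eps)). split; [apply Rdiv_le_0_compat; lra|].
    assert (Hs : forall m k, Cmod (csum d (S (S (m + k))) - csum d (S (S m)))
      <= K / (1 - eps) * (Rpower (INR (S m)) (eps - 1) - Rpower (INR (S (m + k))) (eps - 1))).
    { intros m. induction k as [|k IH].
      - rewrite Nat.add_0_r. replace (csum d (S (S m)) - csum d (S (S m)))%C with (RtoC 0) by ring.
        rewrite Cmod_0. lra.
      - rewrite Nat.add_succ_r, (csum_S _ (S (S (m + k)))).
        replace (csum d (S (S (m + k))) + d (S (S (m + k))) - csum d (S (S m)))%C
          with ((csum d (S (S (m + k))) - csum d (S (S m))) + d (S (S (m + k))))%C by ring.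
        eapply Rle_trans; [apply Cmod_triangle|].
        specialize (Hb (S (S (m + k))) ltac:(lia)).
        destruct (Rpower_diff (INR (S (m + k))) (eps - 1)) as (c & Hc & E); [apply lt_0_INR; lia|].
        rewrite <- S_INR in E, Hc. replace (eps - 1 - 1) with (eps - 2) in E by ring.
        assert (Hle : Rpower (INR (S (S (m + k)))) (eps - 2) <= Rpower c (eps - 2)).
        { apply Rpower_anti; [|lra]. pose proof (lt_0_INR (S (m + k)) ltac:(lia)). lra. }
        assert (E2 : K / (1 - eps) * (Rpower (INR (S m)) (eps - 1) - Rpower (INR (S (S (m + k)))) (eps - 1))
          = K / (1 - eps) * (Rpower (INR (S m)) (eps - 1) - Rpower (INR (S (m + k))) (eps - 1))
            + K * Rpower c (eps - 2)).
        { replace (Rpower (INR (S (S (m + k)))) (eps - 1))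
            with (Rpower (INR (S (m + k))) (eps - 1) + (eps - 1) * Rpower c (eps - 2)) by lra.
          field. lra. }
        rewrite E2.
        assert (K * Rpower (INR (S (S (m + k)))) (eps - 2) <= K * Rpower c (eps - 2))
          by (apply Rmult_le_compat_l; assumption). lra. }
    intros m k. eapply Rle_trans; [apply Hs|]. pose proof (Rpower_pos (INR (S (m + k))) (eps - 1)).
    apply Rmult_le_compat_l; [apply Rdiv_le_0_compat; lra|lra]. }
  destruct (C_complete (csum d)) as [L HL].
  { intros eps He. destruct (Hdiff (/ 2)) as (K & HK & H); [lra|].
    destruct (inv_sqrt_small K eps HK He) as [m Hm]. exists (S (S m)). intros n Hn.
    replace n with (S (S (m + (n - m - 2))))%nat by lia. eapply Rle_lt_trans; [apply H|].
    destruct (Hm (S m) ltac:(lia)) as [_ Hlt]. replace (/ 2 - 1) with (- / 2) by lra.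
    rewrite Rpower_Ropp, Rpower_sqrt by (apply lt_0_INR; lia). exact Hlt. }
  exists L. split; [exact HL|].
  apply slow_small_eps. intros eps He. destruct (Hdiff eps He) as (K & HK & H).
  exists (2 * K + Cmod (csum d 1 - L)). pose proof (Cmod_ge_0 (csum d 1 - L)) as H1.
  split; [lra|]. intros n Hn. pose proof (Rpower_ge_1 n eps Hn ltac:(lra)) as Hp.
  rewrite Cmod_mult, Cmod_R, Rabs_pos_eq by apply pos_INR.
  destruct n as [|[|m]]; [lia| |].
  - simpl INR in *. nra.
  - assert (Hle : Cmod (L - csum d (S (S m))) <= K * Rpower (INR (S m)) (eps - 1)).
    { apply (Clim_le (csum d) L _ _ (S (S m)) HL). intros k Hk.
      replace k with (S (S (m + (k - m - 2))))%nat by lia. apply H. }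
    rewrite <- Cmod_opp in Hle. replace (- (L - csum d (S (S m))))%C with (csum d (S (S m)) - L)%C in Hle by ring.
    pose proof (INR_ge_1 (S m) ltac:(lia)) as Hm1.
    assert (Hm : INR (S (S m)) <= 2 * INR (S m)) by (rewrite (S_INR (S m)); lra).
    assert (E : INR (S m) * Rpower (INR (S m)) (eps - 1) = Rpower (INR (S m)) eps).
    { rewrite <- (Rpower_1 (INR (S m))) at 1 by lra. rewrite <- Rpower_plus. f_equal. ring. }
    assert (Hmono : Rpower (INR (S m)) eps <= Rpower (INR (S (S m))) eps).
    { apply Rle_Rpower_l; [lra|]. rewrite (S_INR (S m)). lra. }
    pose proof (Rpower_pos (INR (S m)) (eps - 1)).
    apply Rle_trans with (2 * INR (S m) * (K * Rpower (INR (S m)) (eps - 1))).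
    + apply Rmult_le_compat; [apply pos_INR|apply Cmod_ge_0|exact Hm|exact Hle].
    + replace (2 * INR (S m) * (K * Rpower (INR (S m)) (eps - 1)))
        with (2 * K * (INR (S m) * Rpower (INR (S m)) (eps - 1))) by ring. rewrite E. nra.
Qed.

Lemma root_Cmod N z : (1 <= N)%nat -> cpow z N = RtoC 1 -> Cmod z = 1.
Proof.
  intros HN H. rewrite cpow_Cpow in H. apply (f_equal Cmod) in H.
  rewrite Cmod_pow, Cmod_1 in H. pose proof (Cmod_ge_0 z) as Hz.
  destruct (Rtotal_order (Cmod z) 1) as [Hlt|[E|Hgt]]; [|exact E|].
  - pose proof (pow_lt_1_compat (Cmod z) N (conj Hz Hlt) ltac:(lia)). lra.
  - pose proof (Rlt_pow_R1 (Cmod z) N Hgt ltac:(lia)). lra.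
Qed.

Lemma lterm_le z s n (x : C) : Cmod z = 1 -> (1 <= n)%nat ->
  Cmod (Cpow (RtoC (INR n)) s * (Cpow z n / Cpow (RtoC (INR n)) s * x)) <= Cmod x.
Proof.
  intros Hz Hn. pose proof (Cpow_nz _ s (INR_C_neq_0 n Hn)) as Hnz.
  replace (Cpow (RtoC (INR n)) s * (Cpow z n / Cpow (RtoC (INR n)) s * x))%C with (Cpow z n * x)%C
    by (field; exact Hnz).
  rewrite Cmod_mult, Cmod_pow, Hz, pow1. lra.
Qed.

(* A factor [n^t] is absorbed by [1/n^s] as soon as [t <= s]. *)
Lemma lterm_slow z s t (x : nat -> C) : Cmod z = 1 -> (t <= s)%nat -> slow x ->
  slow (fun n => Cpow (RtoC (INR n)) t * (Cpow z n / Cpow (RtoC (INR n)) s * x n))%C.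
Proof.
  intros Hz Hts Hx. refine (slow_le _ x _ Hx). intros n Hn.
  pose proof (INR_ge_1 n Hn) as H1.
  eapply Rle_trans; [|apply (lterm_le z s n (x n) Hz Hn)].
  rewrite (Cmod_mult (Cpow _ t)), (Cmod_mult (Cpow _ s)), !Cmod_pow, Cmod_R, Rabs_pos_eq by lra.
  apply Rmult_le_compat_r; [apply Cmod_ge_0|]. now apply Rle_pow.
Qed.

Lemma LiT_slow N l : (1 <= N)%nat -> word N l -> slow (LiT l).
Proof.
  intros HN. induction l as [|[s z] r IH]; intros Hl.
  - apply (slow_bounded _ 1). intros n _. simpl. rewrite Cmod_1. lra.
  - pose proof (Forall_inv Hl) as [Hs Hz]. pose proof (Forall_inv_tail Hl) as Hr. simpl in Hs, Hz.
    apply (slow_le _ (csum (fun n => (Cpow z n / Cpow (RtoC (INR n)) s * LiT r n)%C))).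
    { intros n _. rewrite LiT_csum by exact Hs. lra. }
    apply slow_csum. exact (lterm_slow z s 1 (LiT r) (root_Cmod N z HN Hz) Hs (IH Hr)).
Qed.

(** For [s >= 2] the terms are O(n^(eps-2)). For [s = 1] the root [z] differs from 1, and summation
    by parts gains the missing power of [n]. *)
Lemma LiT_conv N l : (1 <= N)%nat -> word N l -> admissible l ->
  exists L, Clim (LiT l) L /\ slow (fun n => RtoC (INR n) * (LiT l n - L))%C.
Proof.
  intros HN Hl Ha. destruct l as [|[s z] r].
  { exists (RtoC 1). split; [apply Clim_const|]. apply (slow_bounded _ 0). intros n _. simpl.
    replace (RtoC (INR n) * (1 - 1))%C with (RtoC 0) by ring. rewrite Cmod_0. lra. }
  pose proof (Forall_inv Hl) as [Hs Hz]. pose proof (Forall_inv_tail Hl) as Hr. simpl in Hs, Hz.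
  pose proof (root_Cmod N z HN Hz) as Hz1. pose proof (LiT_slow N r HN Hr) as Hrs.
  set (t := fun n => (Cpow z n / Cpow (RtoC (INR n)) s * LiT r n)%C).
  assert (E : forall n, LiT ((s, z) :: r) n = csum t n) by (intros n; now apply LiT_csum).
  cut (exists L, Clim (csum t) L /\ slow (fun n => RtoC (INR n) * (csum t n - L))%C).
  { intros (L & H1 & H2). exists L. split.
    - apply (Clim_ext_from O (csum t)); [intros; now rewrite E|exact H1].
    - refine (slow_le _ _ _ H2). intros n _. rewrite E. lra. }
  destruct (le_lt_dec 2 s) as [Hs2|Hs1].
  - apply csum_tail. exact (lterm_slow z s 2 (LiT r) Hz1 Hs2 Hrs).
  - assert (s = 1)%nat by lia. subst s. clear Hs1 Hs.
    assert (Hz0 : z <> RtoC 1) by (intros E1; apply Ha; now split).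
    assert (Hz0' : (1 - z)%C <> RtoC 0) by (apply Cminus_eq_contra; congruence).
    set (c := fun n => (LiT r n / RtoC (INR n))%C).
    set (d := fun n => (Cpow z (S n) * (c (S n) - c n))%C).
    (* Summation by parts with [(1 - z) z^n = z^n - z^(n+1)]; the differences of [c] collected in
       [d] are O(n^(eps-2)). *)
    assert (Eabel : forall M, (csum t M = / (1 - z) * (c O - Cpow z M * c M + csum d M))%C).
    { induction M as [|M IH]; [simpl; field; exact Hz0'|].
      rewrite !csum_S, IH. unfold t, d. rewrite Cpow_1_r.
      replace (Cpow z M / RtoC (INR M) * LiT r M)%C with (Cpow z M * c M)%C by (unfold c, Cdiv; ring).
      simpl. field. exact Hz0'. }
    assert (Hd : slow (fun n => Cpow (RtoC (INR n)) 2 * d n)%C).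
    (* One step of [LiT r] is a single term of its outer sum, hence O(n^(eps-1)); for the empty word
       it is 0. *)
    { assert (Hstep : exists b, slow b /\ forall n, (1 <= n)%nat ->
         Cmod (RtoC (INR n) * (LiT r (S n) - LiT r n)) <= Cmod (b n)).
      { destruct r as [|[s2 z2] r2].
        - exists (fun _ => RtoC 0). split; [apply (slow_bounded _ 0); intros; rewrite Cmod_0; lra|].
          intros n _. simpl. replace (RtoC (INR n) * (1 - 1))%C with (RtoC 0) by ring. lra.
        - pose proof (Forall_inv Hr) as [Hs2 Hz2]. pose proof (Forall_inv_tail Hr) as Hr2. simpl in Hs2, Hz2.
          eexists. split; [apply (lterm_slow z2 s2 1 (LiT r2) (root_Cmod N z2 HN Hz2) Hs2 (LiT_slow N r2 HN Hr2))|].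
          intros n _. rewrite !LiT_csum, csum_S, Cpow_1_r by exact Hs2.
          apply Req_le. f_equal. simpl. ring. }
      destruct Hstep as (b & Hb & Hstep).
      assert (Hbr : slow (fun n => RtoC (Cmod (b n)) + RtoC (Cmod (LiT r n)))%C).
      { apply slow_plus; [refine (slow_le _ b _ Hb)|refine (slow_le _ (LiT r) _ Hrs)];
        intros n _; rewrite Cmod_R, Rabs_pos_eq by apply Cmod_ge_0; lra. }
      refine (slow_le _ _ _ Hbr). intros n Hn.
      rewrite <- RtoC_plus, Cmod_R, Rabs_pos_eq
        by (apply Rplus_le_le_0_compat; apply Cmod_ge_0).
      pose proof (INR_C_neq_0 n Hn) as Hnz. pose proof (INR_C_neq_0 (S n) ltac:(lia)) as Hnz'.
      assert (Ed : (Cpow (RtoC (INR n)) 2 * d n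
         = Cpow z (S n) * (RtoC (INR n) / RtoC (INR (S n)))
           * (RtoC (INR n) * (LiT r (S n) - LiT r n) - LiT r n))%C).
      { unfold d, c. replace (RtoC (INR (S n))) with (RtoC (INR n) + 1)%C in *
          by (rewrite S_INR, RtoC_plus; reflexivity).
        simpl (Cpow (RtoC (INR n)) 2). field. split; assumption. }
      apply INR_ge_1 in Hn as H1.
      rewrite Ed, !Cmod_mult, Cmod_pow, Hz1, pow1, Cmod_div, !Cmod_R, !Rabs_pos_eq by (try apply pos_INR; assumption).
      specialize (Hstep n Hn).
      assert (Htri : Cmod (RtoC (INR n) * (LiT r (S n) - LiT r n) - LiT r n) <= Cmod (b n) + Cmod (LiT r n)).
      { eapply Rle_trans; [apply Cmod_triangle|]. rewrite Cmod_opp. lra. }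
      assert (Hq : 0 <= INR n / INR (S n) <= 1).
      { rewrite S_INR. split; [apply Rdiv_le_0_compat; lra|].
        apply Rmult_le_reg_r with (INR n + 1); [lra|]. unfold Rdiv.
        rewrite Rmult_assoc, Rinv_l by lra. lra. }
      pose proof (Cmod_ge_0 (RtoC (INR n) * (LiT r (S n) - LiT r n) - LiT r n)). nra. }
    destruct (csum_tail d Hd) as (L' & HL' & HsL').
    assert (Hzc : slow (fun n => RtoC (INR n) * (Cpow z n * c n))%C).
    { refine (slow_le _ (LiT r) _ Hrs). intros n Hn. pose proof (INR_C_neq_0 n Hn) as Hnz.
      unfold c. replace (RtoC (INR n) * (Cpow z n * (LiT r n / RtoC (INR n))))%C
        with (Cpow z n * LiT r n)%C by (field; exact Hnz).
      rewrite Cmod_mult, Cmod_pow, Hz1, pow1. lra. }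
    assert (Hzc0 : Clim (fun n => Cpow z n * c n)%C (RtoC 0)).
    { apply slow_null in Hzc. refine (Clim_ext_from 1%nat _ _ _ _ Hzc). intros n Hn. simpl.
      field. now apply INR_C_neq_0. }
    exists (/ (1 - z) * (c O + L'))%C. split.
    + pose proof (Clim_scal (/ (1 - z))%C _ _ (Clim_plus _ _ _ _ (Clim_const (c O))
        (Clim_plus _ _ _ _ (Clim_scal (-(1))%C _ _ Hzc0) HL'))) as H.
      replace (/ (1 - z) * (c O + L'))%C with (/ (1 - z) * (c 0%nat + (- (1) * 0 + L')))%C by ring.
      refine (Clim_ext_from O _ _ _ _ H). intros n _. rewrite Eabel. simpl. ring.
    + assert (Hsum : slow (fun n => / (1 - z) * (RtoC (-1) * (RtoC (INR n) * (Cpow z n * c n))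
                                     + RtoC (INR n) * (csum d n - L')))%C).
      { apply slow_mult; [apply (slow_bounded _ (Cmod (/ (1 - z)))); intros; lra|].
        apply slow_plus; [|exact HsL'].
        apply slow_mult; [apply (slow_bounded _ (Cmod (RtoC (-1)))); intros; lra|exact Hzc]. }
      refine (slow_le _ _ _ Hsum). intros n _. apply Req_le. f_equal. rewrite Eabel. ring.
Qed.

(** * The graded algebra of cyclotomic multiple zeta values *)

Lemma in_CMZV_0 k N : in_CMZV k N (RtoC 0).
Proof. exists []. split; [constructor|reflexivity]. Qed.

Lemma in_CMZV_cons k N q l L x : word N l -> admissible l -> sum_weights l = k ->
  Clim (LiT l) L -> in_CMZV k N x -> in_CMZV k N (RtoC (Q2R q) * L + x)%C.
Proof.
  intros Hw Ha Hk HL (ts & Hts & ->). exists ((q, l, L) :: ts). split; [|reflexivity].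
  constructor; [|exact Hts]. simpl. split; [|now apply is_Li_Clim].
  split; [exact Hw|split; [exact Hk|exact Ha]].
Qed.

(** Induction over a rational combination, so that later proofs need not handle the list of
    terms. *)
Lemma in_CMZV_rect k N (P : C -> Prop) :
  P (RtoC 0) ->
  (forall q l L x, word N l -> admissible l -> sum_weights l = k -> Clim (LiT l) L ->
     in_CMZV k N x -> P x -> P (RtoC (Q2R q) * L + x)%C) ->
  forall x, in_CMZV k N x -> P x.
Proof.
  intros P0 PS x (ts & Hts & ->). induction ts as [|[[q l] L] ts IH]; [exact P0|].
  pose proof (Forall_inv Hts) as [(Hw & Hk & Ha) HL]. pose proof (Forall_inv_tail Hts) as Ht.
  simpl. apply (PS q l L); try assumption.
  - now apply is_Li_Clim.
  - exists ts. now split.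
  - now apply IH.
Qed.

Lemma in_CMZV_plus k N x y : in_CMZV k N x -> in_CMZV k N y -> in_CMZV k N (x + y)%C.
Proof.
  intros Hx Hy. revert x Hx. apply in_CMZV_rect.
  - replace (0 + y)%C with y by ring. exact Hy.
  - intros q l L x Hw Ha Hk HL _ IH.
    replace (RtoC (Q2R q) * L + x + y)%C with (RtoC (Q2R q) * L + (x + y))%C by ring.
    now apply in_CMZV_cons with l.
Qed.

Lemma in_CMZV_scal k N q x : in_CMZV k N x -> in_CMZV k N (RtoC (Q2R q) * x)%C.
Proof.
  revert x. apply in_CMZV_rect.
  - replace (RtoC (Q2R q) * 0)%C with (RtoC 0) by ring. apply in_CMZV_0.
  - intros q' l L x Hw Ha Hk HL _ IH.
    replace (RtoC (Q2R q) * (RtoC (Q2R q') * L + x))%C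
      with (RtoC (Q2R (q * q')) * L + RtoC (Q2R q) * x)%C
      by (rewrite Q2R_mult, RtoC_mult; ring).
    now apply in_CMZV_cons with l.
Qed.

Lemma in_CMZV_opp k N x : in_CMZV k N x -> in_CMZV k N (- x)%C.
Proof.
  intros H. replace (- x)%C with (RtoC (Q2R (-1)) * x)%C; [now apply in_CMZV_scal|].
  replace (Q2R (-1)) with (-1) by (unfold Q2R; simpl; field). ring.
Qed.

Lemma in_CMZV_Li k N l L : word N l -> admissible l -> sum_weights l = k ->
  Clim (LiT l) L -> in_CMZV k N L.
Proof.
  intros Hw Ha Hk HL. replace L with (RtoC (Q2R 1) * L + 0)%C.
  - apply in_CMZV_cons with l; try assumption. apply in_CMZV_0.
  - unfold Q2R; simpl. replace (1 * / 1) with 1 by field. ring.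
Qed.

Lemma in_CMZV_1 N : in_CMZV 0 N (RtoC 1).
Proof.
  apply (in_CMZV_Li 0 N []); [constructor|exact I|reflexivity|apply Clim_const].
Qed.

Lemma in_CMZV_m1 N : in_CMZV 0 N (RtoC (-1)).
Proof. replace (RtoC (-1)) with (- (1))%C by ring. apply in_CMZV_opp, in_CMZV_1. Qed.

Lemma LiTs_lim k N ws : (1 <= N)%nat ->
  Forall (fun w => word N w /\ sum_weights w = k) ws -> Forall admissible ws ->
  exists L, Clim (LiTs ws) L /\ in_CMZV k N L.
Proof.
  intros HN. induction ws as [|w ws IH]; intros Hw Ha.
  - exists (RtoC 0). split; [apply Clim_const|apply in_CMZV_0].
  - destruct (IH (Forall_inv_tail Hw) (Forall_inv_tail Ha)) as (L & HL & HZ).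
    pose proof (Forall_inv Hw) as [Hw1 Hk]. pose proof (Forall_inv Ha) as Ha1.
    destruct (LiT_conv N w HN Hw1 Ha1) as (L1 & HL1 & _).
    exists (L1 + L)%C. split; [now apply Clim_plus|].
    apply in_CMZV_plus; [now apply in_CMZV_Li with w|exact HZ].
Qed.

Lemma word_pos N l s z r : word N l -> l = (s, z) :: r -> (0 < s)%nat.
Proof. intros H ->. apply Forall_inv in H. apply H. Qed.

(** Stuffling admissible words yields admissible words, so the product identity for truncated sums
    passes to the limit term by term. *)
Lemma in_CMZV_mult k k' N x y : (1 <= N)%nat ->
  in_CMZV k N x -> in_CMZV k' N y -> in_CMZV (k + k') N (x * y)%C.
Proof.
  intros HN Hx Hy. revert x Hx. apply in_CMZV_rect.
  { replace (0 * y)%C with (RtoC 0) by ring. apply in_CMZV_0. }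
  intros q l L x Hw Ha Hk HL _ IH.
  replace ((RtoC (Q2R q) * L + x) * y)%C with (RtoC (Q2R q) * (L * y) + x * y)%C by ring.
  apply in_CMZV_plus; [apply in_CMZV_scal|exact IH]. clear x IH q.
  revert y Hy. apply in_CMZV_rect.
  { replace (L * 0)%C with (RtoC 0) by ring. apply in_CMZV_0. }
  intros q l' L' y Hw' Ha' Hk' HL' _ IH.
  replace (L * (RtoC (Q2R q) * L' + y))%C with (RtoC (Q2R q) * (L * L') + L * y)%C by ring.
  apply in_CMZV_plus; [apply in_CMZV_scal|exact IH].
  destruct (LiTs_lim (k + k') N (stuffle l l') HN) as (M & HM & HZ).
  - rewrite <- Hk, <- Hk'. now apply stuffle_shape.
  - apply stuffle_admissible; try assumption; intros s z r E.
    + exact (word_pos N l s z r Hw E).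
    + exact (word_pos N l' s z r Hw' E).
  - replace (L * L')%C with M; [exact HZ|].
    apply (Clim_unique (LiTs (stuffle l l'))); [exact HM|].
    refine (Clim_ext_from O _ _ _ _ (Clim_mult _ _ _ _ HL HL')).
    intros n _. now apply LiT_stuffle with N.
Qed.

Lemma in_CMZV_pow k N x j : (1 <= N)%nat -> in_CMZV k N x -> in_CMZV (j * k) N (Cpow x j).
Proof.
  intros HN Hx. induction j as [|j IH]; [apply in_CMZV_1|].
  change (S j * k)%nat with (k + j * k)%nat. rewrite Cpow_S. now apply in_CMZV_mult.
Qed.

(** * Stuffle regularisation *)

(** The regularisation polynomial. The sums [LiT (ones j)] serve as a basis in place of the powers
    of the harmonic number because the stuffle product produces them directly. *)
Definition ones_poly (k : nat) (P : nat -> C) (n : nat) : C :=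
  csum (fun j => P j * LiT (ones j) n)%C (S k).

Definition regular (N k : nat) (a : nat -> C) : Prop :=
  exists P : nat -> C,
    (forall j, (j <= k)%nat -> in_CMZV (k - j) N (P j)) /\
    Clim (fun n => a n - ones_poly k P n)%C (RtoC 0).

Lemma regular_ext N k a b : (forall n, (1 <= n)%nat -> a n = b n) -> regular N k a -> regular N k b.
Proof.
  intros E (P & HP & H). exists P. split; [exact HP|].
  refine (Clim_ext_from 1%nat _ _ _ _ H). intros n Hn. simpl. now rewrite E.
Qed.

Lemma regular_0 N k : regular N k (fun _ => RtoC 0).
Proof.
  exists (fun _ => RtoC 0). split; [intros; apply in_CMZV_0|].
  refine (Clim_ext_from O _ _ _ _ (Clim_const (RtoC 0))). intros n _. unfold ones_poly.
  rewrite csum_scal. ring.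
Qed.

Lemma regular_plus N k a b : regular N k a -> regular N k b -> regular N k (fun n => a n + b n)%C.
Proof.
  intros (P & HP & Ha) (Q & HQ & Hb). exists (fun j => P j + Q j)%C. split.
  - intros j Hj. apply in_CMZV_plus; auto.
  - pose proof (Clim_plus _ _ _ _ Ha Hb) as H. replace (0 + 0)%C with (RtoC 0) in H by ring.
    refine (Clim_ext_from O _ _ _ _ H). intros n _. unfold ones_poly.
    rewrite (csum_ext (fun j => (P j + Q j) * LiT (ones j) n)%C
              (fun j => P j * LiT (ones j) n + Q j * LiT (ones j) n)%C) by (intros; ring).
    rewrite csum_plus. ring.
Qed.

Lemma csum_extend f n m : (forall j, (n <= j)%nat -> f j = RtoC 0) -> csum f (n + m) = csum f n.
Proof.
  intros H. induction m as [|m IH]; [now rewrite Nat.add_0_r|].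
  rewrite Nat.add_succ_r, csum_S, IH, H by lia. ring.
Qed.

Lemma regular_scal N k m c a : (1 <= N)%nat -> in_CMZV m N c -> regular N k a ->
  regular N (m + k) (fun n => c * a n)%C.
Proof.
  (* The degree stays at most [k] while the weight rises to [m + k]; the coefficients above [k] are
     0. *)
  intros HN Hc (P & HP & H). exists (fun j => if (j <=? k)%nat then (c * P j)%C else RtoC 0). split.
  - intros j Hj. destruct (Nat.leb_spec j k) as [Hjk|Hjk]; [|apply in_CMZV_0].
    replace (m + k - j)%nat with (m + (k - j))%nat by lia. apply in_CMZV_mult; auto.
  - pose proof (Clim_scal c _ _ H) as H'. replace (c * 0)%C with (RtoC 0) in H' by ring.
    refine (Clim_ext_from O _ _ _ _ H'). intros n _. unfold ones_poly.
    replace (S (m + k)) with (S k + m)%nat by lia.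
    rewrite (csum_extend (fun j => (if (j <=? k)%nat then (c * P j)%C else RtoC 0) * LiT (ones j) n)%C).
    + rewrite (csum_ext (fun j => (if (j <=? k)%nat then (c * P j)%C else RtoC 0) * LiT (ones j) n)%C
                 (fun j => c * (P j * LiT (ones j) n))%C (S k)), csum_scal; [cbv beta; ring|].
      intros j Hj. destruct (Nat.leb_spec j k) as [_|Hjk]; [ring|lia].
    + intros j Hj. destruct (Nat.leb_spec j k) as [Hjk|_]; [lia|ring].
Qed.

Lemma csum_single f n p : (p < n)%nat -> (forall j, j <> p -> f j = RtoC 0) -> csum f n = f p.
Proof.
  intros Hp H. induction n as [|n IH]; [lia|]. rewrite csum_S.
  destruct (Nat.eq_dec p n) as [->|E].
  - rewrite (csum_ext _ (fun _ => RtoC 0)) by (intros; apply H; lia). rewrite csum_0. ring.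
  - rewrite IH by lia. rewrite (H n) by congruence. ring.
Qed.

(** Replacing [LiT v n] by its limit costs O(n^(eps-1)), and multiplication by [LiT (ones p) n],
    which is O(n^eps), still leaves an error tending to 0. *)
Lemma regular_ones_mult N p v : (1 <= N)%nat -> word N v -> admissible v ->
  regular N (p + sum_weights v) (fun n => LiT (ones p) n * LiT v n)%C.
Proof.
  intros HN Hv Ha. destruct (LiT_conv N v HN Hv Ha) as (L & HL & Hs).
  exists (fun j => if (j =? p)%nat then L else RtoC 0). split.
  - intros j Hj. destruct (Nat.eqb_spec j p) as [->|_]; [|apply in_CMZV_0].
    apply (in_CMZV_Li _ N v); try assumption. lia.
  - pose proof (slow_null _ (slow_mult _ _ (LiT_slow N _ HN (word_ones N p)) Hs)) as H.
    refine (Clim_ext_from 1%nat _ _ _ _ H). intros n Hn. unfold ones_poly. rewrite (csum_single _ _ p).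
    + rewrite Nat.eqb_refl. field. now apply INR_C_neq_0.
    + lia.
    + intros j Hj. destruct (Nat.eqb_spec j p); [contradiction|ring].
Qed.

(** The sum of [ones p ++ v] is the product of those of [ones p] and [v] minus sums of words with
    fewer leading ones, to which the induction hypothesis applies. *)
Lemma regular_ones_app N p v : (1 <= N)%nat -> word N v -> admissible v ->
  regular N (p + sum_weights v) (LiT (ones p ++ v)).
Proof.
  intros HN. revert v. induction p as [p IH] using lt_wf_ind. intros v Hv Ha.
  destruct (stuffle_ones N p v Hv Ha) as (rest & E & Hrest).
  pose proof (stuffle_shape N _ _ (word_ones N p) Hv) as Hsh. rewrite E, sum_weights_ones in Hsh.
  apply Forall_inv_tail in Hsh.
  assert (Hr : regular N (p + sum_weights v) (LiTs rest)).
  { clear E. induction rest as [|w rest IHr]; [apply regular_0|].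
    apply (regular_plus N _ (LiT w)).
    - pose proof (Forall_inv Hrest) as (i & u & Hi & -> & Hu).
      pose proof (Forall_inv Hsh) as [Hw Hk]. rewrite <- Hk, sum_weights_app, sum_weights_ones.
      apply IH; [exact Hi| |exact Hu]. apply Forall_app in Hw. apply Hw.
    - apply IHr; [exact (Forall_inv_tail Hrest)|exact (Forall_inv_tail Hsh)]. }
  apply (regular_scal N _ 0 (RtoC (-1))) in Hr; [|exact HN|apply in_CMZV_m1].
  refine (regular_ext _ _ _ _ _ (regular_plus _ _ _ _ (regular_ones_mult N p v HN Hv Ha) Hr)).
  intros n _. simpl. rewrite (LiT_stuffle N) by (try exact Hv; apply word_ones).
  rewrite E. simpl. ring.
Qed.

Lemma regular_LiT N l : (1 <= N)%nat -> word N l -> regular N (sum_weights l) (LiT l).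
Proof.
  intros HN Hl. destruct (word_split l) as (p & v & -> & Ha).
  rewrite sum_weights_app, sum_weights_ones. apply regular_ones_app; [exact HN| |exact Ha].
  apply Forall_app in Hl. apply Hl.
Qed.

(** * Complex power series on the unit disc *)

Definition cseries (a : nat -> C) : C :=
  (Series (fun n => fst (a n)), Series (fun n => snd (a n))).

Lemma csum_sum_n a n : csum a (S n) = (sum_n (fun n => fst (a n)) n, sum_n (fun n => snd (a n)) n).
Proof.
  induction n as [|n IH].
  - simpl. rewrite !sum_O. destruct (a 0%nat). unfold Cplus, RtoC. simpl. f_equal; ring.
  - rewrite csum_S, IH, !sum_Sn. destruct (a (S n)). reflexivity.
Qed.

Lemma cseries_Clim a : ex_series (fun n => Cmod (a n)) -> Clim (csum a) (cseries a).
Proof.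
  intros H.
  assert (Hp : forall p : C -> R, (forall x, Rabs (p x) <= Cmod x) ->
     is_lim_seq (sum_n (fun n => p (a n))) (Series (fun n => p (a n)))).
  { intros p Hp. apply Series_correct. apply (ex_series_le (fun n => p (a n)) (fun n => Cmod (a n))); [|exact H].
    intros n. apply Hp. }
  assert (H1 := Hp fst ltac:(intros x; eapply Rle_trans; [apply Rmax_l|apply Rmax_Cmod])).
  assert (H2 := Hp snd ltac:(intros x; eapply Rle_trans; [apply Rmax_r|apply Rmax_Cmod])).
  apply is_lim_seq_Reals in H1. apply is_lim_seq_Reals in H2.
  intros eps He. destruct (H1 (eps / 2)) as [n1 Hn1]; [lra|]. destruct (H2 (eps / 2)) as [n2 Hn2]; [lra|].
  exists (S (n1 + n2)). intros [|n] Hn; [lia|]. rewrite csum_sum_n.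
  specialize (Hn1 n ltac:(lia)). specialize (Hn2 n ltac:(lia)). unfold Rdist in *.
  eapply Rle_lt_trans; [apply Cmod_le_abs|]. unfold cseries; simpl. unfold Rminus in *. lra.
Qed.

Lemma pow_unit r n : 0 <= r <= 1 -> 0 <= r ^ n <= 1.
Proof. intros Hr. split; [now apply pow_le|]. rewrite <- (pow1 n). now apply pow_incr. Qed.

(** Equivalently, the radius of convergence is at least 1. *)
Definition tame (f : nat -> C) : Prop :=
  forall r, 0 <= r < 1 -> exists K, forall n, Cmod (f n) * r ^ n <= K.

Lemma tame_bounded f K : (forall n, Cmod (f n) <= K) -> tame f.
Proof.
  intros H r Hr. exists K. intros n. pose proof (Cmod_ge_0 (f n)).
  pose proof (pow_unit r n ltac:(lra)).
  specialize (H n). nra.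
Qed.

Lemma tame_plus f g : tame f -> tame g -> tame (fun n => f n + g n)%C.
Proof.
  intros Hf Hg r Hr. destruct (Hf r Hr) as [K H1]. destruct (Hg r Hr) as [K' H2].
  exists (K + K'). intros n. specialize (H1 n). specialize (H2 n).
  pose proof (Cmod_triangle (f n) (g n)). pose proof (pow_le r n ltac:(lra)). nra.
Qed.

Lemma tame_scal c f : tame f -> tame (fun n => c * f n)%C.
Proof.
  intros Hf r Hr. destruct (Hf r Hr) as [K H]. exists (Cmod c * K). intros n.
  rewrite Cmod_mult, Rmult_assoc. apply Rmult_le_compat_l; [apply Cmod_ge_0|apply H].
Qed.

Lemma tame_shift f : tame f -> tame (fun n => f (S n)).
Proof.
  intros Hf r Hr. destruct (Hf ((1 + r) / 2)) as [K H]; [lra|]. exists (K / ((1 + r) / 2)). intros n.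
  specialize (H (S n)). simpl in H. apply Rmult_le_reg_r with ((1 + r) / 2); [lra|].
  replace (K / ((1 + r) / 2) * ((1 + r) / 2)) with K by (field; lra).
  eapply Rle_trans; [|exact H]. rewrite Rmult_assoc. apply Rmult_le_compat_l; [apply Cmod_ge_0|].
  rewrite Rmult_comm. apply Rmult_le_compat_l; [lra|]. apply pow_incr. lra.
Qed.

(** Each of the [n] terms of the geometric sum [1 + t + ... + t^(n-1)] is at least [t^n]. *)
Lemma INR_pow_bound t n : 0 <= t < 1 -> INR n * t ^ n * (1 - t) <= 1 - t ^ n.
Proof.
  intros Ht. induction n as [|n IH]; [simpl; lra|]. rewrite S_INR. simpl.
  pose proof (pow_unit t n ltac:(lra)).
  apply (Rmult_le_compat_l t) in IH; [|lra].
  assert (t * t ^ n * (1 - t) <= 1 * 1 * (1 - t)).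
  { apply Rmult_le_compat_r; [lra|]. apply Rmult_le_compat; lra. }
  lra.
Qed.

(** The factor [r'] is spent on the tame bound, while [t] supplies geometric decay. *)
Lemma radius_split r : 0 <= r < 1 -> exists r' t, 0 <= r' < 1 /\ 0 <= t < 1 /\ r = r' * t.
Proof.
  intros Hr. exists ((1 + r) / 2), (r / ((1 + r) / 2)). split; [lra|]. split; [|field; lra].
  split; [apply Rdiv_le_0_compat; lra|]. apply Rmult_lt_reg_r with ((1 + r) / 2); [lra|].
  unfold Rdiv at 1. rewrite Rmult_assoc, Rinv_l by lra. lra.
Qed.

Lemma tame_INR f : tame f -> tame (fun n => RtoC (INR n) * f n)%C.
Proof.
  intros Hf r Hr. destruct (radius_split r Hr) as (r' & t & Hr' & Ht & E).
  destruct (Hf r' Hr') as [K H]. exists (K / (1 - t)). intros n.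
  specialize (H n). pose proof (INR_pow_bound t n Ht) as Hb.
  rewrite Cmod_mult, Cmod_R, Rabs_pos_eq by apply pos_INR.
  rewrite E, Rpow_mult_distr. apply Rmult_le_reg_r with (1 - t); [lra|].
  unfold Rdiv. rewrite Rmult_assoc, (Rmult_assoc K), Rinv_l, Rmult_1_r by lra.
  pose proof (pow_le t n ltac:(lra)) as Htn. pose proof (pos_INR n) as Hn.
  assert (H0 : 0 <= Cmod (f n) * r' ^ n) by (apply Rmult_le_pos; [apply Cmod_ge_0|apply pow_le; lra]).
  assert (H1 : INR n * t ^ n * (1 - t) <= 1) by lra.
  replace (INR n * Cmod (f n) * (r' ^ n * t ^ n * (1 - t)))
    with ((Cmod (f n) * r' ^ n) * (INR n * t ^ n * (1 - t))) by ring.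
  assert (0 <= INR n * t ^ n * (1 - t)) by (repeat apply Rmult_le_pos; lra).
  rewrite <- (Rmult_1_r K). apply Rmult_le_compat; lra.
Qed.

Lemma tame_summable f r : tame f -> 0 <= r < 1 -> ex_series (fun n => Cmod (f n) * r ^ n).
Proof.
  intros Hf Hr. destruct (radius_split r Hr) as (r' & t & Hr' & Ht & E).
  destruct (Hf r' Hr') as [K H].
  apply (ex_series_le (fun n => Cmod (f n) * r ^ n) (fun n => K * t ^ n)).
  - intros n. change (norm (Cmod (f n) * r ^ n)) with (Rabs (Cmod (f n) * r ^ n)).
    rewrite Rabs_pos_eq by (apply Rmult_le_pos; [apply Cmod_ge_0|apply pow_le; lra]).
    rewrite E, Rpow_mult_distr, <- Rmult_assoc. apply Rmult_le_compat_r; [apply pow_le; lra|apply H].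
  - apply (ex_series_scal_l K (fun n => t ^ n)). apply ex_series_geom. rewrite Rabs_pos_eq; lra.
Qed.

Definition PS (f : nat -> C) (x : C) : C := cseries (fun n => f n * Cpow x n)%C.

Lemma PS_Clim f x : tame f -> Cmod x < 1 -> Clim (csum (fun n => f n * Cpow x n)%C) (PS f x).
Proof.
  intros Hf Hx. apply cseries_Clim.
  apply (ex_series_ext (fun n => Cmod (f n) * Cmod x ^ n)).
  - intros n. now rewrite Cmod_mult, Cmod_pow.
  - apply tame_summable; [exact Hf|]. split; [apply Cmod_ge_0|exact Hx].
Qed.

Lemma cseries_ext a b : (forall n, a n = b n) -> cseries a = cseries b.
Proof. intros H. unfold cseries. f_equal; apply Series_ext; intros n; now rewrite H. Qed.

Lemma PS_ext f g x : (forall n, f n = g n) -> PS f x = PS g x.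
Proof. intros H. apply cseries_ext. intros n. now rewrite H. Qed.

Lemma PS_plus f g x : tame f -> tame g -> Cmod x < 1 ->
  PS (fun n => f n + g n)%C x = (PS f x + PS g x)%C.
Proof.
  intros Hf Hg Hx. eapply Clim_unique; [apply PS_Clim; [now apply tame_plus|exact Hx]|].
  refine (Clim_ext_from O _ _ _ _ (Clim_plus _ _ _ _ (PS_Clim f x Hf Hx) (PS_Clim g x Hg Hx))).
  intros n _. rewrite <- csum_plus. apply csum_ext; intros; ring.
Qed.

Lemma PS_scal c f x : tame f -> Cmod x < 1 -> PS (fun n => c * f n)%C x = (c * PS f x)%C.
Proof.
  intros Hf Hx. eapply Clim_unique; [apply PS_Clim; [now apply tame_scal|exact Hx]|].
  refine (Clim_ext_from O _ _ _ _ (Clim_scal c _ _ (PS_Clim f x Hf Hx))).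
  intros n _. rewrite <- csum_scal. apply csum_ext; intros; ring.
Qed.

Lemma PS_shift f x : tame f -> Cmod x < 1 -> PS f x = (f O + x * PS (fun n => f (S n)) x)%C.
Proof.
  intros Hf Hx.
  pose proof (PS_Clim f x Hf Hx) as H. 
  assert (H' : Clim (fun n => csum (fun n => f n * Cpow x n)%C (S n)) (PS f x)).
  { intros eps He. destruct (H eps He) as [n0 Hn0]. exists n0. intros n Hn. apply Hn0. lia. }
  eapply Clim_unique; [exact H'|].
  refine (Clim_ext_from O _ _ _ _ (Clim_plus _ _ _ _ (Clim_const (f O))
    (Clim_scal x _ _ (PS_Clim _ x (tame_shift f Hf) Hx)))).
  intros n _. rewrite csum_first, <- csum_scal. simpl. f_equal; [ring|].
  apply csum_ext; intros; ring.
Qed.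

Lemma PS_const c x : PS (fun n => match n with O => c | S _ => RtoC 0 end) x = c.
Proof.
  apply (Clim_unique (csum (fun n => match n with O => c | S _ => RtoC 0 end * Cpow x n)%C)).
  - apply cseries_Clim. exists (Cmod c).
    apply is_series_Reals. intros eps He. exists O. intros n _. unfold Rdist.
    replace (sum_f_R0 (fun n => Cmod (match n with O => c | S _ => RtoC 0 end * Cpow x n)) n) with (Cmod c).
    + now rewrite Rminus_diag, Rabs_R0.
    + induction n as [|n IH]; simpl.
      * now rewrite Cmult_1_r.
      * rewrite <- IH, Cmult_0_l, Cmod_0. ring.
  - refine (Clim_ext_from 1%nat _ _ _ _ (Clim_const c)). intros [|n] Hn; [lia|].
    rewrite csum_first. rewrite (csum_ext _ (fun _ => RtoC 0)) by (intros; ring).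
    rewrite csum_0. simpl. ring.
Qed.

Lemma PS_rescale f c y : PS f (c * y)%C = PS (fun n => f n * Cpow c n)%C y.
Proof. apply cseries_ext. intros n. rewrite Cpow_mult_l. ring. Qed.

Definition PS_deriv (f : nat -> C) (n : nat) : C := (RtoC (INR (S n)) * f (S n))%C.

Lemma tame_deriv f : tame f -> tame (PS_deriv f).
Proof. intros Hf. apply (tame_shift (fun n => RtoC (INR n) * f n)%C). now apply tame_INR. Qed.

(** The natural bound of this second-order remainder contains [R^(n-1)]; the factor [R ^ 2] on the
    left avoids a negative exponent at [n = 0]. *)
Lemma pow_taylor (x h : C) R n : 0 < R <= 1 -> Cmod x <= R -> Cmod (x + h) <= R ->
  R ^ 2 * Cmod (Cpow (x + h) (S n) - Cpow x (S n) - h * (RtoC (INR (S n)) * Cpow x n))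
  <= INR (S n) ^ 2 * R ^ (S n) * Cmod h ^ 2.
Proof.
  intros HR Hx Hxh. induction n as [|n IH].
  - simpl. replace ((x + h) * 1 - x * 1 - h * (1 * 1))%C with (RtoC 0) by ring. rewrite Cmod_0.
    pose proof (Cmod_ge_0 h). nra.
  - set (E := (Cpow (x + h) (S n) - Cpow x (S n) - h * (RtoC (INR (S n)) * Cpow x n))%C) in *.
    replace (Cpow (x + h) (S (S n)) - Cpow x (S (S n)) - h * (RtoC (INR (S (S n))) * Cpow x (S n)))%C
      with ((x + h) * E + RtoC (INR (S n)) * Cpow x n * (h * h))%C.
    2:{ unfold E. rewrite (S_INR (S n)), RtoC_plus, !Cpow_S. ring. }
    pose proof (Cmod_triangle ((x + h) * E) (RtoC (INR (S n)) * Cpow x n * (h * h))) as Ht.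
    rewrite !Cmod_mult, Cmod_pow, Cmod_R, Rabs_pos_eq in Ht by apply pos_INR.
    assert (Hxn : Cmod x ^ n <= R ^ n) by (apply pow_incr; split; [apply Cmod_ge_0|exact Hx]).
    pose proof (pow_lt R n ltac:(lra)) as HRn. pose proof (Cmod_ge_0 E) as HE0.
    pose proof (Cmod_ge_0 h) as Hh0. pose proof (pos_INR n) as Hn0.
    rewrite (S_INR (S n)). rewrite (S_INR n) in *.
    assert (H1 : Cmod (x + h) * Cmod E <= R * Cmod E) by (apply Rmult_le_compat_r; assumption).
    assert (H2 : (INR n + 1) * Cmod x ^ n * (Cmod h * Cmod h) <= (INR n + 1) * R ^ n * (Cmod h * Cmod h)).
    { apply Rmult_le_compat_r; [nra|]. apply Rmult_le_compat_l; lra. }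
    apply Rle_trans with (R * (R ^ 2 * Cmod E) + R ^ 2 * ((INR n + 1) * R ^ n * (Cmod h * Cmod h))); [nra|].
    apply Rle_trans with (R * ((INR n + 1) ^ 2 * R ^ S n * Cmod h ^ 2)
                          + R ^ 2 * ((INR n + 1) * R ^ n * (Cmod h * Cmod h))).
    { apply Rplus_le_compat_r. apply Rmult_le_compat_l; [lra|exact IH]. }
    simpl. set (H := Cmod h) in *. set (Rn := R ^ n) in *.
    assert (0 <= R * R * Rn * (H * H)) by (repeat apply Rmult_le_pos; lra). nra.
Qed.

Lemma PS_taylor f x : tame f -> Cmod x < 1 -> exists K d, 0 <= K /\ 0 < d /\ forall h, Cmod h < d ->
  Cmod (x + h) < 1 /\ Cmod (PS f (x + h) - PS f x - h * PS (PS_deriv f) x) <= K * Cmod h ^ 2.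
Proof.
  intros Hf Hx. pose proof (Cmod_ge_0 x) as Hx0. set (R := (1 + Cmod x) / 2).
  assert (HR : 0 < R < 1) by (unfold R; lra). assert (HxR : Cmod x < R) by (unfold R; lra).
  (* The second-order remainders are dominated by [n^2 |f n| R^n], which is summable because
     [R < 1]. *)
  set (g := fun n => (RtoC (INR n) * (RtoC (INR n) * f n))%C).
  assert (Hg : tame g) by (now repeat apply tame_INR).
  destruct (tame_summable g R Hg ltac:(lra)) as [B HB].
  assert (HBn : forall n, sum_n (fun n => Cmod (g n) * R ^ n) n <= B).
  { intros n. apply (is_lim_seq_incr_compare (sum_n (fun n => Cmod (g n) * R ^ n)) B); [exact HB|].
    intros m. rewrite sum_Sn. assert (0 <= Cmod (g (S m)) * R ^ S m) by
      (apply Rmult_le_pos; [apply Cmod_ge_0|apply pow_le; lra]). unfold plus; simpl. simpl in H. lra. }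
  assert (HB0 : 0 <= B).
  { eapply Rle_trans; [|apply (HBn 0%nat)]. rewrite sum_O. apply Rmult_le_pos; [apply Cmod_ge_0|apply pow_le; lra]. }
  exists (B / R ^ 2), (R - Cmod x). split; [apply Rdiv_le_0_compat; nra|]. split; [lra|].
  intros h Hh. assert (Hxh : Cmod (x + h) <= R) by (pose proof (Cmod_triangle x h); lra).
  split; [lra|].
  set (T := fun n => (f n * Cpow (x + h) n + (-(1) * (f n * Cpow x n)))%C).
  (* The derivative series lags one index behind: its first [n] terms match [n + 1] terms of the
     difference. *)
  set (T' := fun n => (csum T (S n) + - h * csum (fun n => PS_deriv f n * Cpow x n) n)%C).
  assert (HT : Clim T' (PS f (x + h) + -(1) * PS f x + - h * PS (PS_deriv f) x)%C).
  { apply Clim_plus; [|apply Clim_scal, PS_Clim; [now apply tame_deriv|exact Hx]].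
    assert (H : Clim (csum T) (PS f (x + h) + -(1) * PS f x)%C).
    { refine (Clim_ext_from O _ _ _ _ (Clim_plus _ _ _ _ (PS_Clim f (x + h) Hf ltac:(lra))
         (Clim_scal (-(1))%C _ _ (PS_Clim f x Hf Hx)))).
      intros n _. unfold T. now rewrite csum_plus, csum_scal. }
    intros eps He. destruct (H eps He) as [n0 Hn0]. exists n0. intros n Hn. apply Hn0. lia. }
  replace (PS f (x + h) - PS f x - h * PS (PS_deriv f) x)%C
    with (PS f (x + h) + -(1) * PS f x + - h * PS (PS_deriv f) x - 0)%C by ring.
  refine (Clim_le T' _ _ _ O HT _). intros n _.
  replace (T' n - 0)%C with (T' n) by ring.
  apply Rle_trans with (sum_n (fun n => Cmod (g n) * R ^ n) n / R ^ 2 * Cmod h ^ 2).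
  2:{ apply Rmult_le_compat_r; [apply pow_le, Cmod_ge_0|].
      apply Rmult_le_compat_r; [|apply HBn]. left. apply Rinv_0_lt_compat. nra. }
  induction n as [|n IHn].
  - unfold T', T. simpl. replace (0 + (f O * 1 + - (1) * (f O * 1)) + - h * 0)%C with (RtoC 0) by ring.
    rewrite Cmod_0, sum_O. unfold g. simpl (INR 0). rewrite Cmult_0_l, Cmod_0. lra.
  - replace (T' (S n)) with (T' n + f (S n) *
       (Cpow (x + h) (S n) - Cpow x (S n) - h * (RtoC (INR (S n)) * Cpow x n)))%C.
    2:{ unfold T'. rewrite (csum_S T (S n)), (csum_S (fun n => PS_deriv f n * Cpow x n)%C n).
        unfold T, PS_deriv. ring. }
    eapply Rle_trans; [apply Cmod_triangle|]. rewrite Cmod_mult, sum_Sn.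
    change (plus (sum_n (fun n => Cmod (g n) * R ^ n) n) (Cmod (g (S n)) * R ^ S n))
      with (sum_n (fun n => Cmod (g n) * R ^ n) n + Cmod (g (S n)) * R ^ S n).
    pose proof (pow_taylor x h R n ltac:(lra) ltac:(lra) Hxh) as Hp.
    set (E := Cmod (Cpow (x + h) (S n) - Cpow x (S n) - h * (RtoC (INR (S n)) * Cpow x n))) in *.
    assert (Hg' : Cmod (g (S n)) = INR (S n) ^ 2 * Cmod (f (S n))).
    { unfold g. rewrite !Cmod_mult, Cmod_R, Rabs_pos_eq by apply pos_INR. ring. }
    rewrite Hg'. assert (HR2 : 0 < R ^ 2) by nra.
    apply Rmult_le_reg_l with (R ^ 2); [exact HR2|].
    replace (R ^ 2 * ((sum_n (fun n => Cmod (g n) * R ^ n) n + INR (S n) ^ 2 * Cmod (f (S n)) * R ^ S n) / R ^ 2 * Cmod h ^ 2))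
      with (R ^ 2 * (sum_n (fun n => Cmod (g n) * R ^ n) n / R ^ 2 * Cmod h ^ 2)
            + Cmod (f (S n)) * (INR (S n) ^ 2 * R ^ S n * Cmod h ^ 2)) by (field; lra).
    rewrite Rmult_plus_distr_l. apply Rplus_le_compat.
    + apply Rmult_le_compat_l; [lra|exact IHn].
    + rewrite <- Rmult_assoc, (Rmult_comm (R ^ 2)), Rmult_assoc.
      apply Rmult_le_compat_l; [apply Cmod_ge_0|exact Hp].
Qed.

(** * Differentiation of complex-valued functions of a real variable *)

Definition dC (g : R -> C) (s : R) (l : C) : Prop :=
  is_derive (fun t => fst (g t)) s (fst l) /\ is_derive (fun t => snd (g t)) s (snd l).

Lemma dC_eps g s l : dC g s l <->
  forall eps, 0 < eps -> exists d, 0 < d /\ forall h, Rabs h < d ->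
    Cmod (g (s + h) - g s - RtoC h * l) <= eps * Rabs h.
Proof.
  unfold dC. rewrite !is_derive_Reals. split.
  - intros [H1 H2] eps He. destruct (H1 (eps / 2)) as [d1 Hd1]; [lra|].
    destruct (H2 (eps / 2)) as [d2 Hd2]; [lra|].
    exists (Rmin d1 d2). split; [apply Rmin_glb_lt; apply cond_pos|]. intros h Hh.
    destruct (Req_dec h 0) as [->|Hh0].
    { replace (s + 0) with s by ring. replace (g s - g s - 0 * l)%C with (RtoC 0) by ring.
      rewrite Cmod_0, Rabs_R0. lra. }
    specialize (Hd1 h Hh0 ltac:(eapply Rlt_le_trans; [exact Hh|apply Rmin_l])).
    specialize (Hd2 h Hh0 ltac:(eapply Rlt_le_trans; [exact Hh|apply Rmin_r])).
    assert (Hm : forall (a b c e : R), Rabs ((a - b) / h - c) < e -> Rabs (a - b - h * c) <= e * Rabs h).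
    { intros a b c e H. replace (a - b - h * c) with (((a - b) / h - c) * h) by (field; exact Hh0).
      rewrite Rabs_mult. apply Rmult_le_compat_r; [apply Rabs_pos|lra]. }
    apply Hm in Hd1, Hd2. eapply Rle_trans; [apply Cmod_le_abs|].
    destruct (g (s + h)%R) as [a b], (g s) as [a' b'], l as [c c']. simpl in *.
    replace (a + - a' + - (h * c - 0 * c')) with (a - a' - h * c) by ring.
    replace (b + - b' + - (h * c' + 0 * c)) with (b - b' - h * c') by ring. lra.
  - intros H.
    assert (Hp : forall p : C -> R, (forall x y, p (x - y)%C = p x - p y) ->
       (forall r x, p (RtoC r * x)%C = r * p x) -> (forall x, Rabs (p x) <= Cmod x) ->
       derivable_pt_lim (fun t => p (g t)) s (p l)).
    { intros p Hs Hm Hle eps He. destruct (H (eps / 2)) as (d & Hd & Hb); [lra|].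
      exists (mkposreal d Hd). intros h Hh0 Hh. simpl in Hh. specialize (Hb h Hh).
      pose proof (Hle (g (s + h)%R - g s - RtoC h * l)%C) as Hl. rewrite !Hs, Hm in Hl.
      replace ((p (g (s + h)%R) - p (g s)) / h - p l) with ((p (g (s + h)%R) - p (g s) - h * p l) * / h)
        by (field; exact Hh0).
      pose proof (Rabs_pos_lt h Hh0) as Hh1.
      rewrite Rabs_mult, Rabs_inv. apply Rmult_lt_reg_r with (Rabs h); [exact Hh1|].
      rewrite Rmult_assoc, Rinv_l, Rmult_1_r by lra. nra. }
    split.
    + apply (Hp fst); [reflexivity| |].
      * intros r [x y]. simpl. ring.
      * intros x. eapply Rle_trans; [apply Rmax_l|apply Rmax_Cmod].
    + apply (Hp snd); [reflexivity| |].
      * intros r [x y]. simpl. ring.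
      * intros x. eapply Rle_trans; [apply Rmax_r|apply Rmax_Cmod].
Qed.

Lemma dC_bound g s l : dC g s l -> exists K d, 0 < d /\ forall h, Rabs h < d ->
  Cmod (g (s + h)%R - g s) <= K * Rabs h.
Proof.
  rewrite dC_eps. intros H. destruct (H 1 ltac:(lra)) as (d & Hd & Hb). exists (1 + Cmod l), d.
  split; [exact Hd|]. intros h Hh. specialize (Hb h Hh).
  replace (g (s + h)%R - g s)%C with ((g (s + h)%R - g s - RtoC h * l) + RtoC h * l)%C by ring.
  eapply Rle_trans; [apply Cmod_triangle|]. rewrite Cmod_mult, Cmod_R. lra.
Qed.

Lemma dC_value g s l l' : l = l' -> dC g s l -> dC g s l'.
Proof. intros <-. exact (fun H => H). Qed.

Lemma dC_ext_loc g f s l : locally s (fun t => g t = f t) -> dC g s l -> dC f s l.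
Proof.
  intros E [H1 H2]. split; (eapply is_derive_ext_loc; [|eassumption]);
  apply (filter_imp (fun t => g t = f t)); try exact E; intros t ->; reflexivity.
Qed.

Lemma dC_ext g f s l : (forall t, g t = f t) -> dC g s l -> dC f s l.
Proof. intros E. apply dC_ext_loc. now apply filter_forall. Qed.

Lemma dC_const c s : dC (fun _ => c) s (RtoC 0).
Proof. split; apply (is_derive_const (V := R_NormedModule)). Qed.

Lemma dC_real f s l : is_derive f s l -> dC (fun t => RtoC (f t)) s (RtoC l).
Proof. intros H. split; [exact H|]. apply (is_derive_const (V := R_NormedModule) 0). Qed.

Lemma dC_plus f g s l m : dC f s l -> dC g s m -> dC (fun t => f t + g t)%C s (l + m)%C.
Proof.
  intros [H1 H2] [H3 H4]. split; simpl.
  - apply (is_derive_plus (V := R_NormedModule) (fun t => fst (f t)) (fun t => fst (g t))); assumption.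
  - apply (is_derive_plus (V := R_NormedModule) (fun t => snd (f t)) (fun t => snd (g t))); assumption.
Qed.

Lemma dC_mult f g s l m : dC f s l -> dC g s m -> dC (fun t => f t * g t)%C s (l * g s + f s * m)%C.
Proof.
  intros [H1 H2] [H3 H4]. split; simpl.
  - pose proof (is_derive_minus _ _ _ _ _ (is_derive_mult _ _ _ _ _ H1 H3 Rmult_comm)
                  (is_derive_mult _ _ _ _ _ H2 H4 Rmult_comm)) as H.
    evar_last; [exact H|]. unfold minus, plus, opp, mult; simpl. ring.
  - pose proof (is_derive_plus _ _ _ _ _ (is_derive_mult _ _ _ _ _ H1 H4 Rmult_comm)
                  (is_derive_mult _ _ _ _ _ H2 H3 Rmult_comm)) as H.
    evar_last; [exact H|]. unfold minus, plus, opp, mult; simpl. ring.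
Qed.

Lemma dC_scal c f s l : dC f s l -> dC (fun t => c * f t)%C s (c * l)%C.
Proof.
  intros H. refine (dC_value _ _ _ _ _ (dC_mult _ _ _ _ _ (dC_const c s) H)). simpl. ring.
Qed.

Lemma dC_opp f s l : dC f s l -> dC (fun t => - f t)%C s (- l)%C.
Proof.
  intros H. apply (dC_ext (fun t => -(1) * f t)%C); [intros; ring|].
  apply (dC_value _ _ (-(1) * l)%C); [ring|]. now apply dC_scal.
Qed.

Lemma dC_minus f g s l m : dC f s l -> dC g s m -> dC (fun t => f t - g t)%C s (l - m)%C.
Proof. intros Hf Hg. apply dC_plus; [exact Hf|now apply dC_opp]. Qed.

Lemma dC_inv f s l : dC f s l -> f s <> RtoC 0 -> dC (fun t => / f t)%C s (- l / (f s * f s))%C.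
Proof.
  intros [H1 H2] Hf. set (p := fun t => fst (f t)) in *. set (q := fun t => snd (f t)) in *.
  assert (Hn : p s ^ 2 + q s ^ 2 <> 0).
  { intros E. apply Hf. unfold p, q in E. destruct (f s) as [x y]; simpl in E.
    assert (x = 0) by nra. assert (y = 0) by nra. subst. reflexivity. }
  assert (Hn' : p s * p s + q s * q s <> 0) by (intros E; apply Hn; nra).
  assert (Hd : is_derive (fun t => p t ^ 2 + q t ^ 2) s (2 * p s * fst l + 2 * q s * snd l)).
  { apply (is_derive_ext (fun t => plus (mult (p t) (p t)) (mult (q t) (q t)))).
    { intros t. unfold plus, mult, p, q; simpl. ring. }
    evar_last; [exact (is_derive_plus _ _ _ _ _ (is_derive_mult _ _ _ _ _ H1 H1 Rmult_comm)
                  (is_derive_mult _ _ _ _ _ H2 H2 Rmult_comm))|].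
    unfold plus, mult, p, q; simpl. ring. }
  assert (E2 : (p s * p s - q s * q s) ^ 2 + (2 * p s * q s) ^ 2 = (p s ^ 2 + q s ^ 2) ^ 2) by ring.
  assert (Hn2 : (p s * p s - q s * q s) ^ 2 + (2 * p s * q s) ^ 2 <> 0).
  { rewrite E2. now apply pow_nonzero. }
  split; simpl.
  - evar_last; [exact (is_derive_div _ _ _ _ _ H1 Hd Hn)|]. fold (p s) (q s).
    replace (p s * q s + q s * p s) with (2 * p s * q s) by ring.
    unfold p, q in *. field.
    split; first [exact Hn | exact Hn' | intros E; apply Hn2; rewrite <- E; ring].
  - evar_last; [exact (is_derive_div _ _ _ _ _ (is_derive_opp _ _ _ H2) Hd Hn)|].
    fold (p s) (q s). unfold opp; simpl. fold (q s).
    replace (p s * q s + q s * p s) with (2 * p s * q s) by ring.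
    unfold p, q in *. field.
    split; first [exact Hn | exact Hn' | intros E; apply Hn2; rewrite <- E; ring].
Qed.

Lemma dC_div f g s l m : dC f s l -> dC g s m -> g s <> RtoC 0 ->
  dC (fun t => f t / g t)%C s ((l * g s - f s * m) / (g s * g s))%C.
Proof.
  intros Hf Hg Hg0. refine (dC_value _ _ _ _ _ (dC_mult _ _ _ _ _ Hf (dC_inv _ _ _ Hg Hg0))).
  simpl. field. exact Hg0.
Qed.

Lemma dC_pow f s l n : dC f s l -> dC (fun t => Cpow (f t) (S n)) s (RtoC (INR (S n)) * Cpow (f s) n * l)%C.
Proof.
  intros H. induction n as [|n IH].
  - apply (dC_value _ _ l); [simpl; ring|]. apply (dC_ext f); [|exact H]. intros t. simpl. ring.
  - apply (dC_ext (fun t => f t * Cpow (f t) (S n))%C); [reflexivity|].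
    refine (dC_value _ _ _ _ _ (dC_mult _ _ _ _ _ H IH)). rewrite (S_INR (S n)), RtoC_plus, !Cpow_S. ring.
Qed.

Lemma dC_PS f g s l : tame f -> dC g s l -> Cmod (g s) < 1 ->
  dC (fun t => PS f (g t)) s (l * PS (PS_deriv f) (g s))%C.
Proof.
  intros Hf Hg Hs. rewrite dC_eps in Hg |- *. intros eps He.
  destruct (PS_taylor f (g s) Hf Hs) as (K & d & HK & Hd & HT).
  set (D := PS (PS_deriv f) (g s)) in *. pose proof (Cmod_ge_0 D) as HD. pose proof (Cmod_ge_0 l) as Hl.
  (* Half of [eps] is spent on the quadratic remainder of the series, the other half on the
     linearisation error of [g] multiplied by [D]. *)
  destruct (Hg (Rmin 1 (eps / (2 * (Cmod D + 1))))) as (d1 & Hd1 & H1).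
  { apply Rmin_glb_lt; [lra|]. apply Rdiv_lt_0_compat; lra. }
  set (A := Cmod l + 1).
  exists (Rmin d1 (Rmin (d / A) (eps / (2 * (K + 1) * A ^ 2)))). split.
  { repeat apply Rmin_glb_lt; [exact Hd1| |]; apply Rdiv_lt_0_compat; unfold A; try lra. nra. }
  intros h Hh.
  assert (Hh1 : Rabs h < d1) by (eapply Rlt_le_trans; [exact Hh|apply Rmin_l]).
  assert (Hh2 : Rabs h < d / A) by (eapply Rlt_le_trans; [exact Hh|eapply Rle_trans; [apply Rmin_r|apply Rmin_l]]).
  assert (Hh3 : Rabs h < eps / (2 * (K + 1) * A ^ 2))
    by (eapply Rlt_le_trans; [exact Hh|eapply Rle_trans; [apply Rmin_r|apply Rmin_r]]).
  specialize (H1 h Hh1). set (De := (g (s + h)%R - g s)%C) in *.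
  pose proof (Rabs_pos h) as Hh0.
  assert (HDe : Cmod De <= A * Rabs h).
  { replace De with ((De - RtoC h * l) + RtoC h * l)%C by ring.
    eapply Rle_trans; [apply Cmod_triangle|]. rewrite Cmod_mult, Cmod_R.
    pose proof (Rmin_l 1 (eps / (2 * (Cmod D + 1)))). unfold A. nra. }
  assert (HA : 0 < A) by (unfold A; lra).
  assert (HDd : Cmod De < d).
  { eapply Rle_lt_trans; [exact HDe|]. apply Rmult_lt_reg_r with (/ A); [now apply Rinv_0_lt_compat|].
    replace (A * Rabs h * / A) with (Rabs h) by (field; lra). exact Hh2. }
  destruct (HT De HDd) as [_ HT']. replace (g s + De)%C with (g (s + h)%R) in HT' by (unfold De; ring).
  replace (PS f (g (s + h)%R) - PS f (g s) - RtoC h * (l * D))%C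
    with ((PS f (g (s + h)%R) - PS f (g s) - De * D) + (De - RtoC h * l) * D)%C by ring.
  eapply Rle_trans; [apply Cmod_triangle|]. rewrite Cmod_mult.
  assert (P1 : K * Cmod De ^ 2 <= eps / 2 * Rabs h).
  { apply Rle_trans with (K * (A * Rabs h) ^ 2).
    - apply Rmult_le_compat_l; [exact HK|]. apply pow_incr. split; [apply Cmod_ge_0|exact HDe].
    - replace (K * (A * Rabs h) ^ 2) with (K * A ^ 2 * Rabs h * Rabs h) by ring.
      apply Rmult_le_compat_r; [exact Hh0|].
      assert (H2 : 2 * (K + 1) * A ^ 2 * Rabs h <= eps).
      { apply Rlt_le. apply Rmult_lt_reg_r with (/ (2 * (K + 1) * A ^ 2)).
        - apply Rinv_0_lt_compat. nra.
        - replace (2 * (K + 1) * A ^ 2 * Rabs h * / (2 * (K + 1) * A ^ 2)) with (Rabs h); [exact Hh3|].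
          field. split; nra. }
      assert (0 <= A ^ 2 * Rabs h) by (apply Rmult_le_pos; nra). nra. }
  assert (P2 : Cmod (De - RtoC h * l) * Cmod D <= eps / 2 * Rabs h).
  { pose proof (Rmin_r 1 (eps / (2 * (Cmod D + 1)))) as Hr.
    assert (H2 : Cmod (De - RtoC h * l) <= eps / (2 * (Cmod D + 1)) * Rabs h) by nra.
    apply Rle_trans with (eps / (2 * (Cmod D + 1)) * Rabs h * (Cmod D + 1)).
    - apply Rmult_le_compat; [apply Cmod_ge_0|exact HD|exact H2|lra].
    - apply Req_le. field. lra. }
  lra.
Qed.

Lemma dC_zero_const f a b : (forall s, a < s < b -> dC f s (RtoC 0)) ->
  forall s t, a < s < b -> a < t < b -> f s = f t.
Proof.
  intros H.
  assert (Hlt : forall s t, a < s < b -> a < t < b -> s < t -> f s = f t).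
  { intros s t Hs Ht Hst. apply injective_projections.
    - apply (eq_is_derive (V := R_NormedModule) (fun t => fst (f t))); [|exact Hst].
      intros u Hu. apply (H u). lra.
    - apply (eq_is_derive (V := R_NormedModule) (fun t => snd (f t))); [|exact Hst].
      intros u Hu. apply (H u). lra. }
  intros s t Hs Ht. destruct (Rtotal_order s t) as [Hst|[->|Hst]]; [now apply Hlt|reflexivity|].
  symmetry. now apply Hlt.
Qed.

(** * Abel's theorem in a Stolz angle *)

Lemma Clim_0_bounded e : Clim e (RtoC 0) -> exists B, 0 <= B /\ forall n, Cmod (e n) <= B.
Proof.
  intros H. destruct (H 1 ltac:(lra)) as [n0 Hn0].
  assert (H0 : exists B, 0 <= B /\ forall n, (n < n0)%nat -> Cmod (e n) <= B).
  { clear Hn0. induction n0 as [|m (B & HB & IH)]; [exists 0; split; [lra|lia]|].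
    exists (Rmax B (Cmod (e m))). split; [eapply Rle_trans; [exact HB|apply Rmax_l]|].
    intros n Hn. destruct (Nat.eq_dec n m) as [->|Hnm]; [apply Rmax_r|].
    eapply Rle_trans; [apply IH; lia|apply Rmax_l]. }
  destruct H0 as (B & HB & H0). exists (B + 1). split; [lra|]. intros n.
  destruct (le_lt_dec n0 n) as [Hn|Hn]; [|specialize (H0 n Hn); lra].
  specialize (Hn0 n Hn). replace (e n - 0)%C with (e n) in Hn0 by ring. lra.
Qed.

(** In a Stolz angle [|1 - y| <= K (1 - |y|)] cancels the factor [1 / (1 - |y|)] that bounds the
    tail of the series. This serves Abel's theorem, and also the product of a divergent series with
    a factor vanishing at the end point. *)
Lemma stolz_null e K : Clim e (RtoC 0) -> forall eps, 0 < eps -> exists d, 0 < d /\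
  forall y, Cmod y < 1 -> Cmod (1 - y) <= K * (1 - Cmod y) -> Cmod (1 - y) < d ->
    Cmod (1 - y) * Cmod (PS e y) <= eps.
Proof.
  intros He eps Heps.
  set (K' := Rabs K + 1). assert (HK' : 1 <= K') by (unfold K'; pose proof (Rabs_pos K); lra).
  assert (HKK : K <= K') by (unfold K'; pose proof (Rle_abs K); lra).
  set (e' := eps / (2 * K')). assert (He' : 0 < e') by (apply Rdiv_lt_0_compat; lra).
  destruct (He e' He') as [n0 Hn0].
  destruct (Clim_0_bounded e He) as (B & HB & HeB).
  exists (eps / (2 * (B * INR n0 + 1))).
  assert (HBn : 0 <= B * INR n0) by (apply Rmult_le_pos; [exact HB|apply pos_INR]).
  split; [apply Rdiv_lt_0_compat; lra|].
  intros y Hy Hst Hd. set (r := Cmod y) in *. pose proof (Cmod_ge_0 y) as Hr0. fold r in Hr0.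
  pose proof (Cmod_ge_0 (1 - y)) as H1y.
  assert (Hpart : forall M, Cmod (csum (fun n => e n * Cpow y n)%C M)
            <= B * INR (min M n0) + e' * ((1 - r ^ M) / (1 - r))).
  { induction M as [|M IH].
    - simpl. rewrite Cmod_0. replace ((1 - 1) / (1 - r)) with 0 by (field; lra). lra.
    - rewrite csum_S. eapply Rle_trans; [apply Cmod_triangle|].
      rewrite Cmod_mult, Cmod_pow. fold r.
      pose proof (pow_unit r M ltac:(lra)) as Hrm.
      assert (Eg : (1 - r ^ S M) / (1 - r) = (1 - r ^ M) / (1 - r) + r ^ M) by (simpl; field; lra).
      rewrite Eg. destruct (le_lt_dec n0 M) as [Hn|Hn].
      + rewrite !Nat.min_r in * by lia. specialize (Hn0 M Hn).
        replace (e M - 0)%C with (e M) in Hn0 by ring. nra.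
      + rewrite !Nat.min_l in * by lia. rewrite S_INR. specialize (HeB M).
        pose proof (Cmod_ge_0 (e M)). nra. }
  assert (HPS : Cmod (PS e y) <= B * INR n0 + e' / (1 - r)).
  { assert (Ht : tame e) by (now apply tame_bounded with B).
    pose proof (PS_Clim e y Ht Hy) as HL.
    replace (PS e y) with (PS e y - 0)%C by ring.
    refine (Clim_le _ _ _ _ O HL _). intros M _.
    replace (csum (fun n => e n * Cpow y n) M - 0)%C with (csum (fun n => e n * Cpow y n)%C M) by ring.
    eapply Rle_trans; [apply Hpart|]. apply Rplus_le_compat.
    - apply Rmult_le_compat_l; [exact HB|]. apply le_INR. lia.
    - unfold Rdiv. apply Rmult_le_compat_l; [lra|]. rewrite <- (Rmult_1_l (/ (1 - r))) at 2.
      apply Rmult_le_compat_r; [left; apply Rinv_0_lt_compat; lra|].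
      pose proof (pow_le r M Hr0). lra. }
  apply Rle_trans with (Cmod (1 - y) * (B * INR n0 + e' / (1 - r))).
  { apply Rmult_le_compat_l; assumption. }
  rewrite Rmult_plus_distr_l.
  assert (P1 : Cmod (1 - y) * (B * INR n0) <= eps / 2).
  { assert (Hd' : Cmod (1 - y) * (2 * (B * INR n0 + 1)) <= eps).
    { apply Rlt_le. apply Rmult_lt_reg_r with (/ (2 * (B * INR n0 + 1))).
      - apply Rinv_0_lt_compat. lra.
      - rewrite Rmult_assoc, Rinv_r, Rmult_1_r by lra. exact Hd. }
    nra. }
  assert (P2 : Cmod (1 - y) * (e' / (1 - r)) <= eps / 2).
  { apply Rle_trans with (K' * (1 - r) * (e' / (1 - r))).
    - apply Rmult_le_compat_r; [apply Rdiv_le_0_compat; lra|]. nra.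
    - apply Req_le. unfold e'. field. split; lra. }
  lra.
Qed.

Lemma PS_partial_sums f y : tame f -> tame (fun n => csum f (S n)) -> Cmod y < 1 ->
  PS f y = ((1 - y) * PS (fun n => csum f (S n)) y)%C.
Proof.
  intros Hf Hs Hy. set (sg := fun n => csum f (S n)) in *.
  assert (E : PS sg y = (f O + y * (PS sg y + PS (fun n => f (S n)) y))%C).
  { rewrite PS_shift at 1 by assumption. replace (sg O) with (f O) by (unfold sg; simpl; ring).
    do 2 f_equal. rewrite <- PS_plus; [|exact Hs|now apply tame_shift|exact Hy].
    apply PS_ext. intros n. reflexivity. }
  rewrite (PS_shift f y Hf Hy). replace ((1 - y) * PS sg y)%C with (PS sg y - y * PS sg y)%C by ring.
  rewrite E at 1. ring.
Qed.

(** The limit 0 suffices: the lemma is applied to the difference between a series and its model made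
    of powers of the logarithm. *)
Lemma abel_stolz f K : tame f -> Clim (csum f) (RtoC 0) -> forall eps, 0 < eps -> exists d, 0 < d /\
  forall y, Cmod y < 1 -> Cmod (1 - y) <= K * (1 - Cmod y) -> Cmod (1 - y) < d ->
    Cmod (PS f y) <= eps.
Proof.
  intros Hf Hs eps He.
  assert (Hs' : Clim (fun n => csum f (S n)) (RtoC 0)).
  { intros e' He'. destruct (Hs e' He') as [n0 Hn0]. exists n0. intros n Hn. apply Hn0. lia. }
  destruct (stolz_null _ K Hs' eps He) as (d & Hd & H). exists d. split; [exact Hd|].
  intros y Hy Hst Hyd. destruct (Clim_0_bounded _ Hs') as (B & _ & HB).
  rewrite PS_partial_sums by (try assumption; now apply tame_bounded with B).
  rewrite Cmod_mult. now apply H.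
Qed.

(** * Hyperlogarithms along a path in the unit disc *)

(** [coeffs_term] gives the Taylor coefficients in [x] of [c Li_{s,...}(z x, ...)], where only the
    outermost argument varies. The constructor [coeffs_ext] stands in for functional
    extensionality. *)
Inductive coeffs (N : nat) : nat -> (nat -> C) -> Prop :=
| coeffs_const k c : in_CMZV k N c ->
    coeffs N k (fun n => match n with O => c | S _ => RtoC 0 end)
| coeffs_term k m c s z r : in_CMZV k N c -> word N ((s, z) :: r) ->
    sum_weights ((s, z) :: r) = m ->
    coeffs N (k + m) (fun n => c * (Cpow z n / Cpow (RtoC (INR n)) s * LiT r n))%C
| coeffs_plus k f g : coeffs N k f -> coeffs N k g -> coeffs N k (fun n => f n + g n)%C
| coeffs_ext k f g : (forall n, f n = g n) -> coeffs N k f -> coeffs N k g.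

Lemma root_neq_0 N z : (1 <= N)%nat -> cpow z N = RtoC 1 -> z <> RtoC 0.
Proof.
  intros HN Hz E. apply root_Cmod in Hz; [|exact HN]. rewrite E, Cmod_0 in Hz. lra.
Qed.

Lemma root_mult N z w : cpow z N = RtoC 1 -> cpow w N = RtoC 1 -> cpow (z * w) N = RtoC 1.
Proof. intros Hz Hw. rewrite cpow_Cpow in *. rewrite Cpow_mult_l, Hz, Hw. ring. Qed.

Lemma root_inv N z : (1 <= N)%nat -> cpow z N = RtoC 1 -> cpow (/ z) N = RtoC 1.
Proof.
  intros HN Hz. pose proof (root_neq_0 N z HN Hz) as H0. rewrite cpow_Cpow in *.
  rewrite Cpow_inv, Hz by exact H0. field.
Qed.

Lemma Cdiv_0_r x : (x / RtoC 0)%C = RtoC 0.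
Proof. unfold Cdiv. rewrite Cinv_0. ring. Qed.

Lemma INR_S_neq_0 n : RtoC (INR (S n)) <> RtoC 0.
Proof. apply INR_C_neq_0. lia. Qed.

Lemma coeffs_scal N m k c f : (1 <= N)%nat -> in_CMZV m N c -> coeffs N k f ->
  coeffs N (m + k) (fun n => c * f n)%C.
Proof.
  intros HN Hc. induction 1 as [k d Hd|k j d s z r Hd Hw Hk|k f g _ IHf _ IHg|k f g E _ IH].
  - refine (coeffs_ext _ _ _ _ _ (coeffs_const N (m + k) (c * d)%C _)).
    + intros [|n]; [reflexivity|ring].
    + now apply in_CMZV_mult.
  - rewrite Nat.add_assoc. refine (coeffs_ext _ _ _ _ _ (coeffs_term N (m + k) j (c * d)%C s z r _ Hw Hk)).
    + intros n. simpl. ring.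
    + now apply in_CMZV_mult.
  - refine (coeffs_ext _ _ _ _ _ (coeffs_plus _ _ _ _ IHf IHg)). intros n. simpl. ring.
  - refine (coeffs_ext _ _ _ _ _ IH). intros n. simpl. now rewrite E.
Qed.

Lemma coeffs_at_0 N k f : coeffs N k f -> in_CMZV k N (f O).
Proof.
  induction 1 as [k d Hd|k j d s z r Hd Hw Hk|k f g _ IHf _ IHg|k f g E _ IH].
  - exact Hd.
  - simpl (INR 0). rewrite Cpow_0_l by exact (word_pos _ _ _ _ _ Hw eq_refl).
    rewrite Cdiv_0_r. replace (d * (0 * LiT r 0))%C with (RtoC 0) by ring. apply in_CMZV_0.
  - now apply in_CMZV_plus.
  - now rewrite <- E.
Qed.

Lemma coeffs_null N k f : (1 <= N)%nat -> coeffs N k f -> Clim f (RtoC 0).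
Proof.
  intros HN. induction 1 as [k d Hd|k j d s z r Hd Hw Hk|k f g _ IHf _ IHg|k f g E _ IH].
  - refine (Clim_ext_from 1%nat _ _ _ _ (Clim_const (RtoC 0))). intros [|n] Hn; [lia|reflexivity].
  - replace (RtoC 0) with (d * 0)%C by ring. apply Clim_scal.
    pose proof (Forall_inv Hw) as [Hs Hz]. pose proof (Forall_inv_tail Hw) as Hr. simpl in Hs, Hz.
    pose proof (slow_null _ (lterm_slow z s 1 (LiT r) (root_Cmod N z HN Hz) Hs (LiT_slow N r HN Hr))) as H.
    refine (Clim_ext_from 1%nat _ _ _ _ H). intros [|n] Hn; [lia|]. cbv beta. rewrite Cpow_1_r.
    field. split; [apply Cpow_nz|]; apply INR_S_neq_0.
  - replace (RtoC 0) with (0 + 0)%C by ring. now apply Clim_plus.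
  - refine (Clim_ext_from O _ _ _ _ IH). intros n _. apply E.
Qed.

Lemma coeffs_tame N k f : (1 <= N)%nat -> coeffs N k f -> tame f.
Proof.
  intros HN H. destruct (Clim_0_bounded f (coeffs_null N k f HN H)) as (B & _ & HB).
  now apply tame_bounded with B.
Qed.

(** Integration against [dx / x] needs a series without constant term; the constant is treated
    apart, as a power of the logarithm. *)
Lemma coeffs_split N k f : (1 <= N)%nat -> coeffs N k f -> exists f1,
  coeffs N k f1 /\ f1 O = RtoC 0 /\ PS_deriv f1 = PS_deriv f /\
  forall x, Cmod x < 1 -> PS f x = (PS f1 x + f O)%C.
Proof.
  intros HN Hf. set (f0 := fun n => match n with O => f O | S _ => RtoC 0 end).
  assert (Hf0 : coeffs N k f0) by (apply coeffs_const; exact (coeffs_at_0 N _ f Hf)).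
  exists (fun n => match n with O => RtoC 0 | S _ => f n end).
  assert (Hf1 : coeffs N k (fun n => match n with O => RtoC 0 | S _ => f n end)).
  { refine (coeffs_ext _ _ _ _ _ (coeffs_plus _ _ _ _ Hf (coeffs_scal N 0 k _ _ HN (in_CMZV_m1 N) Hf0))).
    intros [|n]; simpl; ring. }
  repeat split; [exact Hf1|]. intros x Hx. rewrite <- (PS_const (f O) x).
  rewrite <- PS_plus by (try exact Hx; apply (coeffs_tame N k); assumption).
  apply PS_ext. intros [|n]; simpl; ring.
Qed.

Lemma csum_const_0 (c : C) (h : nat -> C) n :
  csum (fun m => match m with O => c | S _ => RtoC 0 end * h m)%C (S n) = (c * h O)%C.
Proof.
  rewrite csum_first, (csum_ext _ (fun _ => RtoC 0)) by (intros; ring). rewrite csum_0. ring.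
Qed.

Lemma csum_term d s z r w n : (0 < s)%nat ->
  csum (fun m => d * (Cpow z m / Cpow (RtoC (INR m)) s * LiT r m) * Cpow w m)%C n
  = (d * LiT ((s, (z * w)%C) :: r) n)%C.
Proof.
  intros Hs. rewrite LiT_csum, <- csum_scal by exact Hs. apply csum_ext. intros m _.
  rewrite Cpow_mult_l. unfold Cdiv. ring.
Qed.

(** At a root [w] the outermost root [z] becomes [z * w], so the partial sums are again truncated
    sums of level [N]. *)
Lemma coeffs_regular N k f w : (1 <= N)%nat -> cpow w N = RtoC 1 -> coeffs N k f ->
  regular N k (csum (fun n => f n * Cpow w n)%C).
Proof.
  intros HN Hw. induction 1 as [k d Hd|k j d s z r Hd Hzr Hk|k f g _ IHf _ IHg|k f g E _ IH].
  - pose proof (regular_scal N 0 k d _ HN Hd (regular_LiT N [] HN (Forall_nil _))) as H.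
    rewrite Nat.add_0_r in H. refine (regular_ext _ _ _ _ _ H). intros [|n] Hn; [lia|].
    rewrite csum_const_0. reflexivity.
  - pose proof (Forall_inv Hzr) as [Hs Hz]. pose proof (Forall_inv_tail Hzr) as Hr. simpl in Hs, Hz.
    assert (Hwd : word N ((s, (z * w)%C) :: r)).
    { constructor; [|exact Hr]. simpl. split; [exact Hs|now apply root_mult]. }
    pose proof (regular_scal N _ k d _ HN Hd (regular_LiT N _ HN Hwd)) as H.
    replace (sum_weights ((s, (z * w)%C) :: r)) with j in H by (rewrite <- Hk; reflexivity).
    refine (regular_ext _ _ _ _ _ H). intros n _. cbv beta. now rewrite csum_term.
  - refine (regular_ext _ _ _ _ _ (regular_plus _ _ _ _ IHf IHg)). intros n _. cbv beta.
    rewrite <- csum_plus. apply csum_ext. intros; ring.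
  - refine (regular_ext _ _ _ _ _ IH). intros n _. apply csum_ext. intros; now rewrite E.
Qed.

(* Taylor coefficients of the primitives of [PS f x / x] (when [f 0 = 0]) and [PS f x / (x - w)]. *)
Definition int_zero (f : nat -> C) (n : nat) : C := (f n / RtoC (INR n))%C.

Definition int_root (w : C) (f : nat -> C) (n : nat) : C :=
  (- (Cpow (/ w) n / RtoC (INR n) * csum (fun m => f m * Cpow w m) n))%C.

Lemma coeffs_int_zero N k f : coeffs N k f -> coeffs N (S k) (int_zero f).
Proof.
  induction 1 as [k d Hd|k j d s z r Hd Hw Hk|k f g _ IHf _ IHg|k f g E _ IH].
  - refine (coeffs_ext _ _ _ _ _ (coeffs_const N (S k) (RtoC 0) (in_CMZV_0 _ _))).
    intros [|n]; unfold int_zero; [simpl (INR 0); now rewrite Cdiv_0_r|unfold Cdiv; ring].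
  - rewrite plus_n_Sm.
    assert (Hw' : word N ((S s, z) :: r)).
    { pose proof (Forall_inv Hw) as [Hs Hz]. constructor; [|exact (Forall_inv_tail Hw)].
      simpl in *. split; [lia|exact Hz]. }
    refine (coeffs_ext _ _ _ _ _ (coeffs_term N k (S j) d (S s) z r Hd Hw' _)).
    + intros [|n]; unfold int_zero.
      * simpl (INR 0). rewrite (Cpow_0_l (S s)), !Cdiv_0_r by lia. ring.
      * rewrite (Cpow_S _ s). field. split; [apply Cpow_nz|]; apply INR_S_neq_0.
    + simpl in *. lia.
  - refine (coeffs_ext _ _ _ _ _ (coeffs_plus _ _ _ _ IHf IHg)). intros n. unfold int_zero, Cdiv. ring.
  - refine (coeffs_ext _ _ _ _ _ IH). intros n. unfold int_zero. now rewrite E.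
Qed.

(** Expanding [1 / (x - w)] geometrically produces the partial sums of [f] at [w]; they become the
    inner truncated sum under a new outer letter [(1, / w)]. *)
Lemma coeffs_int_root N k f w : (1 <= N)%nat -> cpow w N = RtoC 1 -> coeffs N k f ->
  coeffs N (S k) (int_root w f).
Proof.
  intros HN Hw. pose proof (root_inv N w HN Hw) as Hw'.
  induction 1 as [k d Hd|k j d s z r Hd Hzr Hk|k f g _ IHf _ IHg|k f g E _ IH].
  - replace (S k) with (k + 1)%nat by lia.
    refine (coeffs_ext _ _ _ _ _ (coeffs_term N k 1 (- d)%C 1 (/ w)%C [] (in_CMZV_opp _ _ _ Hd) _ eq_refl)).
    + intros [|n]; unfold int_root; rewrite Cpow_1_r.
      * simpl (INR 0). rewrite !Cdiv_0_r. ring.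
      * rewrite csum_const_0. simpl LiT. simpl (Cpow w 0). ring.
    + constructor; [|constructor]. split; [simpl; lia|exact Hw'].
  - rewrite plus_n_Sm.
    pose proof (Forall_inv Hzr) as [Hs Hz]. simpl in Hs, Hz.
    assert (Hwd : word N ((1%nat, (/ w)%C) :: (s, (z * w)%C) :: r)).
    { constructor; [split; [simpl; lia|exact Hw']|].
      constructor; [split; [exact Hs|now apply root_mult]|exact (Forall_inv_tail Hzr)]. }
    refine (coeffs_ext _ _ _ _ _ (coeffs_term N k (S j) (- d)%C 1 (/ w)%C _ (in_CMZV_opp _ _ _ Hd) Hwd _)).
    + intros n. unfold int_root. rewrite csum_term, Cpow_1_r by exact Hs. ring.
    + simpl in *. lia.
  - refine (coeffs_ext _ _ _ _ _ (coeffs_plus _ _ _ _ IHf IHg)). intros n. unfold int_root.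
    rewrite (csum_ext (fun m => (f m + g m) * Cpow w m)%C (fun m => f m * Cpow w m + g m * Cpow w m)%C)
      by (intros; ring).
    rewrite csum_plus. ring.
  - refine (coeffs_ext _ _ _ _ _ IH). intros n. unfold int_root. do 2 f_equal.
    apply csum_ext. intros; now rewrite E.
Qed.

Lemma PS_int_zero f x : tame f -> f O = RtoC 0 -> Cmod x < 1 ->
  (x * PS (PS_deriv (int_zero f)) x)%C = PS f x.
Proof.
  intros Hf H0 Hx. rewrite (PS_shift f) by assumption. rewrite H0.
  rewrite (PS_ext (PS_deriv (int_zero f)) (fun n => f (S n))); [ring|].
  intros n. unfold PS_deriv, int_zero. field. apply INR_S_neq_0.
Qed.

(** The coefficients [h n = n * int_root w f n] satisfy [w h(n+1) = h(n) - f(n)]; summing this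
    recurrence avoids a Cauchy product. *)
Lemma PS_int_root f w x : tame f -> tame (int_root w f) -> w <> RtoC 0 -> Cmod x < 1 ->
  ((x - w) * PS (PS_deriv (int_root w f)) x)%C = PS f x.
Proof.
  intros Hf Hi Hw Hx. set (h := fun n => (RtoC (INR n) * int_root w f n)%C).
  assert (Hh : tame h) by (now apply tame_INR).
  assert (Hh0 : h O = RtoC 0) by (unfold h; simpl (INR 0); ring).
  assert (E : forall n, h (S n) = (/ w * h n + - / w * f n)%C).
  { assert (Eh : forall n, h n = (- (Cpow (/ w) n * csum (fun m => f m * Cpow w m) n))%C).
    { intros [|n]; [rewrite Hh0; simpl; ring|]. unfold h, int_root.
      generalize (Cpow (/ w) (S n)) (csum (fun m => f m * Cpow w m)%C (S n)). intros a b.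
      field. apply INR_S_neq_0. }
    intros n. rewrite !Eh, csum_S, Cpow_S.
    assert (Ew : (Cpow (/ w) n * Cpow w n)%C = RtoC 1).
    { rewrite <- Cpow_mult_l, Cinv_l by exact Hw. apply Cpow_1_l. }
    transitivity (- (/ w * (Cpow (/ w) n * csum (fun m => f m * Cpow w m) n
       + f n * (Cpow (/ w) n * Cpow w n))))%C; [ring|]. rewrite Ew. ring. }
  assert (EP : PS (PS_deriv (int_root w f)) x = (/ w * PS h x + - / w * PS f x)%C).
  { rewrite <- !PS_scal, <- PS_plus by (try assumption; now apply tame_scal).
    apply PS_ext. intros n. apply E. }
  assert (EH : PS h x = (x * PS (PS_deriv (int_root w f)) x)%C).
  { rewrite (PS_shift h) by assumption. rewrite Hh0. unfold PS_deriv, h. ring. }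
  rewrite EH in EP. set (D := PS (PS_deriv (int_root w f)) x) in *.
  replace ((x - w) * D)%C with (x * D - w * D)%C by ring. rewrite EP at 2. field. exact Hw.
Qed.

(** The logarithm [T] counts with weight 1. Equality is asked only on the open interval, where the
    series converge; the ends are reached by limits. *)
Inductive Fun (N : nat) (g T : R -> C) : nat -> (R -> C) -> Prop :=
| Fun_PS k j f : coeffs N k f -> Fun N g T (j + k) (fun s => Cpow (T s) j * PS f (g s))%C
| Fun_plus k p q : Fun N g T k p -> Fun N g T k q -> Fun N g T k (fun s => p s + q s)%C
| Fun_ext k p q : (forall s, 0 < s < 1 -> p s = q s) -> Fun N g T k p -> Fun N g T k q.

(* [T] is a branch of [log g]. *)
Definition log_path (g g' T : R -> C) : Prop :=
  forall s, 0 < s < 1 ->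
    dC g s (g' s) /\ dC T s (g' s / g s)%C /\ Cmod (g s) < 1 /\ g s <> RtoC 0.

Lemma in_CMZV_INR N n : in_CMZV 0 N (RtoC (INR n)).
Proof.
  induction n as [|n IH]; [apply in_CMZV_0|]. rewrite S_INR, RtoC_plus.
  apply in_CMZV_plus; [exact IH|apply in_CMZV_1].
Qed.

Lemma Fun_scal N g g' T m k c p : (1 <= N)%nat -> log_path g g' T -> in_CMZV m N c ->
  Fun N g T k p -> Fun N g T (m + k) (fun s => c * p s)%C.
Proof.
  intros HN Hg Hc. induction 1 as [k j f Hf|k p q _ IHp _ IHq|k p q E _ IH].
  - replace (m + (j + k))%nat with (j + (m + k))%nat by lia.
    refine (Fun_ext _ _ _ _ _ _ _ (Fun_PS N g T (m + k) j _ (coeffs_scal N m k c f HN Hc Hf))).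
    intros s Hs. destruct (Hg s Hs) as (_ & _ & Hlt & _). cbv beta.
    rewrite PS_scal by (try exact Hlt; now apply (coeffs_tame N k)). ring.
  - refine (Fun_ext _ _ _ _ _ _ _ (Fun_plus _ _ _ _ _ _ IHp IHq)). intros s _. simpl. ring.
  - refine (Fun_ext _ _ _ _ _ _ _ IH). intros s Hs. simpl. now rewrite E.
Qed.

Lemma dC_log_pow_PS g g' T f j s : log_path g g' T -> 0 < s < 1 -> tame f ->
  dC (fun t => Cpow (T t) (S j) * PS f (g t))%C s
    (RtoC (INR (S j)) * (Cpow (T s) j * PS f (g s)) * (g' s / g s)
     + Cpow (T s) (S j) * (g' s * PS (PS_deriv f) (g s)))%C.
Proof.
  intros Hg Hs Hf. destruct (Hg s Hs) as (H1 & H2 & Hlt & H0).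
  refine (dC_value _ _ _ _ _ (dC_mult _ _ _ _ _ (dC_pow _ _ _ j H2) (dC_PS f g s _ Hf H1 Hlt))).
  cbv beta. ring.
Qed.

(* Integration by parts against [dT = g'/g], by induction on the exponent of [T]. *)
Lemma Fun_int_parts N g g' T j : (1 <= N)%nat -> log_path g g' T ->
  forall k e, coeffs N (S k) e -> exists p, Fun N g T (S (j + k)) p /\
    forall s, 0 < s < 1 -> dC p s (Cpow (T s) j * (g' s * PS (PS_deriv e) (g s)))%C.
Proof.
  intros HN Hg. induction j as [|j IH]; intros k e He; pose proof (coeffs_tame N _ e HN He) as Ht.
  - exists (fun s => Cpow (T s) 0 * PS e (g s))%C. split; [exact (Fun_PS N g T (S k) 0 e He)|].
    intros s Hs. destruct (Hg s Hs) as (H1 & _ & Hlt & _).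
    apply (dC_ext (fun t => PS e (g t))); [intros; simpl; ring|].
    apply (dC_value _ _ (g' s * PS (PS_deriv e) (g s))%C); [simpl; ring|]. now apply dC_PS.
  (* Dropping the constant of [e] leaves [PS_deriv e] unchanged and makes [PS e1 x / x] a power
     series, so the remaining integral has exponent [j]. *)
  - destruct (coeffs_split N (S k) e HN He) as (e1 & He1 & He10 & Hd & _).
    pose proof (coeffs_tame N _ e1 HN He1) as He1t.
    destruct (IH (S k) (int_zero e1) (coeffs_int_zero N _ _ He1)) as (p & Hp & Hdp).
    assert (Hc : in_CMZV 0 N (- RtoC (INR (S j)))%C) by (apply in_CMZV_opp, in_CMZV_INR).
    exists (fun s => Cpow (T s) (S j) * PS e1 (g s) + - RtoC (INR (S j)) * p s)%C. split.
    + apply Fun_plus.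
      * rewrite plus_n_Sm. now apply Fun_PS.
      * rewrite plus_Sn_m. rewrite plus_n_Sm. exact (Fun_scal N g g' T 0 _ _ _ HN Hg Hc Hp).
    + intros s Hs. destruct (Hg s Hs) as (H1 & H2 & Hlt & H0).
      refine (dC_value _ _ _ _ _ (dC_plus _ _ _ _ _ (dC_log_pow_PS g g' T e1 j s Hg Hs He1t)
               (dC_scal _ _ _ _ (Hdp s Hs)))).
      rewrite Hd, <- (PS_int_zero e1 (g s) He1t He10 Hlt).
      field. exact H0.
Qed.

Definition letter (N : nat) (w : C) : Prop := w = RtoC 0 \/ cpow w N = RtoC 1.

Lemma in_CMZV_inv_INR N n : in_CMZV 0 N (/ RtoC (INR (S n)))%C.
Proof.
  replace (/ RtoC (INR (S n)))%C with (RtoC (Q2R (1 # Pos.of_nat (S n))) * 1)%C.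
  - apply in_CMZV_scal, in_CMZV_1.
  - assert (E : IZR (Zpos (Pos.of_nat (S n))) = INR (S n))
      by (rewrite <- positive_nat_Z, <- INR_IZR_INZ, Nat2Pos.id; [reflexivity|lia]).
    change (Q2R (1 # Pos.of_nat (S n))) with (1 * / IZR (Zpos (Pos.of_nat (S n)))).
    rewrite E, Rmult_1_l, RtoC_inv by (apply not_0_INR; lia). ring.
Qed.

Lemma Fun_int N g g' T k p w : (1 <= N)%nat -> log_path g g' T -> letter N w -> Fun N g T k p ->
  exists q, Fun N g T (S k) q /\
    forall s, 0 < s < 1 -> g s <> w -> dC q s (p s * (g' s / (g s - w)))%C.
Proof.
  intros HN Hg Hw. induction 1 as [k j f Hf|k p q _ (P & HP & IHp) _ (Q & HQ & IHq)|k p q E _ (P & HP & IH)].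
  - pose proof (coeffs_tame N k f HN Hf) as Ht. destruct Hw as [->|Hw].
    + pose proof (coeffs_at_0 N _ f Hf) as Hf0z. pose proof (coeffs_const N k _ Hf0z) as Hf0.
      destruct (coeffs_split N k f HN Hf) as (f1 & Hf1 & Hf10 & _ & Hsplit).
      pose proof (coeffs_tame N _ f1 HN Hf1) as Hf1t.
      destruct (Fun_int_parts N g g' T j HN Hg k (int_zero f1) (coeffs_int_zero N _ _ Hf1)) as (q & Hq & Hdq).
      set (f0 := fun n => match n with O => f O | S _ => RtoC 0 end) in *.
      (* The constant term contributes [f O * T^j dT], whence [T^(j+1) / (j+1)]; the rest is
         integrated by parts. *)
      exists (fun s => q s + / RtoC (INR (S j)) * (Cpow (T s) (S j) * PS f0 (g s)))%C. split.
      * apply Fun_plus; [exact Hq|].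
        exact (Fun_scal N g g' T 0 _ _ _ HN Hg (in_CMZV_inv_INR N j) (Fun_PS N g T k (S j) f0 Hf0)).
      * intros s Hs _. destruct (Hg s Hs) as (H1 & H2 & Hlt & H0).
        assert (HP : dC (fun t => / RtoC (INR (S j)) * (Cpow (T t) (S j) * PS f0 (g t)))%C s
                       (Cpow (T s) j * f O * (g' s / g s))%C).
        { apply (dC_ext (fun t => (/ RtoC (INR (S j)) * f O) * Cpow (T t) (S j))%C).
          { intros t. unfold f0. rewrite PS_const. ring. }
          refine (dC_value _ _ _ _ _ (dC_scal _ _ _ _ (dC_pow _ _ _ j H2))).
          field. split; [exact H0|apply INR_S_neq_0]. }
        refine (dC_value _ _ _ _ _ (dC_plus _ _ _ _ _ (Hdq s Hs) HP)).
        rewrite Hsplit, <- (PS_int_zero f1 (g s) Hf1t Hf10 Hlt) by exact Hlt.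
        replace (g s - 0)%C with (g s) by ring. field. exact H0.
    + destruct (Fun_int_parts N g g' T j HN Hg k (int_root w f) (coeffs_int_root N k f w HN Hw Hf)) as (q & Hq & Hdq).
      exists q. split; [exact Hq|]. intros s Hs Hgw. destruct (Hg s Hs) as (H1 & H2 & Hlt & H0).
      refine (dC_value _ _ _ _ _ (Hdq s Hs)).
      rewrite <- (PS_int_root f w (g s) Ht (coeffs_tame N _ _ HN (coeffs_int_root N k f w HN Hw Hf))
                    (root_neq_0 N w HN Hw) Hlt).
      field. now apply Cminus_eq_contra.
  - exists (fun s => P s + Q s)%C. split; [now apply Fun_plus|]. intros s Hs Hgw.
    refine (dC_value _ _ _ _ _ (dC_plus _ _ _ _ _ (IHp s Hs Hgw) (IHq s Hs Hgw))). cbv beta. ring.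
  - exists P. split; [exact HP|]. intros s Hs Hgw. rewrite <- E by exact Hs. now apply IH.
Qed.

Definition form (l : list (C * C)) (x : C) : C :=
  fold_right (fun p acc => (fst p / (x - snd p) + acc)%C) (RtoC 0) l.

Lemma Fun_int_form N g g' T k p l : (1 <= N)%nat -> log_path g g' T ->
  Forall (fun cw => in_CMZV 0 N (fst cw) /\ letter N (snd cw)) l -> Fun N g T k p ->
  exists q, Fun N g T (S k) q /\
    forall s, 0 < s < 1 -> dC q s (p s * (g' s * form l (g s)))%C.
Proof.
  intros HN Hg Hl Hp. induction l as [|[c w] l IH].
  - exists (fun s => Cpow (T s) 0 * PS (fun n => match n with O => RtoC 0 | S _ => RtoC 0 end) (g s))%C. split.
    + exact (Fun_PS N g T (S k) 0 _ (coeffs_const N (S k) (RtoC 0) (in_CMZV_0 _ _))).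
    + intros s Hs. apply (dC_ext (fun _ => RtoC 0)); [intros t; rewrite PS_const; ring|].
      apply (dC_value _ _ (RtoC 0)); [simpl; ring|apply dC_const].
  - destruct (IH (Forall_inv_tail Hl)) as (q & Hq & Hdq). pose proof (Forall_inv Hl) as [Hc Hw]. simpl in Hc, Hw.
    destruct (Fun_int N g g' T k p w HN Hg Hw Hp) as (q1 & Hq1 & Hdq1).
    exists (fun s => c * q1 s + q s)%C. split.
    + apply Fun_plus; [exact (Fun_scal N g g' T 0 _ _ _ HN Hg Hc Hq1)|exact Hq].
    + intros s Hs. destruct (Hg s Hs) as (H1 & H2 & Hlt & H0).
      assert (Hgw : g s <> w).
      { destruct Hw as [->|Hw]; [exact H0|]. intros E. rewrite E, (root_Cmod N w HN Hw) in Hlt. lra. }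
      refine (dC_value _ _ _ _ _ (dC_plus _ _ _ _ _ (dC_scal _ _ _ _ (Hdq1 s Hs Hgw)) (Hdq s Hs))).
      simpl. unfold Cdiv. ring.
Qed.

(** * Regularised values at an endpoint *)

Definition lim0 (p : R -> C) (L : C) : Prop :=
  forall eps, 0 < eps -> exists d, 0 < d /\ forall s, 0 < s < d -> s < 1 -> Cmod (p s - L) < eps.

Lemma lim0_ext p q L : (forall s, 0 < s < 1 -> p s = q s) -> lim0 p L -> lim0 q L.
Proof.
  intros E H eps He. destruct (H eps He) as (d & Hd & Hs). exists d. split; [exact Hd|].
  intros s H1 H2. rewrite <- E by lra. now apply Hs.
Qed.

Lemma lim0_const c : lim0 (fun _ => c) c.
Proof.
  intros eps He. exists 1. split; [lra|]. intros s _ _.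
  replace (c - c)%C with (RtoC 0) by ring. now rewrite Cmod_0.
Qed.

Lemma lim0_plus p q L M : lim0 p L -> lim0 q M -> lim0 (fun s => p s + q s)%C (L + M)%C.
Proof.
  intros Hp Hq eps He. destruct (Hp (eps / 2)) as (d & Hd & H1); [lra|].
  destruct (Hq (eps / 2)) as (d' & Hd' & H2); [lra|]. exists (Rmin d d').
  split; [now apply Rmin_glb_lt|]. intros s Hs Hs1.
  pose proof (Rmin_l d d'). pose proof (Rmin_r d d').
  specialize (H1 s ltac:(lra) Hs1). specialize (H2 s ltac:(lra) Hs1).
  replace (p s + q s - (L + M))%C with ((p s - L) + (q s - M))%C by ring.
  eapply Rle_lt_trans; [apply Cmod_triangle|]. lra.
Qed.

Lemma lim0_scal c p L : lim0 p L -> lim0 (fun s => c * p s)%C (c * L)%C.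
Proof.
  intros Hp eps He. pose proof (Cmod_ge_0 c) as Hc.
  destruct (Hp (eps / (Cmod c + 1))) as (d & Hd & H1); [apply Rdiv_lt_0_compat; lra|].
  exists d. split; [exact Hd|]. intros s Hs Hs1. specialize (H1 s Hs Hs1).
  replace (c * p s - c * L)%C with (c * (p s - L))%C by ring. rewrite Cmod_mult.
  pose proof (Cmod_ge_0 (p s - L)) as H0.
  apply Rmult_lt_compat_r with (r := Cmod c + 1) in H1; [|lra].
  unfold Rdiv in H1. rewrite Rmult_assoc, Rinv_l, Rmult_1_r in H1 by lra. nra.
Qed.

Lemma lim0_unique p L M : lim0 p L -> lim0 p M -> L = M.
Proof.
  intros HL HM. destruct (Ceq_dec L M) as [E|E]; [exact E|exfalso].
  assert (Hp : 0 < Cmod (L - M)) by (apply Cmod_gt_0; now apply Cminus_eq_contra).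
  destruct (HL (Cmod (L - M) / 2)) as (d & Hd & H1); [lra|].
  destruct (HM (Cmod (L - M) / 2)) as (d' & Hd' & H2); [lra|].
  set (s := Rmin (1 / 2) (Rmin (d / 2) (d' / 2))).
  assert (Hs : 0 < s) by (unfold s; repeat apply Rmin_glb_lt; lra).
  assert (s <= 1 / 2) by apply Rmin_l.
  assert (s <= d / 2) by (eapply Rle_trans; [apply Rmin_r|apply Rmin_l]).
  assert (s <= d' / 2) by (eapply Rle_trans; [apply Rmin_r|apply Rmin_r]).
  specialize (H1 s ltac:(lra) ltac:(lra)). specialize (H2 s ltac:(lra) ltac:(lra)).
  assert (Hle : Cmod (L - M) <= Cmod (p s - M) + Cmod (p s - L)).
  { replace (L - M)%C with ((p s - M) + - (p s - L))%C by ring.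
    rewrite <- (Cmod_opp (p s - L)). apply Cmod_triangle. }
  lra.
Qed.

(** Taylor coefficients of [(- log (1 - x))^j / j!], the model of divergence at [x = 1]. *)
Fixpoint ones_coef (j : nat) : nat -> C :=
  match j with
  | O => fun n => match n with O => RtoC 1 | S _ => RtoC 0 end
  | S j' => fun n => (RtoC (-1) * int_root (RtoC 1) (ones_coef j') n)%C
  end.

Lemma csum_ones_coef j n : (1 <= n)%nat -> csum (ones_coef j) n = LiT (ones j) n.
Proof.
  revert n. induction j as [|j IH]; intros n Hn.
  - destruct n as [|n]; [lia|]. simpl ones_coef. rewrite csum_first, csum_0. simpl. ring.
  - rewrite ones_S, LiT_csum by lia. apply csum_ext. intros [|m] _.
    + simpl. unfold int_root. simpl (INR 0). rewrite Cmult_1_r, !Cdiv_0_r. ring.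
    + simpl ones_coef. unfold int_root. rewrite <- IH by lia.
      rewrite (csum_ext (fun m => ones_coef j m * Cpow 1 m)%C (ones_coef j))
        by (intros; rewrite Cpow_1_l; ring).
      replace (/ RtoC 1)%C with (RtoC 1) by field. rewrite !Cpow_1_l, Cpow_1_r. ring.
Qed.

Lemma coeffs_ones_coef j : coeffs 1 j (ones_coef j).
Proof.
  induction j as [|j IH]; [apply coeffs_const, in_CMZV_1|].
  refine (coeffs_scal 1 0 (S j) _ _ (le_n 1) _ (coeffs_int_root 1 j _ _ (le_n 1) _ IH)).
  - apply in_CMZV_m1.
  - simpl. ring.
Qed.

Lemma tame_ones_coef j : tame (ones_coef j).
Proof. exact (coeffs_tame 1 j _ (le_n 1) (coeffs_ones_coef j)). Qed.

Definition chord_in_disc (kap : C) : Prop :=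
  kap <> RtoC 0 /\ forall s, 0 < s < 1 -> Cmod (1 - RtoC s * kap) < 1.

Definition ones_val (kap : C) (j : nat) (s : R) : C := PS (ones_coef j) (1 - RtoC s * kap)%C.

Lemma ones_val_0 kap s : ones_val kap 0 s = RtoC 1.
Proof. apply PS_const. Qed.

Lemma dC_id s : dC (fun t => RtoC t) s (RtoC 1).
Proof. apply dC_real. apply (is_derive_id (K := R_AbsRing)). Qed.

Lemma dC_affine (a b : C) s : dC (fun t => a + RtoC t * b)%C s b.
Proof.
  refine (dC_value _ _ _ _ _ (dC_plus _ _ _ _ _ (dC_const a s) (dC_mult _ _ _ _ _ (dC_id s) (dC_const b s)))).
  simpl. ring.
Qed.

Lemma dC_ones_val kap j s : chord_in_disc kap -> 0 < s < 1 ->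
  dC (ones_val kap (S j)) s (- ones_val kap j s / RtoC s)%C.
Proof.
  intros [Hk Hd] Hs.
  assert (Hg : dC (fun t => 1 - RtoC t * kap)%C s (- kap)%C).
  { apply (dC_ext (fun t => 1 + RtoC t * (- kap))%C); [intros; ring|]. apply dC_affine. }
  assert (Hs0 : RtoC s <> RtoC 0) by (intros E; apply RtoC_inj in E; lra).
  refine (dC_value _ _ _ _ _ (dC_PS (ones_coef (S j)) _ s _ (tame_ones_coef (S j)) Hg (Hd s Hs))).
  assert (Hi : tame (int_root (RtoC 1) (ones_coef j))).
  { apply (coeffs_tame 1 (S j)); [lia|]. apply coeffs_int_root; [lia|simpl; ring|apply coeffs_ones_coef]. }
  unfold ones_val. rewrite <- (PS_int_root (ones_coef j) (RtoC 1) _ (tame_ones_coef j) Hi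
    ltac:(exact C1_nz) (Hd s Hs)).
  rewrite (PS_ext (PS_deriv (ones_coef (S j))) (fun n => RtoC (-1) * PS_deriv (int_root (RtoC 1) (ones_coef j)) n)%C)
    by (intros n; unfold PS_deriv; simpl ones_coef; ring).
  rewrite PS_scal by (try apply Hd; try assumption; now apply tame_deriv).
  field. exact Hs0.
Qed.

Definition log_poly (a : nat -> C) (d : nat) (s : R) : C :=
  csum (fun i => a i * Cpow (RtoC (- ln s)) i)%C d.

Lemma dC_log_pow i s : 0 < s ->
  dC (fun t => Cpow (RtoC (- ln t)) (S i)) s (RtoC (INR (S i)) * Cpow (RtoC (- ln s)) i * RtoC (- / s))%C.
Proof.
  intros Hs. apply (dC_pow (fun t => RtoC (- ln t))). apply (dC_real (fun t => - ln t)).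
  exact (is_derive_opp ln s (/ s) (is_derive_ln s Hs)).
Qed.

(** Only the relation [d/ds ones_val (S j) = - ones_val j / s] is integrated; the integration
    constants absorb [log kap], so that no branch of it is chosen. Each integration divides the
    leading coefficient by [j + 1], hence it stays non-zero. *)
Lemma ones_val_log_poly kap j : chord_in_disc kap ->
  exists a, a j <> RtoC 0 /\ forall s, 0 < s < 1 -> ones_val kap j s = log_poly a (S j) s.
Proof.
  intros Hk. induction j as [|j (a & Ha & E)].
  - exists (fun _ => RtoC 1). split; [exact C1_nz|]. intros s _. rewrite ones_val_0.
    unfold log_poly. simpl. ring.
  - set (b := fun i => (a i / RtoC (INR (S i)))%C).
    set (Q := fun s => csum (fun i => b i * Cpow (RtoC (- ln s)) (S i))%C (S j)).
    assert (HQ : forall n s, 0 < s -> dC (fun s => csum (fun i => b i * Cpow (RtoC (- ln s)) (S i))%C n) s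
                   (- log_poly a n s / RtoC s)%C).
    { intros n s Hs. assert (Hs0 : RtoC s <> RtoC 0) by (intros E0; apply RtoC_inj in E0; lra).
      induction n as [|n IHn].
      - change (log_poly a 0 s) with (RtoC 0). change (dC (fun _ => RtoC 0) s (- 0 / RtoC s)%C).
        apply (dC_value _ _ (RtoC 0)); [unfold Cdiv; ring|apply dC_const].
      - refine (dC_value _ _ _ _ _ (dC_plus _ _ _ _ _ IHn (dC_scal (b n) _ _ _ (dC_log_pow n s Hs)))).
        unfold log_poly. rewrite csum_S. unfold b.
        replace (RtoC (- / s)) with (- / RtoC s)%C by (rewrite RtoC_opp, RtoC_inv; [reflexivity|lra]).
        field. split; [exact Hs0|apply INR_S_neq_0]. }
    assert (Hz : forall s, 0 < s < 1 -> dC (fun t => ones_val kap (S j) t - Q t)%C s (RtoC 0)).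
    { intros s Hs. refine (dC_value _ _ _ _ _ (dC_minus _ _ _ _ _ (dC_ones_val kap j s Hk Hs) (HQ (S j) s ltac:(lra)))).
      rewrite E by exact Hs. ring. }
    pose proof (dC_zero_const _ 0 1 Hz) as Hc.
    set (c := (ones_val kap (S j) (1 / 2) - Q (1 / 2)%R)%C).
    exists (fun i => match i with O => c | S i' => b i' end). split.
    + unfold b. intros E0. apply Ha. replace (a j) with (a j / RtoC (INR (S j)) * RtoC (INR (S j)))%C
        by (field; apply INR_S_neq_0). rewrite E0. ring.
    + intros s Hs. unfold log_poly. rewrite csum_first.
      assert (Ec : (ones_val kap (S j) s - Q s)%C = c) by (apply Hc; lra).
      change (csum (fun n => (b n * Cpow (RtoC (- ln s)) (S n))%C) (S j)) with (Q s).
      rewrite <- Ec. simpl (Cpow _ 0). ring.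
Qed.

Lemma log_poly_bound a d : exists B, 0 <= B /\ forall s, 0 < s -> 1 <= - ln s ->
  Cmod (log_poly a (S d) s) <= B * (- ln s) ^ d.
Proof.
  induction d as [|d (B & HB & H)].
  - exists (Cmod (a O)). split; [apply Cmod_ge_0|]. intros s _ _. unfold log_poly. simpl.
    replace (0 + a O * 1)%C with (a O) by ring. lra.
  - exists (B + Cmod (a (S d))). pose proof (Cmod_ge_0 (a (S d))) as H0. split; [lra|].
    intros s Hs Hl. specialize (H s Hs Hl). unfold log_poly in *. rewrite csum_S.
    eapply Rle_trans; [apply Cmod_triangle|]. rewrite Cmod_mult, Cmod_pow, Cmod_R, Rabs_pos_eq by lra.
    assert ((- ln s) ^ d <= (- ln s) ^ S d).
    { simpl. pose proof (pow_le (- ln s) d ltac:(lra)). nra. }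
    nra.
Qed.

Lemma log_poly_top a d c L : lim0 (fun s => log_poly a (S d) s + c * Cpow (RtoC (- ln s)) (S d))%C L ->
  c = RtoC 0.
Proof.
  intros HL. destruct (Ceq_dec c (RtoC 0)) as [E|E]; [exact E|exfalso].
  apply Cmod_gt_0 in E. destruct (log_poly_bound a d) as (B & HB & Hb).
  destruct (HL 1 ltac:(lra)) as (dl & Hdl & H).
  pose proof (Cmod_ge_0 L) as HL0.
  (* Once [- ln s >= M], the leading term exceeds [(B + |L| + 1) (- ln s)^d], too large for the
     whole sum to lie within 1 of [L]. *)
  set (M := (B + Cmod L + 1) / Cmod c + 1).
  assert (HM : 1 < M) by (unfold M; assert (0 < (B + Cmod L + 1) / Cmod c) by (apply Rdiv_lt_0_compat; lra); lra).
  set (s := Rmin (exp (- M)) (dl / 2)).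
  assert (Hs : 0 < s) by (apply Rmin_glb_lt; [apply exp_pos|lra]).
  assert (Hs1 : s <= exp (- M)) by apply Rmin_l. assert (Hs2 : s <= dl / 2) by apply Rmin_r.
  assert (Hl : M <= - ln s).
  { assert (ln s <= - M); [|lra]. rewrite <- (ln_exp (- M)).
    destruct Hs1 as [Hlt|Heq]; [left; now apply ln_increasing|rewrite Heq; lra]. }
  assert (Hs3 : s < 1).
  { eapply Rle_lt_trans; [exact Hs1|]. rewrite <- exp_0. apply exp_increasing. lra. }
  specialize (H s ltac:(lra) Hs3). specialize (Hb s Hs ltac:(lra)).
  set (l := - ln s) in *.
  assert (Hc : Cmod (c * Cpow (RtoC l) (S d)) <= B * l ^ d + Cmod L + 1).
  { replace (c * Cpow (RtoC l) (S d))%C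
      with ((log_poly a (S d) s + c * Cpow (RtoC l) (S d) - L) + (L + - log_poly a (S d) s))%C by ring.
    eapply Rle_trans; [apply Cmod_triangle|].
    pose proof (Cmod_triangle L (- log_poly a (S d) s)) as Ht. rewrite Cmod_opp in Ht. lra. }
  rewrite Cmod_mult, Cmod_pow, Cmod_R, Rabs_pos_eq in Hc by lra. simpl in Hc.
  assert (Hld : 1 <= l ^ d) by (apply pow_R1_Rle; lra).
  assert (Hcl : B + Cmod L + 1 < Cmod c * l).
  { apply Rlt_le_trans with (Cmod c * M); [|apply Rmult_le_compat_l; lra].
    unfold M. rewrite Rmult_plus_distr_l. replace (Cmod c * ((B + Cmod L + 1) / Cmod c)) with (B + Cmod L + 1)
      by (field; lra). lra. }
  assert ((B + Cmod L + 1) * l ^ d < Cmod c * l * l ^ d) by (apply Rmult_lt_compat_r; lra).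
  assert (0 <= Cmod L * (l ^ d - 1)) by (apply Rmult_le_pos; lra). nra.
Qed.

Lemma log_poly_plus a b d s : log_poly (fun i => a i + b i)%C d s = (log_poly a d s + log_poly b d s)%C.
Proof. unfold log_poly. rewrite <- csum_plus. apply csum_ext; intros; ring. Qed.

Lemma log_poly_scal c a d s : log_poly (fun i => c * a i)%C d s = (c * log_poly a d s)%C.
Proof. unfold log_poly. rewrite <- csum_scal. apply csum_ext; intros; ring. Qed.

Definition ones_comb (kap : C) (P : nat -> C) (d : nat) (s : R) : C :=
  csum (fun j => P j * ones_val kap j s)%C d.

Lemma ones_comb_log_poly kap P d : chord_in_disc kap ->
  exists b, forall s, 0 < s < 1 -> ones_comb kap P d s = log_poly b d s.
Proof.
  intros Hk. induction d as [|d (b & Eb)]; [exists (fun _ => RtoC 0); reflexivity|].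
  destruct (ones_val_log_poly kap d Hk) as (a & _ & Ea).
  exists (fun i => (if (i <? d)%nat then b i else RtoC 0) + P d * a i)%C. intros s Hs.
  unfold ones_comb in *. rewrite csum_S, Eb, Ea by exact Hs.
  rewrite log_poly_plus, log_poly_scal. f_equal.
  unfold log_poly. rewrite csum_S, Nat.ltb_irrefl.
  rewrite (csum_ext (fun i => (if (i <? d)%nat then b i else RtoC 0) * Cpow (RtoC (- ln s)) i)%C
                    (fun i => b i * Cpow (RtoC (- ln s)) i)%C); [ring|].
  intros i Hi. apply Nat.ltb_lt in Hi. now rewrite Hi.
Qed.

(** Descent on the degree: the existence of a limit kills the coefficient of the top power of
    [- ln s], and with it the last [P]. *)
Lemma ones_comb_lim kap P d L : chord_in_disc kap -> lim0 (ones_comb kap P (S d)) L -> L = P O.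
Proof.
  intros Hk. induction d as [|d IH]; intros HL.
  - apply (lim0_unique _ _ _ HL). refine (lim0_ext _ _ _ _ (lim0_const (P O))).
    intros s _. unfold ones_comb. simpl. rewrite ones_val_0. ring.
  - destruct (ones_comb_log_poly kap P (S d) Hk) as (b & Eb).
    destruct (ones_val_log_poly kap (S d) Hk) as (a & Ha & Ea).
    assert (HP : (P (S d) * a (S d))%C = RtoC 0).
    { apply (log_poly_top (fun i => b i + P (S d) * a i)%C d _ L). refine (lim0_ext _ _ _ _ HL).
      intros s Hs. unfold ones_comb in *. rewrite csum_S, Eb, Ea, log_poly_plus, log_poly_scal by exact Hs.
      unfold log_poly at 2. rewrite csum_S. fold (log_poly a (S d) s). ring. }
    assert (HP0 : P (S d) = RtoC 0).
    { destruct (Ceq_dec (P (S d)) (RtoC 0)) as [E|E]; [exact E|exfalso].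
      now apply (Cmult_neq_0 _ _ E Ha). }
    apply IH. refine (lim0_ext _ _ _ _ HL). intros s _. unfold ones_comb. rewrite (csum_S _ (S d)), HP0. ring.
Qed.

Lemma PS_csum (h : nat -> nat -> C) (P : nat -> C) d y : (forall j, tame (h j)) -> Cmod y < 1 ->
  tame (fun n => csum (fun j => P j * h j n)%C d) /\
  PS (fun n => csum (fun j => P j * h j n)%C d) y = csum (fun j => P j * PS (h j) y)%C d.
Proof.
  intros Hh Hy. induction d as [|d [Ht E]].
  - split; [apply (tame_bounded _ 0); intros n; simpl; rewrite Cmod_0; lra|].
    etransitivity; [|apply (PS_const (RtoC 0) y)]. apply PS_ext. intros [|n]; reflexivity.
  - split.
    + apply (tame_plus _ _ Ht). now apply tame_scal.
    + rewrite csum_S, <- E, <- PS_scal, <- PS_plus by (try assumption; try apply tame_scal; auto).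
      reflexivity.
Qed.

(* Non-tangential approach to [1], as in Abel's theorem. *)
Definition stolz (kap : C) : Prop :=
  exists K d, 0 < d /\ forall s, 0 < s < d -> s < 1 ->
    Cmod (RtoC s * kap) <= K * (1 - Cmod (1 - RtoC s * kap)).

Lemma lim0_stolz kap (F : R -> R) : chord_in_disc kap -> stolz kap ->
  (forall K eps, 0 < eps -> exists d, 0 < d /\ forall y, Cmod y < 1 ->
     Cmod (1 - y) <= K * (1 - Cmod y) -> Cmod (1 - y) < d -> forall s, y = (1 - RtoC s * kap)%C -> F s <= eps) ->
  forall eps, 0 < eps -> exists d, 0 < d /\ forall s, 0 < s < d -> s < 1 -> F s <= eps.
Proof.
  intros [Hk Hd] (K & d1 & Hd1 & HK) HF eps He. destruct (HF K eps He) as (d2 & Hd2 & H).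
  apply Cmod_gt_0 in Hk. exists (Rmin d1 (d2 / Cmod kap)).
  split; [apply Rmin_glb_lt; [exact Hd1|now apply Rdiv_lt_0_compat]|].
  intros s Hs Hs1. pose proof (Rmin_l d1 (d2 / Cmod kap)). pose proof (Rmin_r d1 (d2 / Cmod kap)).
  apply (H (1 - RtoC s * kap)%C); [apply Hd; lra| | |reflexivity];
  replace (1 - (1 - RtoC s * kap))%C with (RtoC s * kap)%C by ring; [apply HK; lra|].
  rewrite Cmod_mult, Cmod_R, Rabs_pos_eq by lra.
  apply Rmult_lt_reg_r with (/ Cmod kap); [now apply Rinv_0_lt_compat|].
  replace (s * Cmod kap * / Cmod kap) with s by (field; lra). unfold Rdiv in *. lra.
Qed.

(** The path leaves the root [x] at [s = 0] in the direction [- x kap]. The value [T 0] of the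
    continued logarithm must have weight one because its powers enter the coefficients of the
    expansion; differentiability controls how fast [T] approaches it. *)
Definition end_data (N : nat) (g T : R -> C) (x kap : C) : Prop :=
  cpow x N = RtoC 1 /\ in_CMZV 1 N (T 0) /\ chord_in_disc kap /\ stolz kap /\
  (forall s, 0 < s < 1 -> g s = (x * (1 - RtoC s * kap))%C) /\ exists l, dC T 0 l.

(** After rotation of [x] to 1, the series and the combination of the [ones_coef] have the same
    partial sums up to o(1), so Abel's theorem applies to their difference. *)
Lemma PS_end N k f x kap : (1 <= N)%nat -> cpow x N = RtoC 1 -> chord_in_disc kap -> stolz kap ->
  coeffs N k f -> exists P, (forall j, (j <= k)%nat -> in_CMZV (k - j) N (P j)) /\
    lim0 (fun s => PS f (x * (1 - RtoC s * kap)) - ones_comb kap P (S k) s)%C (RtoC 0).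
Proof.
  intros HN Hx Hk Hst Hf. destruct (coeffs_regular N k f x HN Hx Hf) as (P & HP & HL).
  exists P. split; [exact HP|]. set (f1 := fun n => (f n * Cpow x n)%C) in *.
  assert (Hf1 : tame f1).
  { destruct (Clim_0_bounded f (coeffs_null N k f HN Hf)) as (B & _ & HB). apply (tame_bounded _ B).
    intros n. unfold f1. rewrite Cmod_mult, Cmod_pow, (root_Cmod N x HN Hx), pow1, Rmult_1_r. apply HB. }
  set (c := fun n => csum (fun j => P j * ones_coef j n)%C (S k)).
  destruct (PS_csum ones_coef P (S k) (RtoC 0) tame_ones_coef ltac:(rewrite Cmod_0; lra)) as [Hct _].
  fold c in Hct.
  set (e := fun n => (f1 n + RtoC (-1) * c n)%C).
  assert (He : tame e) by (apply tame_plus; [exact Hf1|now apply tame_scal]).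
  assert (HeL : Clim (csum e) (RtoC 0)).
  { refine (Clim_ext_from 1%nat _ _ _ _ HL). intros n Hn. unfold e.
    rewrite csum_plus, csum_scal. unfold ones_poly.
    assert (E : forall d, csum (fun n => csum (fun j => P j * ones_coef j n)%C d) n
                = csum (fun j => P j * LiT (ones j) n)%C d).
    { induction d as [|d IHd]; [apply csum_0|]. rewrite csum_S, <- IHd, <- csum_ones_coef, <- csum_scal, <- csum_plus by exact Hn.
      reflexivity. }
    unfold c. rewrite E. ring. }
  intros eps Heps.
  destruct (lim0_stolz kap (fun s => Cmod (PS e (1 - RtoC s * kap))) Hk Hst) with (eps := eps / 2) as (d & Hd & H).
  - intros K ep Hep. destruct (abel_stolz e K He HeL ep Hep) as (d & Hd & H). exists d. split; [exact Hd|].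
    intros y H1 H2 H3 s ->. now apply H.
  - lra.
  - exists d. split; [exact Hd|]. intros s Hs Hs1. specialize (H s Hs Hs1).
    assert (Hy : Cmod (1 - RtoC s * kap) < 1) by (apply Hk; lra).
    destruct (PS_csum ones_coef P (S k) _ tame_ones_coef Hy) as [_ Ec]. fold c in Ec.
    unfold e in H. rewrite PS_plus, PS_scal, Ec in H by (try assumption; now apply tame_scal).
    rewrite PS_rescale. fold f1.
    match goal with |- Cmod ?z < _ => replace z with
      (PS f1 (1 - RtoC s * kap) + RtoC (-1) * csum (fun j => P j * PS (ones_coef j) (1 - RtoC s * kap))%C (S k))%C end.
    + lra.
    + unfold ones_comb, ones_val. ring.
Qed.

Lemma pow_lipschitz (T : R -> C) l j : dC T 0 l -> exists K d, 0 < d /\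
  forall s, 0 < s < d -> Cmod (Cpow (T s) j - Cpow (T 0) j) <= K * s.
Proof.
  intros H. assert (Hj : exists m, dC (fun s => Cpow (T s) j) 0 m).
  { destruct j as [|j]; [exists (RtoC 0); exact (dC_const (RtoC 1) 0)|eexists; exact (dC_pow _ _ _ j H)]. }
  destruct Hj as [m Hm]. destruct (dC_bound _ _ _ Hm) as (K & d & Hd & Hb). exists K, d.
  split; [exact Hd|]. intros s Hs. assert (Es : Rabs s = s) by (apply Rabs_pos_eq; lra).
  specialize (Hb s ltac:(lra)). now rewrite Rplus_0_l, Es in Hb.
Qed.

Lemma Fun_end_expansion N g T x kap k p : (1 <= N)%nat -> end_data N g T x kap -> Fun N g T k p ->
  exists P, (forall j, (j <= k)%nat -> in_CMZV (k - j) N (P j)) /\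
    lim0 (fun s => p s - ones_comb kap P (S k) s)%C (RtoC 0).
Proof.
  intros HN (Hx & HTe & Hk & Hst & Hg & (l & HT)). set (Te := T 0) in *.
  induction 1 as [k j f Hf|k p q _ (P & HP & IHp) _ (Q & HQ & IHq)|k p q E _ (P & HP & IH)].
  - destruct (PS_end N k f x kap HN Hx Hk Hst Hf) as (P & HP & HL).
    exists (fun i => if (i <=? k)%nat then (Cpow Te j * P i)%C else RtoC 0). split.
    { intros i Hi. destruct (Nat.leb_spec i k) as [Hik|Hik]; [|apply in_CMZV_0].
      replace (j + k - i)%nat with (j + (k - i))%nat by lia. apply in_CMZV_mult; [exact HN| |auto].
      pose proof (in_CMZV_pow 1 N Te j HN HTe) as H. now rewrite Nat.mul_1_r in H. }
    assert (Hcomb : forall s, ones_comb kap (fun i => if (i <=? k)%nat then (Cpow Te j * P i)%C else RtoC 0) (S (j + k)) s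
                      = (Cpow Te j * ones_comb kap P (S k) s)%C).
    { intros s. unfold ones_comb. replace (S (j + k)) with (S k + j)%nat by lia. rewrite csum_extend.
      - rewrite <- csum_scal. apply csum_ext. intros i Hi. destruct (Nat.leb_spec i k) as [_|Hik]; [ring|lia].
      - intros i Hi. destruct (Nat.leb_spec i k) as [Hik|_]; [lia|ring]. }
    pose proof (coeffs_null N k f HN Hf) as Hnull. set (f1 := fun n => (f n * Cpow x n)%C).
    assert (Hf1 : Clim f1 (RtoC 0)).
    { intros eps He. destruct (Hnull eps He) as [n0 Hn0]. exists n0. intros n Hn. specialize (Hn0 n Hn).
      replace (f1 n - 0)%C with ((f n - 0) * Cpow x n)%C by (unfold f1; ring).
      rewrite Cmod_mult, Cmod_pow, (root_Cmod N x HN Hx), pow1, Rmult_1_r. exact Hn0. }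
    destruct (pow_lipschitz T l j HT) as (K' & d' & Hd' & HK'). fold Te in HK'.
    (* The series may diverge logarithmically while [T^j] tends to [Te^j]. The Lipschitz bound
       reduces the product to [s |PS f1|], which [stolz_null] sends to 0. *)
    assert (HTP : lim0 (fun s => (Cpow (T s) j - Cpow Te j) * PS f1 (1 - RtoC s * kap))%C (RtoC 0)).
    { intros eps He.
      assert (Hk0 : 0 < Cmod kap) by (apply Cmod_gt_0; apply Hk).
      pose proof (Rabs_pos K') as HaK'.
      destruct (lim0_stolz kap (fun s => Cmod (1 - (1 - RtoC s * kap)) * Cmod (PS f1 (1 - RtoC s * kap))) Hk Hst)
        with (eps := eps * Cmod kap / (2 * (Rabs K' + 1))) as (d & Hd & H).
      - intros K2 ep Hep. destruct (stolz_null f1 K2 Hf1 ep Hep) as (d & Hd & H). exists d. split; [exact Hd|].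
        intros y H1 H2 H3 s ->. now apply H.
      - apply Rdiv_lt_0_compat; nra.
      - exists (Rmin d d'). split; [now apply Rmin_glb_lt|]. intros s Hs Hs1.
        pose proof (Rmin_l d d'). pose proof (Rmin_r d d').
        specialize (H s ltac:(lra) Hs1). specialize (HK' s ltac:(lra)).
        match goal with |- Cmod ?z < _ => replace z with ((Cpow (T s) j - Cpow Te j) * PS f1 (1 - RtoC s * kap))%C by ring end.
        rewrite Cmod_mult. replace (1 - (1 - RtoC s * kap))%C with (RtoC s * kap)%C in H by ring.
        rewrite Cmod_mult, Cmod_R, Rabs_pos_eq in H by lra.
        set (V := Cmod (PS f1 (1 - RtoC s * kap))) in *. assert (HV : 0 <= V) by apply Cmod_ge_0.
        pose proof (Rle_abs K') as HKa.
        assert (P1 : Cmod (Cpow (T s) j - Cpow Te j) * V <= (Rabs K' + 1) * (s * V)).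
        { apply Rle_trans with (K' * s * V); [apply Rmult_le_compat_r; assumption|].
          assert (0 <= s * V) by (apply Rmult_le_pos; lra). nra. }
        assert (P2 : (Rabs K' + 1) * (s * V) <= eps / 2).
        { apply Rmult_le_reg_r with (Cmod kap / (Rabs K' + 1)); [apply Rdiv_lt_0_compat; lra|].
          replace ((Rabs K' + 1) * (s * V) * (Cmod kap / (Rabs K' + 1))) with (s * Cmod kap * V) by (field; lra).
          replace (eps / 2 * (Cmod kap / (Rabs K' + 1))) with (eps * Cmod kap / (2 * (Rabs K' + 1))) by (field; lra).
          exact H. }
        lra. }
    pose proof (lim0_plus _ _ _ _ HTP (lim0_scal (Cpow Te j) _ _ HL)) as HS.
    replace (0 + Cpow Te j * 0)%C with (RtoC 0) in HS by ring.
    refine (lim0_ext _ _ _ _ HS). intros s Hs. cbv beta. rewrite Hcomb, Hg, PS_rescale by exact Hs. fold f1. ring.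
  - exists (fun i => P i + Q i)%C. split; [intros i Hi; apply in_CMZV_plus; auto|].
    pose proof (lim0_plus _ _ _ _ IHp IHq) as HS. replace (0 + 0)%C with (RtoC 0) in HS by ring.
    refine (lim0_ext _ _ _ _ HS). intros s _. unfold ones_comb.
    rewrite (csum_ext (fun j => (P j + Q j) * ones_val kap j s)%C
               (fun j => P j * ones_val kap j s + Q j * ones_val kap j s)%C) by (intros; ring).
    rewrite csum_plus. ring.
  - exists P. split; [exact HP|]. refine (lim0_ext _ _ _ _ IH). intros s Hs. cbv beta. now rewrite E.
Qed.

Lemma Fun_end N g T x kap k p L : (1 <= N)%nat -> end_data N g T x kap -> Fun N g T k p ->
  lim0 p L -> in_CMZV k N L.
Proof.
  intros HN Hd Hp HL. destruct (Fun_end_expansion N g T x kap k p HN Hd Hp) as (P & HP & H).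
  destruct Hd as (_ & _ & Hk & _).
  assert (HC : lim0 (ones_comb kap P (S k)) L).
  { pose proof (lim0_plus _ _ _ _ HL (lim0_scal (RtoC (-1)) _ _ H)) as HS.
    replace (L + RtoC (-1) * 0)%C with L in HS by ring.
    refine (lim0_ext _ _ _ _ HS). intros s _. cbv beta. ring. }
  rewrite (ones_comb_lim kap P k L Hk HC). specialize (HP O ltac:(lia)). now rewrite Nat.sub_0_r in HP.
Qed.

(** * The inverse binomial series as iterated integrals *)

(** The sum of [arcsin_coef n * x^(2n+1)] is [arcsin x / sqrt (1 - x^2)]; in closed form the
    coefficient is [4^n / ((2n+1) binom(2n,n))]. *)
Fixpoint arcsin_coef (n : nat) : R :=
  match n with
  | O => 1
  | S m => arcsin_coef m * (INR (2 * m + 2) / INR (2 * m + 3))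
  end.

Definition Phi_coef (j n : nat) : C :=
  RtoC ((-1) ^ n * arcsin_coef n / INR (2 * n + 1) ^ j).

(** This is [u S_{j+1}(-4 u^2)]; for [j = 0] it equals [arsinh u / sqrt (1 + u^2)]. *)
Definition Phi (j : nat) (u : C) : C := (u * PS (Phi_coef j) (u * u))%C.

Lemma arcsin_coef_pos n : 0 < arcsin_coef n.
Proof.
  induction n as [|n IH]; simpl arcsin_coef; [lra|].
  apply Rmult_lt_0_compat; [exact IH|]. apply Rdiv_lt_0_compat; apply lt_0_INR; lia.
Qed.

Lemma INR_double_plus n k : INR (2 * n + k) = 2 * INR n + INR k.
Proof. rewrite plus_INR, mult_INR. reflexivity. Qed.

Lemma arcsin_coef_step n : arcsin_coef n - arcsin_coef (S n) = arcsin_coef n / INR (2 * n + 3).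
Proof.
  change (arcsin_coef (S n)) with (arcsin_coef n * (INR (2 * n + 2) / INR (2 * n + 3))).
  rewrite !INR_double_plus. pose proof (pos_INR n). simpl (INR 2). simpl (INR 3). field. lra.
Qed.

Lemma arcsin_coef_le_1 n : arcsin_coef n <= 1.
Proof.
  induction n as [|n IH]; [simpl; lra|]. pose proof (arcsin_coef_step n) as H.
  assert (0 < arcsin_coef n / INR (2 * n + 3)).
  { apply Rdiv_lt_0_compat; [apply arcsin_coef_pos|apply lt_0_INR; lia]. }
  lra.
Qed.

Lemma Phi_coef_Cmod j n : Cmod (Phi_coef j n) = arcsin_coef n / INR (2 * n + 1) ^ j.
Proof.
  unfold Phi_coef. rewrite Cmod_R. unfold Rdiv. rewrite !Rabs_mult, pow_1_abs.
  pose proof (arcsin_coef_pos n).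
  assert (0 < INR (2 * n + 1) ^ j) by (apply pow_lt, lt_0_INR; lia).
  rewrite !Rabs_pos_eq; [ring| |lra]. left. now apply Rinv_0_lt_compat.
Qed.

Lemma Phi_coef_le j n : Cmod (Phi_coef j n) <= arcsin_coef n.
Proof.
  rewrite Phi_coef_Cmod. pose proof (arcsin_coef_pos n).
  assert (1 <= INR (2 * n + 1) ^ j) by (apply pow_R1_Rle, INR_ge_1; lia).
  apply Rmult_le_reg_r with (INR (2 * n + 1) ^ j); [lra|].
  unfold Rdiv. rewrite Rmult_assoc, Rinv_l by lra. nra.
Qed.

Lemma tame_Phi_coef j : tame (Phi_coef j).
Proof.
  apply (tame_bounded _ 1). intros n. eapply Rle_trans; [apply Phi_coef_le|apply arcsin_coef_le_1].
Qed.

Lemma Phi_coef_S j n : (RtoC (INR (2 * n + 1)) * Phi_coef (S j) n)%C = Phi_coef j n.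
Proof.
  unfold Phi_coef. rewrite <- RtoC_mult. f_equal.
  assert (H : INR (2 * n + 1) <> 0) by (apply not_0_INR; lia).
  revert H. generalize (INR (2 * n + 1)). intros x H.
  pose proof (pow_nonzero x j H). rewrite <- tech_pow_Rmult. field. now split.
Qed.

(* The bound telescopes: [arcsin_coef n / (2n+3) = arcsin_coef n - arcsin_coef (n+1)]. *)
Lemma Phi_coef_summable j : ex_series (fun n => Cmod (Phi_coef (S j) n)).
Proof.
  (* The constant 3 comes from [2n + 3 <= 3 (2n + 1)]. *)
  apply (ex_series_le (fun n => Cmod (Phi_coef (S j) n)) (fun n => 3 * (arcsin_coef n - arcsin_coef (S n)))).
  - intros n. change (norm (Cmod (Phi_coef (S j) n))) with (Rabs (Cmod (Phi_coef (S j) n))).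
    rewrite Rabs_pos_eq by apply Cmod_ge_0. rewrite Phi_coef_Cmod, arcsin_coef_step.
    pose proof (arcsin_coef_pos n) as Ha. pose proof (pos_INR n) as Hn.
    assert (E1 : INR (2 * n + 1) = 2 * INR n + 1) by (rewrite INR_double_plus; reflexivity).
    assert (E3 : INR (2 * n + 3) = 2 * INR n + 3) by (rewrite INR_double_plus; simpl; ring).
    assert (Hp : 1 <= INR (2 * n + 1) ^ j) by (apply pow_R1_Rle, INR_ge_1; lia).
    rewrite <- tech_pow_Rmult. rewrite E1, E3 in *. set (P := (2 * INR n + 1) ^ j) in *. set (a := arcsin_coef n) in *.
    apply Rmult_le_reg_r with ((2 * INR n + 1) * P * (2 * INR n + 3)); [nra|].
    replace (a / ((2 * INR n + 1) * P) * ((2 * INR n + 1) * P * (2 * INR n + 3))) with (a * (2 * INR n + 3)) by (field; lra).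
    replace (3 * (a / (2 * INR n + 3)) * ((2 * INR n + 1) * P * (2 * INR n + 3)))
      with (a * (3 * (2 * INR n + 1) * P)) by (field; lra).
    apply Rmult_le_compat_l; [lra|]. nra.
  - apply (ex_series_scal_l 3 (fun n => arcsin_coef n - arcsin_coef (S n))).
    assert (Hsum : forall n, sum_f_R0 (fun n => arcsin_coef n - arcsin_coef (S n)) n = 1 - arcsin_coef (S n)).
    { induction n as [|n IH]; [simpl; ring|]. rewrite tech5, IH. simpl arcsin_coef. ring. }
    destruct (growing_cv (sum_f_R0 (fun n => arcsin_coef n - arcsin_coef (S n)))) as [l Hl].
    + intros n. rewrite !Hsum. pose proof (arcsin_coef_step (S n)) as H.
      assert (0 < arcsin_coef (S n) / INR (2 * S n + 3)).
      { apply Rdiv_lt_0_compat; [apply arcsin_coef_pos|apply lt_0_INR; lia]. }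
      lra.
    + exists 1. intros x [n ->]. rewrite Hsum. pose proof (arcsin_coef_pos (S n)). lra.
    + exists l. apply is_series_Reals. exact Hl.
Qed.

Lemma PS_INR_mult f x : tame f -> Cmod x < 1 ->
  PS (fun n => RtoC (INR n) * f n)%C x = (x * PS (PS_deriv f) x)%C.
Proof.
  intros Hf Hx. rewrite PS_shift by (try exact Hx; now apply tame_INR).
  simpl (INR 0). rewrite Cmult_0_l, Cplus_0_l. reflexivity.
Qed.

Lemma tame_odd_mult f : tame f -> tame (fun n => RtoC (INR (2 * n + 1)) * f n)%C.
Proof.
  intros Hf r Hr.
  destruct (tame_plus _ _ (tame_scal (RtoC 2) _ (tame_INR f Hf)) Hf r Hr) as [K HK]. exists K. intros n.
  replace (RtoC (INR (2 * n + 1)) * f n)%C with (RtoC 2 * (RtoC (INR n) * f n) + f n)%C; [apply HK|].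
  rewrite INR_double_plus, RtoC_plus, RtoC_mult. simpl (INR 1). ring.
Qed.

Lemma PS_odd_mult f x : tame f -> Cmod x < 1 ->
  PS (fun n => RtoC (INR (2 * n + 1)) * f n)%C x = (PS f x + 2 * (x * PS (PS_deriv f) x))%C.
Proof.
  intros Hf Hx.
  rewrite <- PS_INR_mult, <- PS_scal, <- PS_plus
    by (try exact Hx; try exact Hf; try apply tame_scal; now apply tame_INR).
  apply PS_ext. intros n. rewrite INR_double_plus, RtoC_plus, RtoC_mult. simpl (INR 1). ring.
Qed.

Lemma Cmod_sqr_lt_1 u : Cmod u < 1 -> Cmod (u * u) < 1.
Proof. intros H. rewrite Cmod_mult. pose proof (Cmod_ge_0 u). nra. Qed.

Lemma dC_u_PS f u s u' : tame f -> dC u s u' -> Cmod (u s) < 1 ->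
  dC (fun t => u t * PS f (u t * u t))%C s
     (u' * PS (fun n => RtoC (INR (2 * n + 1)) * f n)%C (u s * u s))%C.
Proof.
  intros Hf Hu Hlt. pose proof (Cmod_sqr_lt_1 _ Hlt) as Hlt2.
  refine (dC_value _ _ _ _ _ (dC_mult _ _ _ _ _ Hu
            (dC_PS f (fun t => u t * u t)%C s _ Hf (dC_mult _ _ _ _ _ Hu Hu) Hlt2))).
  rewrite PS_odd_mult by assumption. ring.
Qed.

Lemma dC_Phi j u s u' : dC u s u' -> Cmod (u s) < 1 -> u s <> RtoC 0 ->
  dC (fun t => Phi (S j) (u t)) s (Phi j (u s) * (u' / u s))%C.
Proof.
  intros Hu Hlt H0. refine (dC_value _ _ _ _ _ (dC_u_PS (Phi_coef (S j)) u s u' (tame_Phi_coef _) Hu Hlt)).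
  rewrite (PS_ext _ (Phi_coef j)) by (intros n; apply Phi_coef_S). unfold Phi. field. exact H0.
Qed.

(** With [x = u^2] the second series is the derivative of [Phi 0], and the identity is the equation
    [(1 + u^2) y' + u y = 1] of [arsinh u / sqrt (1 + u^2)]. It makes the derivative of
    [cosh * Phi 0 (sinh)] equal to [q' / q] without identifying the series with a logarithm. *)
Lemma Phi_0_equation x : Cmod x < 1 ->
  (x * PS (Phi_coef 0) x
   + (1 + x) * PS (fun n => RtoC (INR (2 * n + 1)) * Phi_coef 0 n) x)%C = RtoC 1.
Proof.
  intros Hx. set (w := fun n => (RtoC (INR (2 * n + 1)) * Phi_coef 0 n)%C).
  assert (Hp : tame (Phi_coef 0)) by apply tame_Phi_coef.
  assert (Hw : tame w) by (now apply tame_odd_mult).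
  assert (E : PS w x = (1 + x * (-(1) * (PS w x + PS (Phi_coef 0) x)))%C).
  { rewrite PS_shift at 1 by assumption. f_equal.
    - unfold w, Phi_coef. simpl. rewrite <- RtoC_mult. f_equal. field.
    - f_equal. rewrite <- PS_plus, <- PS_scal by (try assumption; now apply tame_plus).
      apply PS_ext. intros n. unfold w, Phi_coef. rewrite <- !RtoC_mult, <- RtoC_plus.
      replace (-(1))%C with (RtoC (-1)) by ring. rewrite <- RtoC_mult. f_equal.
      change (arcsin_coef (S n)) with (arcsin_coef n * (INR (2 * n + 2) / INR (2 * n + 3))).
      replace (2 * S n + 1)%nat with (2 * n + 3)%nat by lia.
      assert (E3 : INR (2 * n + 3) <> 0) by (apply not_0_INR; lia).
      replace (INR (2 * n + 2)) with (INR (2 * n + 1) + 1)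
        by (rewrite !INR_double_plus; simpl; ring).
      simpl pow. field. exact E3. }
  transitivity (PS w x + x * (PS w x + PS (Phi_coef 0) x))%C; [ring|]. rewrite E at 1. ring.
Qed.

Lemma lim0_mult p q L M : lim0 p L -> lim0 q M -> lim0 (fun s => p s * q s)%C (L * M)%C.
Proof.
  intros Hp Hq.
  assert (H0 : lim0 (fun s => (p s - L) * (q s - M))%C (RtoC 0)).
  { intros eps He. destruct (Hp 1 ltac:(lra)) as (d & Hd & H1). destruct (Hq eps He) as (d' & Hd' & H2).
    exists (Rmin d d'). split; [now apply Rmin_glb_lt|]. intros s Hs Hs1.
    pose proof (Rmin_l d d'). pose proof (Rmin_r d d').
    specialize (H1 s ltac:(lra) Hs1). specialize (H2 s ltac:(lra) Hs1).
    replace ((p s - L) * (q s - M) - 0)%C with ((p s - L) * (q s - M))%C by ring.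
    rewrite Cmod_mult. pose proof (Cmod_ge_0 (p s - L)). pose proof (Cmod_ge_0 (q s - M)). nra. }
  pose proof (lim0_plus _ _ _ _ (lim0_plus _ _ _ _ H0 (lim0_scal L _ _ Hq))
                (lim0_plus _ _ _ _ (lim0_scal M _ _ Hp) (lim0_const (- (L * M))%C))) as H.
  replace (0 + L * M + (M * L + - (L * M)))%C with (L * M)%C in H by ring.
  refine (lim0_ext _ _ _ _ H). intros s _. simpl. ring.
Qed.

Lemma dC_lim0 f l : dC f 0 l -> lim0 f (f 0).
Proof.
  intros H eps He. destruct (dC_bound _ _ _ H) as (K & d & Hd & Hb).
  pose proof (Rabs_pos K) as HK. exists (Rmin d (eps / (Rabs K + 1))).
  split; [apply Rmin_glb_lt; [exact Hd|apply Rdiv_lt_0_compat; lra]|].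
  intros s Hs _. pose proof (Rmin_l d (eps / (Rabs K + 1))). pose proof (Rmin_r d (eps / (Rabs K + 1))).
  assert (Es : Rabs s = s) by (apply Rabs_pos_eq; lra).
  specialize (Hb s ltac:(lra)). rewrite Rplus_0_l, Es in Hb. pose proof (Rle_abs K).
  assert (s * (Rabs K + 1) < eps).
  { replace eps with (eps / (Rabs K + 1) * (Rabs K + 1)) by (field; lra). apply Rmult_lt_compat_r; lra. }
  nra.
Qed.

Lemma summable_PS_Clim f x : ex_series (fun n => Cmod (f n)) -> Cmod x <= 1 ->
  Clim (csum (fun n => f n * Cpow x n)%C) (PS f x).
Proof.
  intros Hf Hx. apply cseries_Clim. apply (ex_series_le (fun n => Cmod (f n * Cpow x n)) (fun n => Cmod (f n))); [|exact Hf].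
  intros n. change (norm (Cmod (f n * Cpow x n))) with (Rabs (Cmod (f n * Cpow x n))).
  rewrite Rabs_pos_eq by apply Cmod_ge_0. rewrite Cmod_mult, Cmod_pow.
  assert (0 <= Cmod x ^ n <= 1) by (apply pow_unit; split; [apply Cmod_ge_0|exact Hx]).
  pose proof (Cmod_ge_0 (f n)). nra.
Qed.

Lemma summable_PS_uniform f : ex_series (fun n => Cmod (f n)) -> forall eps, 0 < eps ->
  exists M, forall x, Cmod x <= 1 -> Cmod (PS f x - csum (fun n => f n * Cpow x n)%C M) <= eps.
Proof.
  intros [l Hl] eps He.
  assert (Hl' : is_lim_seq (sum_n (fun n => Cmod (f n))) l) by exact Hl.
  apply is_lim_seq_Reals in Hl'. destruct (Hl' eps He) as [m Hm]. exists (S m). intros x Hx.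
  refine (Clim_le _ _ _ _ (S m) (summable_PS_Clim f x (ex_intro _ l Hl) Hx) _). intros n Hn.
  assert (Hle : forall k, sum_n (fun n => Cmod (f n)) k <= l).
  { intros k. apply (is_lim_seq_incr_compare (sum_n (fun n => Cmod (f n))) l); [exact Hl|].
    intros i. rewrite sum_Sn. pose proof (Cmod_ge_0 (f (S i))). unfold plus; simpl. lra. }
  specialize (Hm m (le_n m)). unfold Rdist in Hm. specialize (Hle (m + (n - S m))%nat).
  assert (Hd : forall k, Cmod (csum (fun n => f n * Cpow x n)%C (S m + k) - csum (fun n => f n * Cpow x n)%C (S m))
     <= sum_n (fun n => Cmod (f n)) (m + k) - sum_n (fun n => Cmod (f n)) m).
  { induction k as [|k IH].
    - rewrite !Nat.add_0_r. match goal with |- Cmod ?z <= _ => replace z with (RtoC 0) by ring end. rewrite Cmod_0. lra.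
    - rewrite !Nat.add_succ_r, csum_S, sum_Sn.
      change (S m + k)%nat with (S (m + k)) in *.
      match goal with |- Cmod (?a + ?b - ?c) <= _ => replace (a + b - c)%C with ((a - c) + b)%C by ring end.
      eapply Rle_trans; [apply Cmod_triangle|]. rewrite (Cmod_mult (f _)), Cmod_pow.
      assert (0 <= Cmod x ^ S (m + k) <= 1) by (apply pow_unit; split; [apply Cmod_ge_0|exact Hx]).
      pose proof (Cmod_ge_0 (f (S (m + k)))). unfold plus; simpl. simpl in *. nra. }
  replace n with (S m + (n - S m))%nat by lia. eapply Rle_trans; [apply Hd|].
  apply Rabs_def2 in Hm. lra.
Qed.

(** Continuity up to the closed disc is required because [u] may have modulus 1 at the far end of
    the path, as for [z = -4]. *)
Lemma summable_PS_continuous f p x : ex_series (fun n => Cmod (f n)) ->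
  (forall s, 0 < s < 1 -> Cmod (p s) <= 1) -> Cmod x <= 1 -> lim0 p x ->
  lim0 (fun s => PS f (p s)) (PS f x).
Proof.
  intros Hf Hp Hx Hl eps He. destruct (summable_PS_uniform f Hf (eps / 4)) as [M HM]; [lra|].
  assert (HlM : forall m, lim0 (fun s => csum (fun n => f n * Cpow (p s) n)%C m) (csum (fun n => f n * Cpow x n)%C m)).
  { assert (Hpow : forall m, lim0 (fun s => Cpow (p s) m) (Cpow x m)).
    { induction m as [|m IH]; [exact (lim0_const (RtoC 1))|exact (lim0_mult _ _ _ _ Hl IH)]. }
    induction m as [|m IH]; [exact (lim0_const (RtoC 0))|].
    exact (lim0_plus _ _ _ _ IH (lim0_scal (f m) _ _ (Hpow m))). }
  destruct (HlM M (eps / 4)) as (d & Hd & H); [lra|]. exists d. split; [exact Hd|].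
  intros s Hs Hs1. specialize (H s Hs Hs1).
  pose proof (HM _ (Hp s ltac:(lra))) as H1. pose proof (HM _ Hx) as H2.
  set (A := csum (fun n => f n * Cpow (p s) n)%C M) in *. set (B := csum (fun n => f n * Cpow x n)%C M) in *.
  replace (PS f (p s) - PS f x)%C with ((PS f (p s) - A) + ((A - B) + - (PS f x - B)))%C by ring.
  eapply Rle_lt_trans; [apply Cmod_triangle|].
  pose proof (Cmod_triangle (A - B) (- (PS f x - B))) as H3. rewrite Cmod_opp in H3. lra.
Qed.

(** A primitive in the class differs from [f] by a constant [c]. As [f] tends to 0 at the start, [c]
    is the limit of that primitive there, so [Fun_end] gives it weight [S k] and it may be
    subtracted. *)
Lemma Fun_step N g g' T k p f l x kap : (1 <= N)%nat -> log_path g g' T -> end_data N g T x kap ->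
  Forall (fun cw => in_CMZV 0 N (fst cw) /\ letter N (snd cw)) l -> Fun N g T k p ->
  (forall s, 0 < s < 1 -> dC f s (p s * (g' s * form l (g s)))%C) -> lim0 f (RtoC 0) ->
  Fun N g T (S k) f.
Proof.
  intros HN Hg He Hl Hp Hf Hf0.
  destruct (Fun_int_form N g g' T k p l HN Hg Hl Hp) as (q & Hq & Hdq).
  assert (Hz : forall s, 0 < s < 1 -> dC (fun t => q t - f t)%C s (RtoC 0)).
  { intros s Hs. refine (dC_value _ _ _ _ _ (dC_minus _ _ _ _ _ (Hdq s Hs) (Hf s Hs))). ring. }
  pose proof (dC_zero_const _ 0 1 Hz) as Hc. cbv beta in Hc.
  set (c := (q (1 / 2)%R - f (1 / 2)%R)%C).
  assert (Ec : forall s, 0 < s < 1 -> q s = (f s + c)%C).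
  { intros s Hs. unfold c. rewrite <- (Hc s (1 / 2)%R Hs ltac:(lra)). ring. }
  assert (Hcz : in_CMZV (S k) N c).
  { apply (Fun_end N g T x kap (S k) q c HN He Hq).
    pose proof (lim0_plus _ _ _ _ Hf0 (lim0_const c)) as H. replace (0 + c)%C with c in H by ring.
    refine (lim0_ext _ _ _ _ H). intros s Hs. now rewrite Ec. }
  refine (Fun_ext _ _ _ _ _ _ _ (Fun_plus _ _ _ _ _ _ Hq
            (Fun_PS N g T (S k) 0 _ (coeffs_const N (S k) _ (in_CMZV_opp _ _ _ Hcz))))).
  intros s Hs. cbv beta. rewrite PS_const, Ec by exact Hs. simpl. ring.
Qed.

(** Limits are taken at [s = 0] only; the far end is reached by running the path backwards. *)
Lemma Fun_rev N g T k p : Fun N g T k p ->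
  Fun N (fun s => g (1 - s)) (fun s => T (1 - s)) k (fun s => p (1 - s)).
Proof.
  induction 1 as [k j f Hf|k p q _ IHp _ IHq|k p q E _ IH].
  - exact (Fun_PS N (fun s => g (1 - s)) (fun s => T (1 - s)) k j f Hf).
  - exact (Fun_plus _ _ _ _ _ _ IHp IHq).
  - refine (Fun_ext _ _ _ _ _ _ _ IH). intros s Hs. apply E. lra.
Qed.

Lemma dC_rev f s l : dC f (1 - s) l -> dC (fun t => f (1 - t)) s (- l)%C.
Proof.
  rewrite !dC_eps. intros H eps He. destruct (H eps He) as (d & Hd & Hb). exists d. split; [exact Hd|].
  intros h Hh. specialize (Hb (- h) ltac:(now rewrite Rabs_Ropp)). rewrite Rabs_Ropp in Hb.
  replace (1 - (s + h))%R with (1 - s + - h)%R by ring.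
  replace (f (1 - s + - h)%R - f (1 - s)%R - RtoC h * - l)%C
    with (f (1 - s + - h)%R - f (1 - s)%R - RtoC (- h) * l)%C by (rewrite RtoC_opp; ring).
  exact Hb.
Qed.

Definition sinh_of (q : C) : C := ((q - / q) / RtoC 2)%C.
Definition cosh_of (q : C) : C := ((q + / q) / RtoC 2)%C.

Lemma dC_sinh_of q s l : dC q s l -> q s <> RtoC 0 ->
  dC (fun t => sinh_of (q t)) s (cosh_of (q s) * (l / q s))%C.
Proof.
  intros H H0. apply (dC_ext (fun t => / RtoC 2 * (q t - / q t))%C); [intros; unfold sinh_of, Cdiv; ring|].
  refine (dC_value _ _ _ _ _ (dC_scal _ _ _ _ (dC_minus _ _ _ _ _ H (dC_inv _ _ _ H H0)))).
  unfold cosh_of. field. exact H0.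
Qed.

Lemma dC_cosh_of q s l : dC q s l -> q s <> RtoC 0 ->
  dC (fun t => cosh_of (q t)) s (sinh_of (q s) * (l / q s))%C.
Proof.
  intros H H0. apply (dC_ext (fun t => / RtoC 2 * (q t + / q t))%C); [intros; unfold cosh_of, Cdiv; ring|].
  refine (dC_value _ _ _ _ _ (dC_scal _ _ _ _ (dC_plus _ _ _ _ _ H (dC_inv _ _ _ H H0)))).
  unfold sinh_of. field. exact H0.
Qed.

(** * Chords between roots of unity *)

Definition chord (b : C) (s : R) : C := (1 + RtoC s * (b - 1))%C.

Lemma Cmod_lt_1 (z : C) : fst z ^ 2 + snd z ^ 2 < 1 -> Cmod z < 1.
Proof. intros H. unfold Cmod. rewrite <- sqrt_1. apply sqrt_lt_1; nra. Qed.

Lemma segment_norm (be : C) s : fst be ^ 2 + snd be ^ 2 = 1 ->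
  fst (1 - RtoC s * (1 - be))%C ^ 2 + snd (1 - RtoC s * (1 - be))%C ^ 2
  = 1 - 2 * s * (1 - s) * (1 - fst be).
Proof.
  destruct be as [x y]; simpl. intros H.
  assert (E : y ^ 2 = 1 - x ^ 2) by (simpl; lra).
  transitivity ((1 - s * (1 - x)) ^ 2 + s ^ 2 * y ^ 2); [simpl; ring|]. rewrite E. ring.
Qed.

Lemma segment_in_disc be : fst be ^ 2 + snd be ^ 2 = 1 -> fst be < 1 -> chord_in_disc (1 - be)%C.
Proof.
  intros H Hx. split.
  - apply Cminus_eq_contra. intros E. rewrite <- E in Hx. simpl in Hx. lra.
  - intros s Hs. apply Cmod_lt_1. rewrite segment_norm by exact H.
    assert (0 < s * (1 - s) * (1 - fst be)) by (repeat apply Rmult_lt_0_compat; lra). lra.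
Qed.

(** For [s <= 1/2] the exact norm gives [s (1 - Re be) <= 1 - |y|^2 <= 2 (1 - |y|)], while
    [|s (1 - be)| <= 2 s]; together they yield the constant [4 / (1 - Re be)]. *)
Lemma segment_stolz be : fst be ^ 2 + snd be ^ 2 = 1 -> fst be < 1 -> stolz (1 - be)%C.
Proof.
  intros H Hx. exists (4 / (1 - fst be)), (1 / 2). split; [lra|]. intros s Hs _.
  pose proof (segment_norm be s H) as Hn. set (y := (1 - RtoC s * (1 - be))%C) in *.
  destruct (segment_in_disc be H Hx) as [_ Hd]. specialize (Hd s ltac:(lra)). fold y in Hd.
  assert (Hy2 : Cmod y ^ 2 = 1 - 2 * s * (1 - s) * (1 - fst be)).
  { rewrite <- Hn. unfold Cmod. rewrite pow2_sqrt; [reflexivity|nra]. }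
  assert (Hbe : Cmod be = 1) by (unfold Cmod; rewrite H; apply sqrt_1).
  assert (H2 : Cmod (1 - be) <= 2).
  { eapply Rle_trans; [apply Cmod_triangle|]. rewrite Cmod_1, Cmod_opp, Hbe. lra. }
  rewrite Cmod_mult, Cmod_R, Rabs_pos_eq by lra. pose proof (Cmod_ge_0 y) as Hy0.
  apply Rle_trans with (2 * s); [nra|].
  assert (Hk : s * (1 - fst be) <= 2 * (1 - Cmod y)).
  { assert (1 - Cmod y ^ 2 <= 2 * (1 - Cmod y)) by nra.
    assert (s * (1 - fst be) <= 2 * s * (1 - s) * (1 - fst be)); [|lra].
    assert (0 < s * (1 - fst be)) by (apply Rmult_lt_0_compat; lra). nra. }
  apply Rmult_le_reg_r with (1 - fst be); [lra|].
  replace (4 / (1 - fst be) * (1 - Cmod y) * (1 - fst be)) with (2 * (2 * (1 - Cmod y))) by (field; lra).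
  lra.
Qed.

(** The principal logarithm on the half-plane [Re z > 0]. *)
Definition Clog (z : C) : C := (/ 2 * ln (fst z ^ 2 + snd z ^ 2), atan (snd z / fst z)).

Lemma dC_Clog f s l : dC f s l -> 0 < fst (f s) -> dC (fun t => Clog (f t)) s (l / f s)%C.
Proof.
  intros [H1 H2] Hf. set (n := fst (f s) ^ 2 + snd (f s) ^ 2). assert (Hn : 0 < n) by (unfold n; nra).
  assert (E : (l / f s)%C = ((fst l * fst (f s) + snd l * snd (f s)) / n, (snd l * fst (f s) - fst l * snd (f s)) / n)).
  { unfold n in *. destruct (f s) as [x y], l as [l1 l2]. unfold Cdiv, Cmult, Cinv; simpl in *. f_equal; field; lra. }
  rewrite E. unfold Clog, n in *. split; cbn [fst snd].
  - evar_last.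
    + apply is_derive_scal. refine (is_derive_comp ln _ s _ _ (is_derive_ln _ Hn) _).
      exact (is_derive_plus (V := R_NormedModule) _ _ _ _ _ (is_derive_pow _ 2 _ _ H1) (is_derive_pow _ 2 _ _ H2)).
    + unfold plus, scal, mult; simpl. unfold mult; simpl. field. simpl in Hn. lra.
  - evar_last.
    + refine (is_derive_comp atan _ s _ _ (is_derive_atan _) _).
      exact (is_derive_div _ _ _ _ _ H2 H1 ltac:(lra)).
    + unfold scal; simpl. unfold mult, Rsqr; simpl. simpl in Hn. field. split; lra.
Qed.

(* For [b = (c, y)] on the unit circle and [tau = y / (1+c)], the chord from [1] to [b] is
   [(1 + i (2s-1) tau) / (1 - i tau)]. *)
Definition chord_log (tau s : R) : C := Cminus (Clog (1, (2 * s - 1) * tau)) (Clog (1, - tau)).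

(** [y / (1 + c)] is the tangent of half the argument of [b]. Both affine factors have real part 1,
    so [Clog] applies to them even where the chord meets the imaginary axis. *)
Lemma chord_factor c y s : 0 < 1 + c -> c ^ 2 + y ^ 2 = 1 ->
  Cmult (chord (c, y) s) (1, - (y / (1 + c))) = (1, (2 * s - 1) * (y / (1 + c))) /\
  Cmult ((c, y) - 1) (1, - (y / (1 + c))) = (0, 2 * (y / (1 + c))).
Proof.
  intros Hc Hn. assert (Ey : y * (y / (1 + c)) = 1 - c).
  { replace (y * (y / (1 + c))) with (y ^ 2 / (1 + c)) by (field; lra).
    replace (y ^ 2) with ((1 - c) * (1 + c)) by lra. field. lra. }
  assert (Et : y = (1 + c) * (y / (1 + c))) by (field; lra).
  set (tau := y / (1 + c)) in *. clearbody tau.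
  unfold chord, Cmult, Cminus, Cplus, Copp, RtoC; simpl. split; f_equal.
  - transitivity (1 + s * (c - 1) + s * (y * tau)); [ring|]. rewrite Ey. ring.
  - rewrite Et. ring.
  - transitivity (c - 1 + y * tau); [ring|]. rewrite Ey. ring.
  - rewrite Et. ring.
Qed.

Lemma chord_neq_0 c y s : 0 < 1 + c -> c ^ 2 + y ^ 2 = 1 -> chord (c, y) s <> RtoC 0.
Proof.
  intros Hc Hn E. destruct (chord_factor c y s Hc Hn) as [E1 _]. rewrite E, Cmult_0_l in E1.
  apply (f_equal fst) in E1. simpl in E1. lra.
Qed.

Lemma dC_chord_log c y s : 0 < 1 + c -> c ^ 2 + y ^ 2 = 1 ->
  dC (chord_log (y / (1 + c))) s (((c, y) - 1) / chord (c, y) s)%C.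
Proof.
  intros Hc Hn. destruct (chord_factor c y s Hc Hn) as [E1 E2]. set (tau := y / (1 + c)) in *.
  assert (Hd : dC (fun t => (1, (2 * t - 1) * tau) : C) s (0, 2 * tau)).
  { split; simpl; auto_derive; try exact I; ring. }
  refine (dC_value _ _ _ _ _ (dC_minus _ _ _ _ _ (dC_Clog _ _ _ Hd _) (dC_const (Clog (1, - tau)) s))).
  2: simpl; lra.
  cbv beta. rewrite <- E1, <- E2. field. split; [now apply chord_neq_0|].
  intros E. apply (f_equal fst) in E. simpl in E. lra.
Qed.

Lemma chord_Cmod_lt_1 c y s : y <> 0 -> c ^ 2 + y ^ 2 = 1 -> 0 < s < 1 -> Cmod (chord (c, y) s) < 1.
Proof.
  intros Hy Hn Hs. replace (chord (c, y) s) with (1 - RtoC s * (1 - (c, y)))%C by (unfold chord; ring).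
  apply (segment_in_disc (c, y)); [exact Hn| |exact Hs]. simpl. pose proof (pow2_gt_0 y Hy). nra.
Qed.

(** Seen from [b], the chord is [b (1 - s (1 - 1/b))], so both ends reduce to a segment from 1 to a
    point of the unit circle. *)
Lemma chord_end_data N c y T l l' : (1 <= N)%nat -> y <> 0 -> c ^ 2 + y ^ 2 = 1 ->
  cpow (c, y) N = RtoC 1 -> dC T 0 l -> dC T 1 l' -> in_CMZV 1 N (T 0) -> in_CMZV 1 N (T 1) ->
  end_data N (chord (c, y)) T (RtoC 1) (1 - (c, y))%C /\
  end_data N (fun s => chord (c, y) (1 - s)) (fun s => T (1 - s)) (c, y) (1 - / (c, y))%C.
Proof.
  intros HN Hy Hn Hb HT0 HT1 HZ0 HZ1. pose proof (root_neq_0 N _ HN Hb) as Hb0.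
  assert (Hc : c < 1) by (pose proof (pow2_gt_0 y Hy); nra).
  assert (Ei : (/ (c, y))%C = (c, - y)).
  { unfold Cinv; simpl. replace (c * (c * 1) + y * (y * 1)) with 1 by (simpl in Hn; lra). f_equal; field. }
  split; (split; [|split; [|split; [|split; [|split]]]]).
  - rewrite cpow_Cpow. apply Cpow_1_l.
  - exact HZ0.
  - now apply segment_in_disc.
  - now apply segment_stolz.
  - intros s _. unfold chord. ring.
  - now exists l.
  - exact Hb.
  - now rewrite Rminus_0_r.
  - rewrite Ei. apply segment_in_disc; simpl in *; lra.
  - rewrite Ei. apply segment_stolz; simpl in *; lra.
  - intros s _. unfold chord. rewrite RtoC_minus. field. exact Hb0.
  - exists (- l')%C. apply dC_rev. now rewrite Rminus_0_r.
Qed.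

(** Up to a constant, [log (1 + x)] is the weight-one primitive of [dx / (x + 1)]; subtracting its
    limits at the two ends of the chord eliminates the constant. *)
Lemma log_one_plus_in_CMZV N c y : (1 <= N)%nat -> 0 < 1 + c -> y <> 0 -> c ^ 2 + y ^ 2 = 1 ->
  cpow (c, y) N = RtoC 1 -> cpow (RtoC (-1)) N = RtoC 1 ->
  in_CMZV 1 N (Clog (1 + (c, y)) - Clog (1 + 1))%C.
Proof.
  (* Only [T^0] occurs, so [T = 0] will do. The true branch would presuppose that [log b] has weight
     one, which this lemma serves to prove. *)
  intros HN Hc1 Hy Hn Hb Hm. set (b := (c, y) : C). set (T := fun _ : R => RtoC 0).
  destruct (chord_end_data N c y T _ _ HN Hy Hn Hb (dC_const _ 0) (dC_const _ 1) (in_CMZV_0 _ _) (in_CMZV_0 _ _))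
    as [He0 He1]. fold b in He0, He1.
  set (one := fun n => match n with O => RtoC 1 | S _ => RtoC 0 end).
  pose proof (coeffs_const N 0 _ (in_CMZV_1 N)) as Hone. fold one in Hone.
  pose proof (coeffs_int_root N 0 one (RtoC (-1)) HN Hm Hone) as Hi.
  pose proof (coeffs_tame N _ _ HN Hone) as Ht1. pose proof (coeffs_tame N _ _ HN Hi) as Hti.
  set (p := fun s => (Cpow (T s) 0 * PS (int_root (RtoC (-1)) one) (chord b s))%C).
  assert (Hp : Fun N (chord b) T 1 p) by (exact (Fun_PS N (chord b) T 1 0 _ Hi)).
  set (E := fun s => Clog (1 + chord b s)%C).
  assert (HE : forall s, 0 <= s <= 1 -> dC E s ((b - 1) / (1 + chord b s))%C).
  { intros s Hs. apply dC_Clog.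
    - apply (dC_value _ _ (0 + (b - 1))%C); [ring|]. apply dC_plus; [apply dC_const|apply dC_affine].
    - unfold chord, b; simpl. nra. }
  assert (Hz : forall s, 0 < s < 1 -> dC (fun t => p t - E t)%C s (RtoC 0)).
  { intros s Hs. pose proof (chord_Cmod_lt_1 c y s Hy Hn Hs) as Hlt. fold b in Hlt.
    assert (Hp' : dC p s ((b - 1) * PS (PS_deriv (int_root (RtoC (-1)) one)) (chord b s))%C).
    { apply (dC_ext (fun t => PS (int_root (RtoC (-1)) one) (chord b t))); [intros; unfold p; simpl; ring|].
      apply dC_PS; [exact Hti|apply dC_affine|exact Hlt]. }
    refine (dC_value _ _ _ _ _ (dC_minus _ _ _ _ _ Hp' (HE s ltac:(lra)))).
    pose proof (PS_int_root one _ _ Ht1 Hti (root_neq_0 N _ HN Hm) Hlt) as EP.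
    unfold one in EP at 2. rewrite PS_const in EP.
    set (X := PS (PS_deriv (int_root (RtoC (-1)) one)) (chord b s)) in *.
    assert (Hnz : (1 + chord b s)%C <> RtoC 0).
    { intros E0. rewrite <- Cmod_opp in Hlt. replace (- chord b s)%C with (RtoC 1) in Hlt.
      - rewrite Cmod_1 in Hlt. lra.
      - transitivity ((1 + chord b s) - chord b s)%C; [ring|]. rewrite E0. ring. }
    transitivity ((b - 1) * (X - (chord b s - RtoC (-1)) * X / (1 + chord b s)))%C; [rewrite EP; field|field]; exact Hnz. }
  pose proof (dC_zero_const _ 0 1 Hz) as Hk. cbv beta in Hk.
  set (k := (p (1 / 2)%R - E (1 / 2)%R)%C).
  assert (Ep : forall s, 0 < s < 1 -> (E s + k)%C = p s).
  { intros s Hs. unfold k. rewrite <- (Hk s (1 / 2)%R Hs ltac:(lra)). ring. }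
  assert (H0 : in_CMZV 1 N (E 0 + k)%C).
  { apply (Fun_end _ _ _ _ _ _ _ _ HN He0 Hp).
    exact (lim0_ext _ _ _ Ep (lim0_plus _ _ _ _ (dC_lim0 _ _ (HE 0 ltac:(lra))) (lim0_const k))). }
  assert (H1 : in_CMZV 1 N (E 1 + k)%C).
  { apply (Fun_end _ _ _ _ _ _ _ _ HN He1 (Fun_rev _ _ _ _ _ Hp)).
    pose proof (HE 1 ltac:(lra)) as H. replace 1 with (1 - 0) in H at 1 by ring.
    pose proof (dC_lim0 _ _ (dC_rev _ _ _ H)) as H'. cbv beta in H'. rewrite Rminus_0_r in H'.
    refine (lim0_ext _ _ _ _ (lim0_plus _ _ _ _ H' (lim0_const k))). intros s Hs. apply Ep. lra. }
  replace (Clog (1 + b) - Clog (1 + 1))%C with ((E 1 + k) + - (E 0 + k))%C.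
  - apply in_CMZV_plus; [exact H1|now apply in_CMZV_opp].
  - unfold E. replace (chord b 1) with b by (unfold chord; ring).
    replace (chord b 0) with (RtoC 1) by (unfold chord; ring). ring.
Qed.

(* [log b = log (1 + b) - log (1 + 1/b)] *)
Lemma chord_log_end N c y : (1 <= N)%nat -> 0 < 1 + c -> y <> 0 -> c ^ 2 + y ^ 2 = 1 ->
  cpow (c, y) N = RtoC 1 -> cpow (RtoC (-1)) N = RtoC 1 -> in_CMZV 1 N (chord_log (y / (1 + c)) 1).
Proof.
  intros HN Hc Hy Hn Hb Hm.
  assert (Hb' : cpow (c, - y) N = RtoC 1).
  { rewrite cpow_Cpow in *. change (c, - y) with (Cconj (c, y)). rewrite <- Cpow_conj, Hb.
    unfold Cconj, RtoC; simpl. f_equal. ring. }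
  pose proof (log_one_plus_in_CMZV N c y HN Hc Hy Hn Hb Hm) as H1.
  assert (Hn' : c ^ 2 + (- y) ^ 2 = 1) by (rewrite <- Hn; ring).
  assert (Hy' : - y <> 0) by lra.
  pose proof (log_one_plus_in_CMZV N c (- y) HN Hc Hy' Hn' Hb' Hm) as H2.
  pose proof (in_CMZV_plus _ _ _ _ H1 (in_CMZV_opp _ _ _ H2)) as H.
  replace (chord_log (y / (1 + c)) 1)
    with (Cplus (Clog (1 + (c, y)) - Clog (1 + 1)) (- (Clog (Cplus 1 (c, - y)) - Clog (1 + 1)))); [exact H|].
  apply (eq_trans (y := Cminus (Clog (1 + (c, y))) (Clog (Cplus 1 (c, - y))))).
  { generalize (Clog (1 + (c, y))%C) (Clog (Cplus 1 (c, - y))) (Clog (1 + 1)%C). intros z1 z2 z3. ring. }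
  unfold chord_log. replace ((2 * 1 - 1) * (y / (1 + c))) with (y / (1 + c)) by ring.
  unfold Clog, Cminus, Cplus, Copp, RtoC; cbn [fst snd]. rewrite !Rplus_0_l.
  replace (- y / (1 + c)) with (- (y / (1 + c))) by (field; lra).
  replace ((- y) ^ 2) with (y ^ 2) by ring.
  replace ((- (y / (1 + c))) ^ 2) with ((y / (1 + c)) ^ 2) by ring.
  replace (y / (1 + c) / 1) with (y / (1 + c)) by (field; lra).
  replace (- (y / (1 + c)) / 1) with (- (y / (1 + c))) by (field; lra).
  f_equal; ring.
Qed.

(** The three lists are the pullbacks of [dlog q], [dlog q / sinh] and [coth dlog q = dlog sinh],
    integrated in weight 1, in weight 2 and from weight 3 on. The bounds on [sinh_of] keep [u] in
    the disc of convergence. *)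
Lemma chord_Phi_in_CMZV N c y q q' l1 l2 l3 : (1 <= N)%nat -> 0 < 1 + c -> y <> 0 -> c ^ 2 + y ^ 2 = 1 ->
  cpow (c, y) N = RtoC 1 -> cpow (RtoC (-1)) N = RtoC 1 ->
  (forall l, In l [l1; l2; l3] -> Forall (fun cw => in_CMZV 0 N (fst cw) /\ letter N (snd cw)) l) ->
  (forall s, 0 <= s <= 1 -> dC q s (q' s) /\ q s <> RtoC 0) ->
  q 0 = RtoC 1 ->
  (forall s, 0 < s < 1 -> Cmod (sinh_of (q s)) < 1 /\ sinh_of (q s) <> RtoC 0) ->
  Cmod (sinh_of (q 1)) <= 1 ->
  (forall s, 0 < s < 1 ->
     (q' s / q s)%C = (((c, y) - 1) * form l1 (chord (c, y) s))%C /\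
     (q' s / q s / sinh_of (q s))%C = (((c, y) - 1) * form l2 (chord (c, y) s))%C /\
     (q' s / q s * (cosh_of (q s) / sinh_of (q s)))%C = (((c, y) - 1) * form l3 (chord (c, y) s))%C) ->
  forall j, in_CMZV (S (S j)) N (Phi (S j) (sinh_of (q 1))).
Proof.
  intros HN Hc Hy Hn Hb Hm Hl Hq Hq0 Hu Hu1 Hform.
  set (b := (c, y) : C) in *. set (g := chord b) in *. set (T := chord_log (y / (1 + c))).
  assert (Hg : log_path g (fun _ => b - 1)%C T).
  { intros s Hs. split; [apply dC_affine|]. split; [now apply dC_chord_log|].
    split; [now apply chord_Cmod_lt_1|now apply chord_neq_0]. }
  assert (HT0 : T 0 = RtoC 0).
  { unfold T, chord_log. replace ((2 * 0 - 1) * (y / (1 + c))) with (- (y / (1 + c))) by ring. ring. }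
  destruct (chord_end_data N c y T _ _ HN Hy Hn Hb (dC_chord_log c y 0 Hc Hn) (dC_chord_log c y 1 Hc Hn))
    as [He0 He1]; [rewrite HT0; apply in_CMZV_0|now apply chord_log_end|]. fold b g in He0, He1.
  set (u := fun s => sinh_of (q s)) in *. set (v := fun s => cosh_of (q s)).
  assert (Hlim : forall f l, dC f 0 l -> f 0 = RtoC 0 -> lim0 f (RtoC 0)).
  { intros f l Hd E. rewrite <- E. exact (dC_lim0 f l Hd). }
  destruct (Hq 0 ltac:(lra)) as [Hq0d Hq00].
  assert (Hv0 : lim0 v (v 0)) by (exact (dC_lim0 _ _ (dC_cosh_of q 0 _ Hq0d Hq00))).
  assert (Hu00 : u 0 = RtoC 0) by (unfold u, sinh_of; rewrite Hq0; field).
  assert (HPhi0 : forall j, lim0 (fun s => Phi j (u s)) (RtoC 0)).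
  { intros j. apply (Hlim _ _ (dC_u_PS (Phi_coef j) u 0 _ (tame_Phi_coef j) (dC_sinh_of q 0 _ Hq0d Hq00)
                       ltac:(rewrite Hu00, Cmod_0; lra))).
    rewrite Hu00. ring. }
  (* This function is [log q], since [Phi 0 u = arsinh u / cosh]; the argument uses only its
     derivative [q' / q] and its vanishing at the start. *)
  assert (H1 : Fun N g T 1 (fun s => v s * Phi 0 (u s))%C).
  { apply (Fun_step N g (fun _ => b - 1)%C T 0 (fun s => Cpow (T s) 0 * PS (fun n => match n with O => RtoC 1 | S _ => RtoC 0 end) (g s))%C
             _ l1 (RtoC 1) (1 - b)%C HN Hg He0).
    - apply Hl. now left.
    - exact (Fun_PS N g T 0 0 _ (coeffs_const N 0 _ (in_CMZV_1 N))).
    - intros s Hs. destruct (Hq s ltac:(lra)) as [Hqs Hqs0]. destruct (Hu s Hs) as [Hlt Hne].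
      destruct (Hform s Hs) as (E1 & _ & _). rewrite <- E1, PS_const.
      pose proof (dC_sinh_of q s _ Hqs Hqs0) as Hdu. fold u in Hdu.
      refine (dC_value _ _ _ _ _ (dC_mult _ _ _ _ _ (dC_cosh_of q s _ Hqs Hqs0)
               (dC_u_PS (Phi_coef 0) u s _ (tame_Phi_coef 0) Hdu Hlt))).
      fold (u s) (v s).
      pose proof (Phi_0_equation (u s * u s)%C (Cmod_sqr_lt_1 _ Hlt)) as EP.
      set (A := PS (Phi_coef 0) (u s * u s)%C) in *.
      set (B := PS (fun n => RtoC (INR (2 * n + 1)) * Phi_coef 0 n)%C (u s * u s)%C) in *.
      assert (Ev : (v s * v s = 1 + u s * u s)%C).
      { unfold u, v, sinh_of, cosh_of. field. exact Hqs0. }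
      transitivity ((q' s / q s) * (u s * u s * A + v s * v s * B))%C; [ring|].
      rewrite Ev, EP. simpl. ring.
    - pose proof (lim0_mult _ _ _ _ Hv0 (HPhi0 0%nat)) as H. rewrite Cmult_0_r in H. exact H. }
  assert (Hj : forall j, Fun N g T (S (S j)) (fun s => Phi (S j) (u s))).
  { assert (Hd : forall j s, 0 < s < 1 -> dC (fun s => Phi (S j) (u s)) s
               (Phi j (u s) * (v s * (q' s / q s) / u s))%C).
    { intros j s Hs. destruct (Hq s ltac:(lra)) as [Hqs Hqs0]. destruct (Hu s Hs) as [Hlt Hne].
      apply dC_Phi; [|exact Hlt|exact Hne]. exact (dC_sinh_of q s _ Hqs Hqs0). }
    induction j as [|j IH].
    - apply (Fun_step N g (fun _ => b - 1)%C T 1 _ _ l2 (RtoC 1) (1 - b)%C HN Hg He0 (Hl l2 ltac:(right; now left)) H1); [|apply HPhi0].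
      intros s Hs. destruct (Hform s Hs) as (_ & E2 & _). rewrite <- E2.
      refine (dC_value _ _ _ _ _ (Hd 0%nat s Hs)). fold (u s). unfold Cdiv. ring.
    - apply (Fun_step N g (fun _ => b - 1)%C T _ _ _ l3 (RtoC 1) (1 - b)%C HN Hg He0 (Hl l3 ltac:(right; right; now left)) IH); [|apply HPhi0].
      intros s Hs. destruct (Hform s Hs) as (_ & _ & E3). rewrite <- E3.
      refine (dC_value _ _ _ _ _ (Hd (S j) s Hs)). fold (u s) (v s). unfold Cdiv. ring. }
  intros j.
  apply (Fun_end _ _ _ _ _ _ _ _ HN He1 (Fun_rev _ _ _ _ _ (Hj j))).
  destruct (Hq 1 ltac:(lra)) as [Hq1d Hq10].
  assert (Hu1l : lim0 (fun s => u (1 - s)) (u 1)).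
  { pose proof (dC_sinh_of q 1 _ Hq1d Hq10) as H. fold u in H. replace 1 with (1 - 0) in H at 1 by ring.
    pose proof (dC_lim0 _ _ (dC_rev _ _ _ H)) as H'. cbv beta in H'. rewrite Rminus_0_r in H'. exact H'. }
  unfold Phi. apply lim0_mult; [exact Hu1l|].
  apply (summable_PS_continuous _ (fun s => u (1 - s)%R * u (1 - s)%R)%C); [apply Phi_coef_summable| | |exact (lim0_mult _ _ _ _ Hu1l Hu1l)].
  - intros s Hs. destruct (Hu (1 - s) ltac:(lra)) as [Hlt _]. apply Rlt_le, Cmod_sqr_lt_1. exact Hlt.
  - rewrite Cmod_mult. pose proof (Cmod_ge_0 (sinh_of (q 1))). nra.
Qed.

(** * Evaluation of the inverse binomial series *)

Lemma arcsin_coef_binomial n : arcsin_coef n = 4 ^ n / (INR (2 * n + 1) * Binomial.C (2 * n) n).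
Proof.
  induction n as [|n IH].
  - unfold Binomial.C. simpl. field.
  - change (arcsin_coef (S n)) with (arcsin_coef n * (INR (2 * n + 2) / INR (2 * n + 3))). rewrite IH.
    unfold Binomial.C. replace (2 * S n)%nat with (S (S (2 * n))) by lia.
    replace (S (S (2 * n)) - S n)%nat with (S n) by lia. replace (2 * n - n)%nat with n by lia.
    replace (S (S (2 * n)) + 1)%nat with (2 * n + 3)%nat by lia.
    rewrite !fact_simpl, !mult_INR, <- tech_pow_Rmult.
    replace (S (S (2 * n))) with (2 * n + 2)%nat by lia. replace (S (2 * n)) with (2 * n + 1)%nat by lia.
    rewrite !INR_double_plus, (S_INR n). simpl (INR 1). simpl (INR 2). simpl (INR 3).
    pose proof (pos_INR n). pose proof (INR_fact_neq_0 n). pose proof (INR_fact_neq_0 (2 * n)).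
    field. repeat split; try assumption; lra.
Qed.

Lemma Binomial_C_pos n : 0 < Binomial.C (2 * n) n.
Proof.
  unfold Binomial.C. apply Rdiv_lt_0_compat; [apply INR_fact_lt_0|].
  apply Rmult_lt_0_compat; apply INR_fact_lt_0.
Qed.

Lemma S_term_Phi_coef j u n :
  S_term (S j) (RtoC (-4) * (u * u)) n = (Phi_coef j n * Cpow (u * u) n)%C.
Proof.
  unfold S_term, Phi_coef. rewrite !cpow_Cpow, (Cpow_mult_l (RtoC (-4))), arcsin_coef_binomial.
  assert (Hn : INR (2 * n + 1) <> 0) by (apply not_0_INR; lia). pose proof (Binomial_C_pos n) as Hb.
  rewrite <- !RtoC_pow, <- RtoC_mult.
  replace (Cpow (u * u) n) with (Cpow (u * u) n * 1)%C at 2 by ring.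
  assert (Hp : INR (2 * n + 1) ^ S j * Binomial.C (2 * n) n <> 0)
    by (apply Rmult_integral_contrapositive_currified; [now apply pow_nonzero|lra]).
  assert (E : (-4) ^ n / (INR (2 * n + 1) ^ S j * Binomial.C (2 * n) n)
     = (-1) ^ n * (4 ^ n / (INR (2 * n + 1) * Binomial.C (2 * n) n)) / INR (2 * n + 1) ^ j).
  { replace (-4) with (-1 * 4) by ring. rewrite Rpow_mult_distr, <- tech_pow_Rmult. field.
    repeat split; try (now apply pow_nonzero); lra. }
  rewrite <- E, RtoC_div by exact Hp. unfold Cdiv. ring.
Qed.

Lemma is_series_Clim (a : nat -> C) (L : C) : Clim (csum a) L ->
  @is_series C_AbsRing C_NormedModule a L.
Proof.
  intros H. unfold is_series.
  assert (E : forall n, @sum_n C_AbelianMonoid a n = csum a (S n)).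
  { induction n as [|n IH]; [rewrite sum_O; simpl; ring|]. rewrite sum_Sn, IH. reflexivity. }
  intros P [eps HP]. destruct (H eps (cond_pos eps)) as [n0 Hn0]. exists n0. intros n Hn.
  apply HP. specialize (Hn0 (S n) ltac:(lia)). rewrite <- E in Hn0.
  split; (eapply Rle_lt_trans; [|exact Hn0]); [apply Re_sub_le|apply Im_sub_le].
Qed.

Lemma is_S_PS j u : Cmod u <= 1 ->
  is_S (S (S j)) (RtoC (-4) * (u * u)) (PS (Phi_coef (S j)) (u * u)).
Proof.
  intros Hu. apply is_series_Clim.
  assert (Hu2 : Cmod (u * u) <= 1).
  { rewrite Cmod_mult. pose proof (Cmod_ge_0 u). nra. }
  refine (Clim_ext_from O _ _ _ _ (summable_PS_Clim _ _ (Phi_coef_summable j) Hu2)).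
  intros n _. apply csum_ext. intros m _. symmetry. apply S_term_Phi_coef.
Qed.

(** * Paths inside the disc of convergence *)

Definition normsq (z : C) : R := fst z ^ 2 + snd z ^ 2.

Lemma normsq_Cmod z : Cmod z ^ 2 = normsq z.
Proof. unfold Cmod, normsq. apply pow2_sqrt. nra. Qed.

(** By [sinh_of (x / p) = (x - p) (x + p) / (2 x p)], the bound becomes a polynomial inequality in
    real coordinates. *)
Lemma sinh_of_lt_1 (x p : C) : x <> RtoC 0 -> p <> RtoC 0 ->
  normsq (x - p) * normsq (x + p) < 4 * normsq x * normsq p -> Cmod (sinh_of (x / p)) < 1.
Proof.
  intros Hx Hp H. rewrite <- !normsq_Cmod in H.
  assert (E : (sinh_of (x / p) * (RtoC 2 * (x * p)) = (x - p) * (x + p))%C).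
  { unfold sinh_of. field. split; assumption. }
  apply (f_equal Cmod) in E. rewrite !Cmod_mult, Cmod_R, Rabs_pos_eq in E by lra.
  apply Cmod_gt_0 in Hx, Hp. pose proof (Cmod_ge_0 (sinh_of (x / p))) as Hs.
  set (S := Cmod (sinh_of (x / p))) in *. set (X := Cmod x) in *. set (P := Cmod p) in *.
  destruct (Rlt_le_dec S 1) as [Hlt|Hge]; [exact Hlt|exfalso].
  assert (E2 : (S * (2 * (X * P))) ^ 2 < (2 * (X * P)) ^ 2).
  { rewrite E. lra. }
  assert (HXP : 0 < X * P) by (now apply Rmult_lt_0_compat).
  assert (2 * (X * P) <= S * (2 * (X * P))) by nra.
  assert ((2 * (X * P)) ^ 2 <= (S * (2 * (X * P))) ^ 2) by (apply pow_incr; lra). lra.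
Qed.

Lemma sinh_of_neq_0 q : q <> RtoC 0 -> q <> RtoC 1 -> q <> RtoC (-1) -> sinh_of q <> RtoC 0.
Proof.
  intros H0 H1 Hm E.
  assert (E2 : ((q - 1) * (q - RtoC (-1)))%C = RtoC 0).
  { transitivity (sinh_of q * (RtoC 2 * q))%C; [unfold sinh_of; field; exact H0|rewrite E; ring]. }
  revert E2. apply Cmult_neq_0; now apply Cminus_eq_contra.
Qed.

Lemma dlog_split q l : q <> RtoC 0 -> q <> RtoC 1 -> q <> RtoC (-1) ->
  (l / q / sinh_of q)%C = (l / (q - 1) - l / (q - RtoC (-1)))%C /\
  (l / q * (cosh_of q / sinh_of q))%C = (l / (q - 1) + l / (q - RtoC (-1)) - l / q)%C.
Proof.
  intros H0 H1 Hm.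
  apply Cminus_eq_contra in H1. apply Cminus_eq_contra in Hm.
  assert (Es : sinh_of q = ((q - 1) * (q - RtoC (-1)) / (RtoC 2 * q))%C) by (unfold sinh_of; field; exact H0).
  assert (Ec : cosh_of q = (((q - 1) * (q - 1) + (q - RtoC (-1)) * (q - RtoC (-1))) / (RtoC 2 * (RtoC 2 * q)))%C)
    by (unfold cosh_of; field; exact H0).
  rewrite Es, Ec. split; field; repeat split; assumption.
Qed.

Lemma chord_neq_root N c y s w : (1 <= N)%nat -> y <> 0 -> c ^ 2 + y ^ 2 = 1 -> 0 < s < 1 ->
  cpow w N = RtoC 1 -> chord (c, y) s <> w.
Proof.
  intros HN Hy Hn Hs Hw E. pose proof (chord_Cmod_lt_1 c y s Hy Hn Hs) as H.
  rewrite E, (root_Cmod N w HN Hw) in H. lra.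
Qed.

Lemma root_1 N : cpow (RtoC 1) N = RtoC 1.
Proof. rewrite cpow_Cpow. apply Cpow_1_l. Qed.

(** Here [q] is the chord itself, ending at [b] with [sinh_of b = i y]. The condition [0 <= c]
    ensures [|sinh_of q| < 1] along the chord. *)
Lemma circle_Phi_in_CMZV N c y j : (1 <= N)%nat -> 0 <= c -> y <> 0 -> c ^ 2 + y ^ 2 = 1 ->
  cpow (c, y) N = RtoC 1 -> cpow (RtoC (-1)) N = RtoC 1 ->
  in_CMZV (S (S j)) N (Phi (S j) (Ci * RtoC y)).
Proof.
  intros HN Hc Hy Hn Hb Hm1. assert (Hc1 : 0 < 1 + c) by lra.
  assert (Hy2 : 0 < y ^ 2) by (now apply pow2_gt_0).
  set (g := chord (c, y)).
  assert (Es : sinh_of (g 1) = (Ci * RtoC y)%C).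
  { assert (E1 : g 1 = (c, y)) by (unfold g, chord, Cplus, Cminus, Cmult, Copp, RtoC; simpl; f_equal; ring).
    assert (Ei : (/ (c, y))%C = Cconj (c, y)).
    { unfold Cinv, Cconj; simpl. replace (c * (c * 1) + y * (y * 1)) with 1 by (simpl in Hn; lra). f_equal; field. }
    rewrite E1. unfold sinh_of. rewrite Ei.
    replace ((c, y) - Cconj (c, y))%C with (RtoC 2 * (Ci * RtoC y))%C; [field|].
    unfold Cconj, Cminus, Cplus, Copp, Cmult, Ci, RtoC; simpl. f_equal; ring. }
  rewrite <- Es.
  assert (Hne : forall s, 0 < s < 1 -> g s <> RtoC 0 /\ g s <> RtoC 1 /\ g s <> RtoC (-1)).
  { intros s Hs. split; [now apply chord_neq_0|].
    split; apply (chord_neq_root N); try assumption. apply root_1. }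
  apply (chord_Phi_in_CMZV N c y g (fun _ => (c, y) - 1)%C
           [(RtoC 1, RtoC 0)] [(RtoC 1, RtoC 1); (RtoC (-1), RtoC (-1))]
           [(RtoC 1, RtoC 1); (RtoC 1, RtoC (-1)); (RtoC (-1), RtoC 0)]); try assumption.
  - intros l [<-|[<-|[<-|[]]]]; repeat (apply Forall_cons; [simpl; split|]); try apply Forall_nil;
      try apply in_CMZV_1; try apply in_CMZV_m1; try (left; reflexivity); right; try exact Hm1; apply root_1.
  - intros s _. split; [apply dC_affine|now apply chord_neq_0].
  - unfold g, chord. ring.
  - intros s Hs. destruct (Hne s Hs) as (H0 & H1 & H2).
    split; [|now apply sinh_of_neq_0].
    replace (g s) with (g s / 1)%C by field. apply sinh_of_lt_1; [exact H0|exact C1_nz|].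
    assert (Eg : g s = (1 - s * (1 - c), s * y)).
    { unfold g, chord. unfold Cplus, Cminus, Cmult, Copp, RtoC; simpl. f_equal; ring. }
    set (e := 1 - c) in *.
    assert (He : 0 < e <= 1).
    { unfold e. split; [|lra]. nra. }
    assert (Ey : y ^ 2 = 2 * e - e ^ 2) by (unfold e; lra).
    assert (En : normsq (g s) = 1 - 2 * s * e + 2 * s ^ 2 * e).
    { rewrite Eg. unfold normsq; cbn [fst snd]. rewrite Rpow_mult_distr, Ey. ring. }
    assert (Em : normsq (g s - 1) = 2 * s ^ 2 * e).
    { rewrite Eg. unfold normsq. transitivity (s ^ 2 * e ^ 2 + s ^ 2 * y ^ 2); [simpl; ring|]. rewrite Ey. ring. }
    assert (Ep : normsq (g s + 1) = 4 - 4 * s * e + 2 * s ^ 2 * e).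
    { rewrite Eg. unfold normsq. transitivity ((2 - s * e) ^ 2 + s ^ 2 * y ^ 2); [simpl; ring|]. rewrite Ey. ring. }
    assert (E1 : normsq 1 = 1) by (unfold normsq; simpl; ring).
    rewrite En, Em, Ep, E1.
    (* A quarter of the difference of the two sides is [(1 - s)^3 (1 + s)], its value at [e = 1],
       plus the product in [H5]. *)
    assert (H4 : 0 < (1 - s) ^ 3 * (1 + s)) by (apply Rmult_lt_0_compat; [apply pow_lt|]; lra).
    assert (H5 : 0 <= (1 - e) * (s * (2 - s ^ 2 * (2 - s) * (1 + e)))).
    { apply Rmult_le_pos; [lra|]. apply Rmult_le_pos; [lra|].
      (* This product equals [1 - s^2 (2 - s)], and [1 + e <= 2]. *)
      assert (0 <= (1 - s) * (1 + s - s ^ 2)) by (apply Rmult_le_pos; [lra|nra]).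
      assert (0 <= s ^ 2 * (2 - s)) by (apply Rmult_le_pos; [apply pow2_ge_0|lra]). nra. }
    nra.
  - rewrite Es, Cmod_mult, Cmod_Ci, Cmod_R, Rmult_1_l. apply Rabs_le. nra.
  - intros s Hs. destruct (Hne s Hs) as (H0 & H1 & H2).
    fold g. destruct (dlog_split (g s) ((c, y) - 1)%C H0 H1 H2) as [E2 E3]. rewrite E2, E3.
    apply Cminus_eq_contra in H1. apply Cminus_eq_contra in H2.
    assert (H0' : (g s - 0)%C <> RtoC 0) by (replace (g s - 0)%C with (g s) by ring; exact H0).
    unfold form; simpl. split; [|split].
    + replace (g s - 0)%C with (g s) by ring. field. exact H0.
    + field. split; assumption.
    + replace (g s - 0)%C with (g s) by ring. field. repeat split; assumption.
Qed.

Lemma Cinv_neq_0 x : x <> RtoC 0 -> (/ x)%C <> RtoC 0.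
Proof.
  intros Hx E. pose proof (Cinv_r x Hx) as H. rewrite E, Cmult_0_r in H. now apply C1_nz.
Qed.

Lemma Cdiv_neq_0 x w : x <> RtoC 0 -> w <> RtoC 0 -> (x / w)%C <> RtoC 0.
Proof. intros Hx Hw. apply Cmult_neq_0; [exact Hx|now apply Cinv_neq_0]. Qed.

(* With [w = (al, be)], [q = ((1-s) + s q0 w) / ((1-s) + s w)] runs through a circular arc
   from [1] to [q0]. *)
Lemma arc_sinh_bound s al be q0 : 0 < s < 1 -> 0 <= al -> 1 < q0 -> q0 ^ 2 - 1 <= 2 * q0 ->
  let x : C := (1 - s + s * q0 * al, s * q0 * be) in
  let p : C := (1 - s + s * al, s * be) in
  normsq (x - p) * normsq (x + p) < 4 * normsq x * normsq p.
Proof.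
  intros Hs Hal Hq Hq2 x p. set (a := 1 - s). set (m := al ^ 2 + be ^ 2).
  assert (Ha : 0 < a) by (unfold a; lra).
  assert (Hm : 0 <= m) by (unfold m; pose proof (pow2_ge_0 al); pose proof (pow2_ge_0 be); lra).
  assert (Em : normsq (x - p) = s ^ 2 * (q0 - 1) ^ 2 * m)
    by (unfold normsq, x, p, m, a; simpl; ring).
  assert (Ep : normsq (x + p) = 4 * a ^ 2 + 4 * a * s * (q0 + 1) * al + s ^ 2 * (q0 + 1) ^ 2 * m)
    by (unfold normsq, x, p, m, a; simpl; ring).
  assert (Ex : normsq x = a ^ 2 + 2 * a * s * q0 * al + s ^ 2 * q0 ^ 2 * m)
    by (unfold normsq, x, p, m, a; simpl; ring).
  assert (Epp : normsq p = a ^ 2 + 2 * a * s * al + s ^ 2 * m)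
    by (unfold normsq, x, p, m, a; simpl; ring).
  rewrite Em, Ep, Ex, Epp.
  (* Expanded in powers of [a] and [s], the difference of the two sides is the sum of the
     expressions in [T0] to [T4]. The condition [q0 ^ 2 - 1 <= 2 * q0], that is [|u| <= 1] at the
     end, gives the signs in [T3] and [T4]. *)
  assert (T0 : 0 < 4 * a ^ 4) by (apply Rmult_lt_0_compat; [lra|now apply pow_lt]).
  assert (T1 : 0 <= 8 * (1 + q0) * a ^ 3 * s * al)
    by (repeat apply Rmult_le_pos; try lra; apply pow_le; lra).
  assert (T2 : 0 <= 4 * (2 * q0 * m + 4 * q0 * al ^ 2) * a ^ 2 * s ^ 2).
  { repeat apply Rmult_le_pos; try lra; try (apply pow_le; lra).
    assert (0 <= q0 * m) by (apply Rmult_le_pos; lra).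
    assert (0 <= q0 * al ^ 2) by (apply Rmult_le_pos; [lra|apply pow2_ge_0]). lra. }
  assert (T3 : 0 <= 4 * (q0 + 1) * (2 * q0 - (q0 - 1) ^ 2) * m * al * a * s ^ 3).
  { repeat apply Rmult_le_pos; try lra; apply pow_le; lra. }
  assert (T4 : 0 <= (2 * q0 - (q0 ^ 2 - 1)) * (2 * q0 + (q0 ^ 2 - 1)) * m ^ 2 * s ^ 4).
  { repeat apply Rmult_le_pos; try lra; try (apply pow_le; lra); nra. }
  apply Rminus_lt_0.
  match goal with |- 0 < ?d => replace d with
    (4 * a ^ 4 + 8 * (1 + q0) * a ^ 3 * s * al + 4 * (2 * q0 * m + 4 * q0 * al ^ 2) * a ^ 2 * s ^ 2
     + 4 * (q0 + 1) * (2 * q0 - (q0 - 1) ^ 2) * m * al * a * s ^ 3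
     + (2 * q0 - (q0 ^ 2 - 1)) * (2 * q0 + (q0 ^ 2 - 1)) * m ^ 2 * s ^ 4) by ring end.
  lra.
Qed.


(* The Moebius map [q] sending [1, z0, zm, zi] to [1, 0, -1, infinity] pulls the poles of
   [dlog q], [dlog (q - 1)] and [dlog (q + 1)] back to roots of unity. *)
Lemma mobius_Phi_in_CMZV N c y q0 (z0 zm zi : C) j : (1 <= N)%nat -> 0 < 1 + c -> y <> 0 -> c ^ 2 + y ^ 2 = 1 ->
  cpow (c, y) N = RtoC 1 -> cpow (RtoC (-1)) N = RtoC 1 ->
  cpow z0 N = RtoC 1 -> cpow zm N = RtoC 1 -> cpow zi N = RtoC 1 ->
  z0 <> RtoC 1 -> zi <> RtoC 1 -> z0 <> zi -> 1 < q0 -> q0 ^ 2 - 1 <= 2 * q0 ->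
  ((1 - zi) * (zm - z0) = - ((1 - z0) * (zm - zi)))%C ->
  ((1 - zi) * ((c, y) - z0) = RtoC q0 * ((1 - z0) * ((c, y) - zi)))%C ->
  0 <= fst (((c, y) - zi) * Cconj (1 - zi))%C ->
  in_CMZV (S (S j)) N (Phi (S j) (RtoC ((q0 - / q0) / 2))).
Proof.
  intros HN Hc1 Hy Hn Hb Hm1 Hz0 Hzm Hzi H01 Hi1 H0i Hq0 Hq02 Hm Hend Hre.
  set (b := (c, y) : C) in *. set (g := chord b).
  apply Cminus_eq_contra in H0i.
  assert (Hd0 : (1 - z0)%C <> RtoC 0) by (apply Cminus_eq_contra; congruence).
  assert (Hdi : (1 - zi)%C <> RtoC 0) by (apply Cminus_eq_contra; congruence).
  assert (Hq0c : RtoC q0 <> RtoC 0) by (intros E; apply RtoC_inj in E; lra).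
  assert (Hbi : (b - zi)%C <> RtoC 0).
  { intros E. rewrite E in Hend. assert (E0 : (b - z0)%C = RtoC 0).
    { transitivity (/ (1 - zi) * ((1 - zi) * (b - z0)))%C; [field; exact Hdi|]. rewrite Hend. ring. }
    apply H0i. transitivity ((b - zi) - (b - z0))%C; [ring|]. rewrite E, E0. ring. }
  assert (Hb0 : (b - z0)%C <> RtoC 0).
  { intros E. rewrite E in Hend. apply (Cmult_neq_0 _ _ Hq0c (Cmult_neq_0 _ _ Hd0 Hbi)). rewrite <- Hend. ring. }
  (* The map [q = k (x - z0) / (x - zi)] is normalised by [q(1) = 1]; then [Hm] says [q(zm) = -1]
     and [Hend] says [q(b) = q0]. *)
  set (k := ((1 - zi) / (1 - z0))%C).
  assert (Hk0 : k <> RtoC 0).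
  { now apply Cdiv_neq_0. }
  assert (K1 : (k * z0 - zi = k - 1)%C) by (unfold k; field; exact Hd0).
  assert (K2 : (k * z0 + zi = (k + 1) * zm)%C).
  { assert (E : ((k + 1) * zm - (k * z0 + zi) = ((1 - zi) * (zm - z0) + (1 - z0) * (zm - zi)) / (1 - z0))%C)
      by (unfold k; field; exact Hd0).
    rewrite Hm in E. symmetry. apply Ceq_minus. rewrite E. field. exact Hd0. }
  assert (Kb : (k * (b - z0) = RtoC q0 * (b - zi))%C).
  { unfold k. transitivity ((1 - zi) * (b - z0) / (1 - z0))%C; [field; exact Hd0|]. rewrite Hend. field. exact Hd0. }
  assert (Hkm : (k - 1)%C <> RtoC 0).
  { intros E. rewrite E in K1. apply H0i. replace k with (RtoC 1) in K1.
    - rewrite <- K1. ring.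
    - symmetry. now apply Ceq_minus. }
  assert (Hkp : (k + 1)%C <> RtoC 0).
  { intros E. rewrite E in K2. apply H0i.
    transitivity ((k + 1) * z0 - (k * z0 + zi))%C; [ring|]. rewrite E, K2. ring. }
  assert (Hg0 : forall s, 0 <= s <= 1 -> (g s - z0)%C <> RtoC 0 /\ (g s - zi)%C <> RtoC 0).
  { intros s Hs. destruct (Req_dec s 0) as [->|Hs0].
    { replace (g 0) with (RtoC 1) by (unfold g, chord; ring). now split. }
    destruct (Req_dec s 1) as [->|Hs1].
    { replace (g 1) with b by (unfold g, chord; ring). now split. }
    split; apply Cminus_eq_contra; apply (chord_neq_root N); try assumption; lra. }
  set (q := fun s => (k * (g s - z0) / (g s - zi))%C).
  set (q' := fun s => (k * ((b - 1) * (z0 - zi)) / ((g s - zi) * (g s - zi)))%C).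
  assert (Hqd : forall s, 0 <= s <= 1 -> dC q s (q' s) /\ q s <> RtoC 0).
  { intros s Hs. destruct (Hg0 s Hs) as [A0 Ai]. split.
    - pose proof (dC_affine 1 (b - 1)%C s) as Hdg. fold (chord b) in Hdg.
      assert (D0 : dC (fun t => g t - z0)%C s (b - 1)%C)
        by (apply (dC_value _ _ (b - 1 - 0)%C); [ring|apply dC_minus; [exact Hdg|apply dC_const]]).
      assert (Di : dC (fun t => g t - zi)%C s (b - 1)%C)
        by (apply (dC_value _ _ (b - 1 - 0)%C); [ring|apply dC_minus; [exact Hdg|apply dC_const]]).
      refine (dC_value _ _ _ _ _ (dC_div _ _ _ _ _ (dC_scal k _ _ _ D0) Di Ai)).
      unfold q'. field. exact Ai.
    - apply Cdiv_neq_0; [now apply Cmult_neq_0|exact Ai]. }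
  assert (Qm : forall s, 0 <= s <= 1 -> (q s - 1 = (k - 1) * (g s - 1) / (g s - zi))%C).
  { intros s Hs. destruct (Hg0 s Hs) as [_ Ai].
    transitivity (((k - 1) * g s - (k * z0 - zi)) / (g s - zi))%C; [unfold q; field; exact Ai|].
    rewrite K1. field. exact Ai. }
  assert (Qp : forall s, 0 <= s <= 1 -> (q s - RtoC (-1) = (k + 1) * (g s - zm) / (g s - zi))%C).
  { intros s Hs. destruct (Hg0 s Hs) as [_ Ai].
    transitivity (((k + 1) * g s - (k * z0 + zi)) / (g s - zi))%C; [unfold q; field; exact Ai|].
    rewrite K2. field. exact Ai. }
  assert (Hgm : forall s, 0 < s < 1 -> (g s - 1)%C <> RtoC 0 /\ (g s - zm)%C <> RtoC 0).
  { intros s Hs. split; apply Cminus_eq_contra; apply (chord_neq_root N); try assumption. apply root_1. }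
  assert (Qne : forall s, 0 < s < 1 -> q s <> RtoC 1 /\ q s <> RtoC (-1)).
  { intros s Hs. destruct (Hg0 s ltac:(lra)) as [_ Ai]. destruct (Hgm s Hs) as [Am Ap].
    split; intros E.
    - apply (Cdiv_neq_0 _ _ (Cmult_neq_0 _ _ Hkm Am) Ai). rewrite <- Qm, E by lra. ring.
    - apply (Cdiv_neq_0 _ _ (Cmult_neq_0 _ _ Hkp Ap) Ai). rewrite <- Qp, E by lra. ring. }
  assert (Q1 : q 1 = RtoC q0).
  { unfold q. replace (g 1) with b by (unfold g, chord; ring). rewrite Kb. field. exact Hbi. }
  assert (Hsq : sinh_of (q 1) = RtoC ((q0 - / q0) / 2)).
  { rewrite Q1. unfold sinh_of. rewrite <- RtoC_inv, <- RtoC_minus, <- RtoC_div by lra. reflexivity. }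
  rewrite <- Hsq.
  apply (chord_Phi_in_CMZV N c y q q'
           [(RtoC 1, z0); (RtoC (-1), zi)] [(RtoC 1, RtoC 1); (RtoC (-1), zm)]
           [(RtoC 1, RtoC 1); (RtoC 1, zm); (RtoC (-1), z0); (RtoC (-1), zi)]); try assumption.
  - intros l [<-|[<-|[<-|[]]]]; repeat (apply Forall_cons; [simpl; split|]); try apply Forall_nil;
      try apply in_CMZV_1; try apply in_CMZV_m1; right; try assumption; apply root_1.
  - unfold q. replace (g 0) with (RtoC 1) by (unfold g, chord; ring). unfold k. field. now split.
  - intros s Hs. destruct (Qne s Hs) as [N1 Nm]. destruct (Hqd s ltac:(lra)) as [_ N0].
    split; [|now apply sinh_of_neq_0].
    (* Up to the common factor [1 - zi], the denominator of [q] along the chord is [(1-s) + s w] and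
       the numerator is [(1-s) + s q0 w], as in [arc_sinh_bound]; [Hre] means [Re w >= 0]. *)
    set (w := ((b - zi) / (1 - zi))%C).
    assert (Hal : 0 <= fst w).
    { assert (E : ((b - zi) * Cconj (1 - zi) = w * RtoC (normsq (1 - zi)))%C).
      { rewrite <- normsq_Cmod, Cmod2_conj. unfold w. field. exact Hdi. }
      rewrite E in Hre. destruct w as [al be]; simpl in Hre |- *.
      assert (Hn1 : 0 < normsq (1 - zi)).
      { rewrite <- normsq_Cmod. apply pow_lt. now apply Cmod_gt_0. }
      set (n := normsq (1 - zi)) in *.
      destruct (Rle_lt_dec 0 al) as [Ha|Ha]; [exact Ha|exfalso]. nra. }
    set (X := ((1 - s) + s * q0 * fst w, s * q0 * snd w) : C).
    set (P := ((1 - s) + s * fst w, s * snd w) : C).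
    assert (EX : X = (RtoC (1 - s) + RtoC (s * q0) * w)%C).
    { unfold X. destruct w; unfold Cplus, Cmult, RtoC; simpl. f_equal; ring. }
    assert (EP : P = (RtoC (1 - s) + RtoC s * w)%C).
    { unfold P. destruct w; unfold Cplus, Cmult, RtoC; simpl. f_equal; ring. }
    assert (Epi : ((1 - zi) * P = g s - zi)%C).
    { rewrite EP. unfold w, g, chord. rewrite RtoC_minus. field. exact Hdi. }
    assert (Exi : ((1 - zi) * X = k * (g s - z0))%C).
    { rewrite EX, RtoC_minus, RtoC_mult.
      transitivity ((1 - s) * (1 - zi) + s * (RtoC q0 * (b - zi)))%C; [unfold w; field; exact Hdi|].
      rewrite <- Kb. transitivity ((1 - s) * (k * (1 - z0)) + s * (k * (b - z0)))%C; [|unfold g, chord; ring].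
      f_equal. f_equal. unfold k. field. exact Hd0. }
    destruct (Hg0 s ltac:(lra)) as [A0 Ai].
    assert (HP0 : P <> RtoC 0) by (intros E; apply Ai; rewrite <- Epi, E; ring).
    assert (HX0 : X <> RtoC 0).
    { intros E. apply (Cmult_neq_0 _ _ Hk0 A0). rewrite <- Exi, E. ring. }
    assert (Eq : q s = (X / P)%C).
    { unfold q. rewrite <- Exi, <- Epi. field. now split. }
    rewrite Eq. apply sinh_of_lt_1; [exact HX0|exact HP0|].
    now apply arc_sinh_bound.
  - rewrite Hsq, Cmod_R. assert (Hi : 0 < / q0 < 1).
    { split; [apply Rinv_0_lt_compat; lra|]. rewrite <- Rinv_1. apply Rinv_lt_contravar; lra. }
    assert (Hq1 : q0 - / q0 <= 2).
    { apply Rmult_le_reg_r with q0; [lra|]. rewrite Rmult_minus_distr_r, Rinv_l by lra. lra. }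
    apply Rabs_le. lra.
  - intros s Hs. destruct (Qne s Hs) as [N1 Nm]. destruct (Hqd s ltac:(lra)) as [_ N0].
    destruct (Hg0 s ltac:(lra)) as [A0 Ai]. destruct (Hgm s Hs) as [Am Ap].
    assert (F0 : (q' s / q s = (b - 1) / (g s - z0) - (b - 1) / (g s - zi))%C).
    { unfold q, q'. field. repeat split; assumption. }
    assert (Fm : (q' s / (q s - 1) = (b - 1) / (g s - 1) - (b - 1) / (g s - zi))%C).
    { rewrite Qm by lra. unfold q'.
      replace (k * ((b - 1) * (z0 - zi)))%C with ((b - 1) * ((k * z0 - zi) + zi - k * zi))%C by ring.
      rewrite K1. field. repeat split; assumption. }
    assert (Fp : (q' s / (q s - RtoC (-1)) = (b - 1) / (g s - zm) - (b - 1) / (g s - zi))%C).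
    { rewrite Qp by lra. unfold q'.
      replace (k * ((b - 1) * (z0 - zi)))%C with ((b - 1) * ((k * z0 + zi) - zi - k * zi))%C by ring.
      rewrite K2. field. repeat split; assumption. }
    fold b g. destruct (dlog_split (q s) (q' s) N0 N1 Nm) as [E2 E3]. rewrite E2, E3, F0, Fm, Fp.
    unfold form; simpl. split; [|split]; field; repeat split; assumption.
Qed.

(* Explicit Moebius maps for the six real arguments *)
From Stdlib Require Import Nsatz.
Local Open Scope R_scope.

Lemma half_root b n : Cpow b n = RtoC (-1) ->
  cpow b (2 * n) = RtoC 1 /\ cpow (RtoC (-1)) (2 * n) = RtoC 1.
Proof.
  intros H. rewrite !cpow_Cpow. split.
  - rewrite Nat.mul_comm, Cpow_mult_r, H. simpl. ring.
  - rewrite Cpow_mult_r. replace (Cpow (RtoC (-1)) 2) with (RtoC 1) by (simpl; ring). apply Cpow_1_l.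
Qed.

Lemma root_pow N b n : cpow b N = RtoC 1 -> cpow (Cpow b n) N = RtoC 1.
Proof.
  intros H. rewrite cpow_Cpow in *. rewrite <- Cpow_mult_r, Nat.mul_comm, Cpow_mult_r, H. apply Cpow_1_l.
Qed.

Lemma root_opp N b : cpow (RtoC (-1)) N = RtoC 1 -> cpow b N = RtoC 1 -> cpow (- b) N = RtoC 1.
Proof. intros Hm Hb. replace (- b)%C with (RtoC (-1) * b)%C by ring. now apply root_mult. Qed.

Lemma Cneq_snd (x y : C) : snd x <> snd y -> x <> y.
Proof. congruence. Qed.

(* [nsatz] sees neither through division nor past hypotheses that are not equations: the
   coordinates are variables with integral relations, and other hypotheses are cleared. *)
Ltac Rnsatz :=
  repeat match goal with
         | H : ?T |- _ => lazymatch T with @eq R _ _ => fail | _ => clear H end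
         end; nsatz.

Ltac Cring := simpl Cpow; unfold Cmult, Cminus, Cplus, Copp, RtoC; simpl; f_equal; Rnsatz.

Ltac mobius_side :=
  first [ assumption | lia | lra | now apply root_opp | apply Cneq_snd; simpl; lra
        | Cring | simpl; nra | simpl; Rnsatz ].

(** With [u = (q0 - 1/q0) / 2] one has [r = -4 u^2]; the rational [p] turns the factor [u] of [Phi]
    into the prefactor [f] wanted for the series. *)
Lemma binomial_series_value k N q0 r f p : (2 <= k)%nat -> 1 < q0 -> q0 ^ 2 - 1 <= 2 * q0 ->
  (forall j, in_CMZV (S (S j)) N (Phi (S j) (RtoC ((q0 - / q0) / 2)))) ->
  r = - (q0 - / q0) ^ 2 -> f = Q2R p * ((q0 - / q0) / 2) ->
  exists L, is_S k (RtoC r) L /\ in_CMZV k N (RtoC f * L).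
Proof.
  intros Hk Hq Hq2 HP Hr Hf. destruct k as [|[|j]]; try lia. specialize (HP j).
  set (u := (q0 - / q0) / 2) in *.
  assert (Hu : Cmod (RtoC u) <= 1).
  { rewrite Cmod_R. assert (Hi : 0 < / q0 < 1).
    { split; [apply Rinv_0_lt_compat; lra|]. rewrite <- Rinv_1. apply Rinv_lt_contravar; lra. }
    assert (q0 - / q0 <= 2).
    { apply Rmult_le_reg_r with q0; [lra|]. rewrite Rmult_minus_distr_r, Rinv_l by lra. lra. }
    apply Rabs_le. unfold u. lra. }
  exists (PS (Phi_coef (S j)) (RtoC u * RtoC u)%C). split.
  - replace (RtoC r) with (RtoC (-4) * (RtoC u * RtoC u))%C; [now apply is_S_PS|].
    rewrite <- !RtoC_mult. f_equal. rewrite Hr. unfold u. field. lra.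
  - rewrite Hf, RtoC_mult, <- Cmult_assoc. now apply in_CMZV_scal.
Qed.


(** In all six cases [1, b, z0, zm, zi] are powers of one root; here of [e^(i pi/3)] with exponents
    [0, 1, 4, 3, 2]. The cross-ratio is [sin(2pi/6) sin(3pi/6) / (sin(4pi/6) sin(pi/6)) = 2]. *)
Lemma mobius_in_CMZV_6 j : in_CMZV (S (S j)) 6 (Phi (S j) (RtoC ((2 - / 2) / 2))).
Proof.
  pose proof (sqrt_sqrt 3 ltac:(lra)) as H3. pose proof (sqrt_lt_R0 3 ltac:(lra)) as P3.
  assert (H : exists c y, 2 * c = 1 /\ 4 * (y * y) = 3 /\ 0 < y) by (exists (1 / 2), (sqrt 3 / 2); lra).
  destruct H as (c & y & Hc & Hy & Hy0).
  assert (E2 : Cpow (c, y) 2 = (- c, y)) by Cring.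
  assert (E3 : Cpow (c, y) 3 = RtoC (-1)) by (rewrite Cpow_S, E2; Cring).
  destruct (half_root (c, y) 3 E3) as (R1 & R3).
  assert (R4 : cpow (- c, y) 6 = RtoC 1) by (rewrite <- E2; now apply root_pow).
  apply (mobius_Phi_in_CMZV 6 c y 2 (- (c, y))%C (RtoC (-1)) (- c, y)); mobius_side.
Qed.

(** The points [1, b, z0, zm, zi] are the powers [0, 1, 5, 4, 3] of [e^(i pi/4)]. *)
Lemma mobius_in_CMZV_8_sqrt2 j : in_CMZV (S (S j)) 8 (Phi (S j) (RtoC ((sqrt 2 - / sqrt 2) / 2))).
Proof.
  pose proof (sqrt_sqrt 2 ltac:(lra)) as H2. pose proof (sqrt_lt_R0 2 ltac:(lra)) as P2.
  assert (H : exists c, sqrt 2 = 2 * c /\ 2 * (c * c) = 1 /\ 1 / 2 < c) by (exists (sqrt 2 / 2); nra).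
  destruct H as (c & Hq & Hc & Hc0). rewrite Hq.
  assert (E2 : Cpow (c, c) 2 = (0, 1)) by Cring.
  assert (E3 : Cpow (c, c) 3 = (- c, c)) by (rewrite Cpow_S, E2; Cring).
  assert (E4 : Cpow (c, c) 4 = RtoC (-1)) by (rewrite Cpow_S, E3; Cring).
  destruct (half_root (c, c) 4 E4) as (R1 & R3).
  assert (R4 : cpow (- c, c) 8 = RtoC 1) by (rewrite <- E3; now apply root_pow).
  apply (mobius_Phi_in_CMZV 8 c c (2 * c) (- (c, c))%C (RtoC (-1)) (- c, c)); mobius_side.
Qed.

(** Powers [0, 1, 6, 4, 2] of [e^(i pi/4)]. This is the extreme case [q0 ^ 2 - 1 = 2 * q0], where
    [u = 1]. *)
Lemma mobius_in_CMZV_8_silver j :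
  in_CMZV (S (S j)) 8 (Phi (S j) (RtoC ((1 + sqrt 2 - / (1 + sqrt 2)) / 2))).
Proof.
  pose proof (sqrt_sqrt 2 ltac:(lra)) as H2. pose proof (sqrt_lt_R0 2 ltac:(lra)) as P2.
  assert (H : exists c, sqrt 2 = 2 * c /\ 2 * (c * c) = 1 /\ 1 / 2 < c) by (exists (sqrt 2 / 2); nra).
  destruct H as (c & Hq & Hc & Hc0). rewrite Hq.
  assert (E2 : Cpow (c, c) 2 = (0, 1)) by Cring.
  assert (E4 : Cpow (c, c) 4 = RtoC (-1)) by (rewrite !Cpow_S; simpl Cpow; Cring).
  destruct (half_root (c, c) 4 E4) as (R1 & R3).
  assert (R4 : cpow (0, 1) 8 = RtoC 1) by (rewrite <- E2; now apply root_pow).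
  apply (mobius_Phi_in_CMZV 8 c c (1 + 2 * c) (Copp (0, 1)) (RtoC (-1)) (0, 1)); mobius_side.
Qed.

(* Here [c = cos (pi/5)] and [y = sin (pi/5)]. *)
Lemma tenth_root : exists c y, sqrt 5 = 4 * c - 1 /\ 4 * (c * c) = 2 * c + 1 /\ c * c + y * y = 1 /\
  3 / 4 < c < 1 /\ 0 < y /\ Cpow (c, y) 2 = (c * c - y * y, 2 * c * y) /\
  Cpow (c, y) 3 = (y * y - c * c, 2 * c * y) /\ Cpow (c, y) 4 = (- c, y) /\
  Cpow (c, y) 5 = RtoC (-1).
Proof.
  pose proof (sqrt_sqrt 5 ltac:(lra)) as H5. pose proof (sqrt_lt_R0 5 ltac:(lra)) as P5.
  set (c := (1 + sqrt 5) / 4). assert (Hq : sqrt 5 = 4 * c - 1) by (unfold c; lra).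
  rewrite Hq in H5, P5 |- *. clearbody c.
  assert (Hc : 4 * (c * c) = 2 * c + 1) by lra.
  assert (Hc1 : 3 / 4 < c < 1) by nra.
  assert (Hs : 0 < 1 - c * c) by nra.
  exists c, (sqrt (1 - c * c)). pose proof (sqrt_sqrt (1 - c * c) ltac:(lra)) as Hy.
  pose proof (sqrt_lt_R0 (1 - c * c) Hs) as Hy0. set (y := sqrt (1 - c * c)) in *. clearbody y.
  assert (E2 : Cpow (c, y) 2 = (c * c - y * y, 2 * c * y)) by Cring.
  assert (E3 : Cpow (c, y) 3 = (y * y - c * c, 2 * c * y)) by (rewrite Cpow_S, E2; Cring).
  assert (E4 : Cpow (c, y) 4 = (- c, y)) by (rewrite Cpow_S, E3; Cring).
  assert (E5 : Cpow (c, y) 5 = RtoC (-1)) by (rewrite Cpow_S, E4; Cring).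
  repeat split; try assumption; lra.
Qed.

(** Powers [0, 1, 9, 8, 4] of [e^(i pi/5)]. *)
Lemma mobius_in_CMZV_10_sqrt5 j : in_CMZV (S (S j)) 10 (Phi (S j) (RtoC ((sqrt 5 - / sqrt 5) / 2))).
Proof.
  destruct tenth_root as (c & y & Hq & Hc & Hn & Hc1 & Hy & E2 & E3 & E4 & E5). rewrite Hq.
  destruct (half_root (c, y) 5 E5) as (R1 & R3).
  assert (Hcy : 0 < c * y) by nra.
  assert (R4 : cpow (- c, y) 10 = RtoC 1) by (rewrite <- E4; now apply root_pow).
  assert (R5 : cpow (y * y - c * c, 2 * c * y) 10 = RtoC 1) by (rewrite <- E3; now apply root_pow).
  apply (mobius_Phi_in_CMZV 10 c y (4 * c - 1) (Copp (- c, y)) (Copp (y * y - c * c, 2 * c * y)) (- c, y)); mobius_side.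
Qed.

(** Powers [0, 1, 7, 5, 3] of [e^(i pi/5)]. *)
Lemma mobius_in_CMZV_10_golden j :
  in_CMZV (S (S j)) 10 (Phi (S j) (RtoC (((1 + sqrt 5) / 2 - / ((1 + sqrt 5) / 2)) / 2))).
Proof.
  destruct tenth_root as (c & y & Hq & Hc & Hn & Hc1 & Hy & E2 & E3 & E4 & E5). rewrite Hq.
  replace ((1 + (4 * c - 1)) / 2) with (2 * c) by field.
  destruct (half_root (c, y) 5 E5) as (R1 & R3).
  assert (Hcy : 0 < c * y) by nra.
  assert (R4 : cpow (c * c - y * y, 2 * c * y) 10 = RtoC 1) by (rewrite <- E2; now apply root_pow).
  assert (R5 : cpow (y * y - c * c, 2 * c * y) 10 = RtoC 1) by (rewrite <- E3; now apply root_pow).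
  apply (mobius_Phi_in_CMZV 10 c y (2 * c) (Copp (c * c - y * y, 2 * c * y)) (RtoC (-1)) (y * y - c * c, 2 * c * y)); mobius_side.
Qed.

(** Powers [0, 1, 10, 8, 4] of [e^(i pi/6)]. *)
Lemma mobius_in_CMZV_12 j : in_CMZV (S (S j)) 12 (Phi (S j) (RtoC ((sqrt 3 - / sqrt 3) / 2))).
Proof.
  pose proof (sqrt_sqrt 3 ltac:(lra)) as H3. pose proof (sqrt_lt_R0 3 ltac:(lra)) as P3.
  assert (H : exists c y, sqrt 3 = 2 * c /\ 4 * (c * c) = 3 /\ 2 * y = 1 /\ 3 / 4 < c)
    by (exists (sqrt 3 / 2), (1 / 2); repeat split; nra).
  destruct H as (c & y & Hq & Hc & Hy & Hc0). rewrite Hq.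
  assert (E2 : Cpow (c, y) 2 = (y, c)) by Cring.
  assert (E4 : Cpow (c, y) 4 = (- y, c)) by (rewrite !Cpow_S; simpl Cpow; Cring).
  assert (E6 : Cpow (c, y) 6 = RtoC (-1)) by (rewrite Cpow_S, Cpow_S, E4; Cring).
  destruct (half_root (c, y) 6 E6) as (R1 & R3).
  assert (R4 : cpow (- y, c) 12 = RtoC 1) by (rewrite <- E4; now apply root_pow).
  assert (R5 : cpow (y, c) 12 = RtoC 1) by (rewrite <- E2; now apply root_pow).
  apply (mobius_Phi_in_CMZV 12 c y (2 * c) (Copp (- y, c)) (Copp (y, c)) (- y, c)); mobius_side.
Qed.

(** * End points on the unit circle *)

Lemma cos_sin_Cpow t n : Cpow (cos t, sin t) n = (cos (INR n * t), sin (INR n * t)).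
Proof.
  induction n as [|n IH].
  - simpl. rewrite Rmult_0_l, cos_0, sin_0. reflexivity.
  - rewrite Cpow_S, IH, S_INR, Rmult_plus_distr_r, Rmult_1_l, cos_plus, sin_plus.
    unfold Cmult; simpl. f_equal; ring.
Qed.

Lemma cos_sin_2PI_mult m : cos (2 * IZR m * PI) = 1 /\ sin (2 * IZR m * PI) = 0.
Proof.
  assert (H : forall k, cos (2 * INR k * PI) = 1 /\ sin (2 * INR k * PI) = 0).
  { intros k. split.
    - rewrite <- cos_0, <- (cos_period 0 k). f_equal. ring.
    - rewrite <- sin_0, <- (sin_period 0 k). f_equal. ring. }
  destruct (Z.abs_or_opp_abs m) as [E|E]; rewrite E, <- Zabs2Nat.id_abs, ?opp_IZR, <- INR_IZR_INZ.
  - apply H.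
  - replace (2 * - INR (Z.abs_nat m) * PI) with (- (2 * INR (Z.abs_nat m) * PI)) by ring.
    rewrite cos_neg, sin_neg. destruct (H (Z.abs_nat m)) as [-> ->]. split; ring.
Qed.

Lemma circle_series_value k N m : (2 <= k)%nat -> (3 <= N)%nat ->
  let t := 2 * IZR m * PI / INR N in
  exists L : C, is_S k (RtoC (4 * sin t ^ 2)) L /\
    in_iCMZV k (Nat.lcm 2 N) (Cmult L (RtoC (sin t))).
Proof.
  intros Hk HN t. destruct k as [|[|j]]; try lia.
  set (u := (Ci * RtoC (sin t))%C).
  assert (Hcs : cos t ^ 2 + sin t ^ 2 = 1).
  { pose proof (sin2_cos2 t) as H. unfold Rsqr in H. simpl. lra. }
  assert (Hu : Cmod u <= 1).
  { unfold u. rewrite Cmod_mult, Cmod_Ci, Cmod_R, Rmult_1_l. apply Rabs_le.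
    pose proof (SIN_bound t). lra. }
  assert (Huu : (RtoC (-4) * (u * u) = RtoC (4 * sin t ^ 2))%C).
  { unfold u, Cmult, Ci, RtoC; simpl. f_equal; ring. }
  exists (PS (Phi_coef (S j)) (u * u)). split; [rewrite <- Huu; now apply is_S_PS|].
  (* With [L] the value of the series, [Phi (S j) u = i L sin t], and [i * (- i) = 1]. *)
  exists (- Phi (S j) u)%C. split.
  2:{ unfold Phi. replace (Ci * - (u * PS (Phi_coef (S j)) (u * u)))%C
        with (- (Ci * Ci) * PS (Phi_coef (S j)) (u * u) * RtoC (sin t))%C by (unfold u; ring).
      replace (Ci * Ci)%C with (RtoC (-1)) by (unfold Cmult, Ci, RtoC; simpl; f_equal; ring). ring. }
  apply in_CMZV_opp.
  (* If [sin t = 0], the end point is 1 or -1 and the chord degenerates or passes through 0; but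
     then the product itself vanishes. *)
  destruct (Req_dec (sin t) 0) as [E0|E0].
  { unfold Phi. replace u with (RtoC 0) by (unfold u; rewrite E0; ring). rewrite Cmult_0_l. apply in_CMZV_0. }
  set (M := Nat.lcm 2 N).
  destruct (Nat.divide_lcm_l 2 N) as [a Ha]. destruct (Nat.divide_lcm_r 2 N) as [d Hd]. fold M in Ha, Hd.
  assert (HM : (1 <= M)%nat).
  { destruct (Nat.eq_dec M 0) as [E|E]; [|lia]. apply Nat.lcm_eq_0 in E. lia. }
  assert (Hm1 : cpow (RtoC (-1)) M = RtoC 1).
  { rewrite cpow_Cpow, Ha, Nat.mul_comm, Cpow_mult_r.
    replace (Cpow (RtoC (-1)) 2) with (RtoC 1) by (simpl; ring). apply Cpow_1_l. }
  assert (Hb : cpow (cos t, sin t) M = RtoC 1).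
  { rewrite cpow_Cpow, Hd, Nat.mul_comm, Cpow_mult_r, cos_sin_Cpow.
    replace (INR N * t) with (2 * IZR m * PI) by (unfold t; field; apply not_0_INR; lia).
    destruct (cos_sin_2PI_mult m) as [-> ->]. apply Cpow_1_l. }
  (* If [cos t < 0], the opposite point [-b] has positive real part and is again an [M]-th root
     because [M] is even; [Phi] is odd in [u]. *)
  destruct (Rle_lt_dec 0 (cos t)) as [Hc|Hc].
  - now apply (circle_Phi_in_CMZV M (cos t)).
  - assert (E : Phi (S j) u = (- Phi (S j) (Ci * RtoC (- sin t)))%C).
    { unfold Phi. replace (Ci * RtoC (- sin t))%C with (- u)%C by (unfold u; rewrite RtoC_opp; ring).
      replace (- u * - u)%C with (u * u)%C by ring. ring. }
    rewrite E. apply in_CMZV_opp. apply (circle_Phi_in_CMZV M (- cos t)); try lra; try assumption.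
    exact (root_opp M _ Hm1 Hb).
Qed.

Theorem theorem4 :
  (forall (k N : nat) (m : Z), (2 <= k)%nat -> (3 <= N)%nat ->
     let t := 2 * IZR m * PI / INR N in
     exists L : C, is_S k (RtoC (4 * sin t ^ 2)) L /\
       in_iCMZV k (Nat.lcm 2 N) (Cmult L (RtoC (sin t))))
  /\
  (forall k : nat, (2 <= k)%nat ->
     (exists L, is_S k (RtoC (- 9 / 4)) L /\ in_CMZV k 6 L) /\
     (exists L, is_S k (RtoC (- 4)) L /\ in_CMZV k 8 L) /\
     (exists L, is_S k (RtoC (- 1 / 2)) L /\ in_CMZV k 8 (Cmult (RtoC (sqrt 2)) L)) /\
     (exists L, is_S k (RtoC (- 1)) L /\ in_CMZV k 10 L) /\
     (exists L, is_S k (RtoC (- 16 / 5)) L /\ in_CMZV k 10 (Cmult (RtoC (sqrt 5)) L)) /\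
     (exists L, is_S k (RtoC (- 4 / 3)) L /\ in_CMZV k 12 (Cmult (RtoC (sqrt 3)) L))).
Proof.
  split; [exact circle_series_value|]. intros k Hk.
  pose proof (sqrt_sqrt 2 ltac:(lra)) as H2. pose proof (sqrt_lt_R0 2 ltac:(lra)) as P2.
  pose proof (sqrt_sqrt 3 ltac:(lra)) as H3. pose proof (sqrt_lt_R0 3 ltac:(lra)) as P3.
  pose proof (sqrt_sqrt 5 ltac:(lra)) as H5. pose proof (sqrt_lt_R0 5 ltac:(lra)) as P5.
  assert (Hone : forall N r, (exists L, is_S k (RtoC r) L /\ in_CMZV k N (RtoC 1 * L)) ->
            exists L, is_S k (RtoC r) L /\ in_CMZV k N L).
  { intros N r (L & HL & HZ). exists L. split; [exact HL|]. now rewrite Cmult_1_l in HZ. }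
  assert (I2 : / sqrt 2 = sqrt 2 / 2) by (rewrite <- H2 at 3; field; lra).
  assert (I3 : / sqrt 3 = sqrt 3 / 3) by (rewrite <- H3 at 3; field; lra).
  assert (I5 : / sqrt 5 = sqrt 5 / 5) by (rewrite <- H5 at 3; field; lra).
  assert (Is : / (1 + sqrt 2) = sqrt 2 - 1).
  { apply Rmult_eq_reg_l with (1 + sqrt 2); [|lra]. rewrite Rinv_r by lra. lra. }
  assert (Ig : / ((1 + sqrt 5) / 2) = (sqrt 5 - 1) / 2).
  { apply Rmult_eq_reg_l with ((1 + sqrt 5) / 2); [|lra]. rewrite Rinv_r by lra. lra. }
  (* In each case [q0 > 1] solves [(q0 - 1/q0)^2 = -z], and [u] is [3/4], [1], [sqrt 2 / 4], [1/2],
     [2 sqrt 5 / 5], [sqrt 3 / 3] respectively, which determines the rational factor. *)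
  split; [|split; [|split; [|split; [|split]]]].
  - apply Hone, (binomial_series_value k 6 2 _ _ (4 # 3) Hk); unfold Q2R; simpl; try lra.
    apply mobius_in_CMZV_6.
  - apply Hone, (binomial_series_value k 8 (1 + sqrt 2) _ _ (1 # 1) Hk); unfold Q2R; rewrite ?Is; simpl; try lra.
    rewrite <- Is. apply mobius_in_CMZV_8_silver.
  - apply (binomial_series_value k 8 (sqrt 2) _ _ (4 # 1) Hk); unfold Q2R; rewrite ?I2; simpl; try nra.
    rewrite <- I2. apply mobius_in_CMZV_8_sqrt2.
  - apply Hone, (binomial_series_value k 10 ((1 + sqrt 5) / 2) _ _ (2 # 1) Hk); unfold Q2R; rewrite ?Ig; simpl; try nra.
    rewrite <- Ig. apply mobius_in_CMZV_10_golden.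
  - apply (binomial_series_value k 10 (sqrt 5) _ _ (5 # 2) Hk); unfold Q2R; rewrite ?I5; simpl; try nra.
    rewrite <- I5. apply mobius_in_CMZV_10_sqrt5.
  - apply (binomial_series_value k 12 (sqrt 3) _ _ (3 # 1) Hk); unfold Q2R; rewrite ?I3; simpl; try nra.
    rewrite <- I3. apply mobius_in_CMZV_12.
Qed.
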